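(* Let $G$ be a finite group. Then $G$ has exactly $13$ cyclic subgroups if and only if $G$ is isomorphic to one of the following groups: $\mathbb{Z}_{11}\times\mathbb{Z}_{11}$, $\mathbb{Z}_{p^{12}}$ for some prime $p$, $D_{22}$, $SL(2,3)$, $Q_{32}$, $\mathbb{Z}_{11}\rtimes\mathbb{Z}_5$, $\mathbb{Z}_7\rtimes\mathbb{Z}_8$, $\mathbb{Z}_5\rtimes\mathbb{Z}_{16}$, $\mathbb{Z}_3\rtimes\mathbb{Z}_{32}$, or $\mathbb{Z}_7\rtimes\mathbb{Z}_{27}$.
   Context: All cyclic subgroups are counted, including the trivial one. $\mathbb{Z}_n$ is the cyclic group of order $n$; $D_{22}$ is the dihedral group of order $22$; $Q_{32}$ is the generalized quaternion group of order $32$; $SL(2,3)$ is the special linear group of order $24$ ($2\times 2$ matrices of determinant $1$ over the field with $3$ elements). The semidirect products denote the following specific groups (with their GAP Small Group Library identifiers): $\mathbb{Z}_{11}\rtimes\mathbb{Z}_5$ is the non-abelian group of order $55$, SmallGroup(55,1); $\mathbb{Z}_7\rtimes\mathbb{Z}_8=\langle a,b\mid a^7=b^8=1,\ bab^{-1}=a^{-1}\rangle$, SmallGroup(56,1); $\mathbb{Z}_5\rtimes\mathbb{Z}_{16}=\langle a,b\mid a^5=b^{16}=1,\ bab^{-1}=a^{-1}\rangle$, SmallGroup(80,1); $\mathbb{Z}_3\rtimes\mathbb{Z}_{32}=\langle a,b\mid a^3=b^{32}=1,\ bab^{-1}=a^{-1}\rangle$, SmallGroup(96,1); $\mathbb{Z}_7\rtimes\mathbb{Z}_{27}=\langle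 a,b\mid a^7=b^{27}=1,\ bab^{-1}=a^{2}\rangle$, SmallGroup(189,1). *)

(* Defs.v *)
From HB Require Import structures.
From mathcomp Require Import all_boot all_order all_algebra.
From mathcomp Require Import all_fingroup all_solvable.

Set Implicit Arguments.
Unset Strict Implicit.
Unset Printing Implicit Defensive.

Import GroupScope GRing.Theory.

Definition cyclic_subgroups (gT : finGroupType) (G : {group gT}) :
  {set {group gT}} := [set H in subgroups G | cyclic H].

Section SpecialLinear.

Variables (n : nat) (R : finComUnitRingType).

Definition SLgroup : {set {'GL_n[R]}} := [set A | (\det (GLval A) == 1)%R].

Lemma SLgroup_group_set : group_set SLgroup.
Proof.
apply/group_setP; split=> [|A B]; first by rewrite inE GL_1E det1.
by rewrite !inE GL_ME => /eqP dA /eqP dB; rewrite det_mulmx dA dB mulr1.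
Qed.

Canonical SLgroup_group := Group SLgroup_group_set.

End SpecialLinear.

(* [Extremal.gtype q p e] is the semidirect product of Z_q by Z_p in which the
   generator of Z_p acts on Z_q as x |-> e x; the library silently replaces the
   action by the trivial one when e ^ p <> 1 modulo q. *)
Lemma Grp_gtype q p e : 1 < q -> 1 < p -> e ^ p = 1 %[mod q] ->
  [set: Extremal.gtype q p e] \isog
    Grp (a : b : a ^+ q, b ^+ p, a ^ b = a ^+ e).
Proof.
move=> q_gt1 p_gt1 ep1; apply: Extremal.Grp => //.
set b := Zp1 : 'Z_q; have ob : #[b] = q by rewrite order_Zp1 Zp_cast.
have co_e : coprime q e.
  rewrite -(coprime_pexpr _ _ (ltnW p_gt1)) -coprime_modr ep1.
  by rewrite coprime_modr coprimen1.
have Ue : (e%:R : 'Z_#[b])%R \is a GRing.unit by rewrite unitZpE ob.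
pose u := FinRing.unit 'Z_#[b] Ue; exists (Zp_unitm u).
have e_p : ((e ^ p)%:R = 1%:R :> 'Z_#[b])%R.
  by apply: val_inj; rewrite [LHS]val_Zp_nat ?[RHS]val_Zp_nat ob.
have u_p : u ^+ p = 1.
  by apply: val_inj; rewrite FinRing.val_unitX /= -natrX e_p.
have Au : u \in units_Zp #[b] by rewrite inE.
split; first exact: Aut_aut.
  by rewrite order_dvdn -morphX // u_p morph1.
apply/eqP; rewrite autE ?cycle_id // eq_expg_mod_order /=.
by rewrite val_Zp_nat ob // modn_mod.
Qed.

Definition Z11_Z5_gtype : finGroupType := Extremal.gtype 11 5 3.
Definition Z11_Z5 : {group Z11_Z5_gtype} := [set: Z11_Z5_gtype]%G.

Lemma card_Z11_Z5 : #|Z11_Z5| = 55.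
Proof. exact: Extremal.card. Qed.

Lemma nonabelian_Z11_Z5 : ~~ abelian Z11_Z5.
Proof.
apply/negP=> cGG.
have /existsP[[a b]] := isoGrp_hom (@Grp_gtype 11 5 3 isT isT erefl).
rewrite /= !xpair_eqE => /and4P[/eqP defG /eqP a11 /eqP b5 /eqP ab].
have Ga : a \in Z11_Z5 by rewrite inE.
have Gb : b \in Z11_Z5 by rewrite inE.
have a2 : a ^+ 2 = 1.
  have ab' : a ^ b = a by rewrite conjgE (centsP cGG _ Ga _ Gb) mulKg.
  by apply: (mulgI a); rewrite -expgS -ab ab' mulg1.
have a1 : a = 1 by rewrite -a11 (expgD a 10 1) (expgM a 2 5) a2 expg1n mul1g.
have: #|<[a]> <*> <[b]>| = 55 by rewrite defG -card_Z11_Z5.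
rewrite a1 cycle1 joing1G => o_b; suff: #[b] <= 5 by rewrite orderE o_b.
by apply: dvdn_leq => //; rewrite order_dvdn b5.
Qed.

(* Main.v *)
(* Let c(G) be the number of cyclic subgroups of G.

   If G is nilpotent then c is multiplicative over its Sylow subgroups, so G is
   a p-group because 13 is prime. A p-group that is neither cyclic nor a 2-group
   of maximal class has a normal subgroup E of type p x p. Fibring the cyclic
   subgroups of G over those of G / E by L |-> L E / E, the nontrivial fibres
   have p or p ^ 2 elements, up to an even number of fibres of size 3 for p = 2,
   while c(E) = p + 2. Hence c(G) = 2 mod p, so p = 11, and G = E.

   If G is not nilpotent, some p-element x acts nontrivially on a q-subgroup Q
   with q != p (minimal non-nilpotent groups are soluble). The conjugates of
   <x> under Q form an orbit of size |Q : C_Q(x)|, a power of q congruent to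
   1 mod p and at most 11. Counting cyclic subgroups for each such size leaves
   two possibilities: either G is the product of a normal subgroup A of order q
   and a cyclic p-group <x> such that x ^ p centralises A, in which case
   c(G) = q + 2 n with |<x>| = p ^ n, or Q is a quaternion group of order 8
   extended by an element of order 3, and G = SL(2, 3). *)

Require Import Defs.
From HB Require Import structures.
From mathcomp Require Import all_boot all_order all_algebra.
From mathcomp Require Import all_fingroup all_solvable.
From mathcomp Require Import zify.

Set Implicit Arguments.
Unset Strict Implicit.
Unset Printing Implicit Defensive.

Import GroupScope.


(** * Counting cyclic subgroups *)

(** Two ways of counting recur. Every element generates exactly one cyclic subgroup, so the totients
    of the orders of the cyclic subgroups add up to |G|, which links numbers of subgroups to orders.
    And disjoint families of cyclic subgroups, mostly conjugation orbits told apart by the orders of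
    their members or by what they centralise or normalise, have at most 13 members together: most
    configurations die by reaching 14. For p-groups the obstacle is p = 2, where (y e)^2 and y^2 may
    differ by a commutator, so that a fibre over a subgroup of order 2 can have odd size. Otherwise,
    q > 6 leaves no room for two subgroups of order q, and normality is immediate. For q = 3 or 5
    there is room, and normality is fought for with a 2-element inverting an element of order q. For
    q = 2 the acting prime is 3; beside the quaternion group there remains a Q of order 4, which is
    excluded by the parity of 13 when it is a Sylow subgroup, unless it acts nontrivially on a
    cyclic subgroup of odd order, and this leads back to an acting 2-element. *)

Local Notation cyc := cyclic_subgroups.

Section Counting.

Variable gT : finGroupType.
Implicit Types (G H K L P Q : {group gT}) (S : {set {group gT}}).

Lemma mem_cyc G L : (L \in cyc G) = (L \subset G) && cyclic L.
Proof. by rewrite !inE. Qed.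

Lemma cycle_cyc G x : (<[x]>%G \in cyc G) = (x \in G).
Proof. by rewrite mem_cyc cycle_cyclic andbT cycle_subG. Qed.

Lemma cycS G H : H \subset G -> cyc H \subset cyc G.
Proof.
move=> sHG; apply/subsetP=> L; rewrite !mem_cyc => /andP[sLH ->].
by rewrite (subset_trans sLH).
Qed.

Lemma cyc1 G : 1%G \in cyc G.
Proof. by rewrite mem_cyc sub1G cyclic1. Qed.

Lemma cyc_imset G : cyc G = [set <[x]>%G | x in G].
Proof.
apply/setP=> L; apply/idP/imsetP=> [|[x Gx ->]]; last by rewrite cycle_cyc.
rewrite mem_cyc => /andP[sLG /cyclicP[x defL]]; exists x.
  by rewrite -cycle_subG -defL.
exact: val_inj.
Qed.

Lemma leq_cyc_card G : #|cyc G| <= #|G|.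
Proof. by rewrite cyc_imset leq_imset_card. Qed.

Lemma cyc_sub_eq G H : H \subset G -> #|cyc G| <= #|cyc H| -> G :=: H.
Proof.
move=> sHG le_c; have /eqP defc: cyc H == cyc G by rewrite eqEcard cycS.
apply/eqP; rewrite eqEsubset sHG andbT; apply/subsetP=> x.
by rewrite -cycle_cyc -defc cycle_cyc.
Qed.

(** Sort elements by the cyclic subgroup they generate: a cyclic group of order m has [totient m]
    generators. *)
Lemma sum_totient_cyc S : {in S, forall L : {group gT}, cyclic L} ->
  \sum_(L in S) totient #|L| = #|[set x | <[x]>%G \in S]|.
Proof.
move=> cycS; rewrite -sum1dep_card (partition_big (fun x => <[x]>%G) (mem S)) //=.
apply: eq_bigr => L SL; have /cyclicP[a defL] := cycS L SL.
rewrite defL -orderE totient_gen -sum1dep_card; apply: eq_bigl => x.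
rewrite /generator; apply/idP/andP=> [/eqP def_a | [_ /eqP defx]].
  have ->: <[x]>%G = L by apply: val_inj; rewrite /= -def_a defL.
  by [].
by rewrite -defL -defx.
Qed.

Lemma sum_totient_cyc_group G : \sum_(L in cyc G) totient #|L| = #|G|.
Proof.
rewrite sum_totient_cyc => [|L]; last by rewrite mem_cyc => /andP[].
by congr #|pred_of_set _|; apply/setP=> x; rewrite inE cycle_cyc.
Qed.

Lemma sum_totient_cycD G H : H \subset G ->
  \sum_(L in cyc G :\: cyc H) totient #|L| = #|G| - #|H|.
Proof.
move=> sHG; rewrite -!sum_totient_cyc_group [\sum_(L in cyc G) _](big_setID (cyc H)) /=.
by rewrite (setIidPr (cycS sHG)) addKn.
Qed.

Lemma sum_card_leq S (s : seq {set {group gT}}) :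
    all (fun A : {set {group gT}} => A \subset S) s ->
    pairwise (fun A B : {set {group gT}} => [disjoint A & B]) s ->
  sumn (map (fun A : {set {group gT}} => #|A|) s) <= #|S|.
Proof.
elim: s S => //= A s IHs S /andP[sAS sS] /andP[dAs ps].
rewrite -(cardsID A S) (setIidPr sAS) leq_add2l; apply: IHs => //.
apply/allP=> B sB; rewrite subsetD (allP sS) // disjoint_sym.
exact: (allP dAs).
Qed.

Lemma JG_cyc G x L : x \in 'N(G) -> (('JG%act L x) \in cyc G) = (L \in cyc G).
Proof. by move=> nGx; rewrite !mem_cyc /= cyclicJ -{1}(normP nGx) conjSg. Qed.

Lemma acts_cyc G P : P \subset 'N(G) -> [acts P, on cyc G | 'JG].
Proof. by move=> nGP; apply/actsP=> x Px L; apply: JG_cyc; apply: (subsetP nGP). Qed.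

Lemma orbitJG_P Q L K :
  reflect (exists2 u, u \in Q & K :=: L :^ u) (K \in orbit 'JG Q L).
Proof.
apply: (iffP imsetP) => [] [u Qu defK]; exists u => //; first by rewrite defK.
exact: val_inj.
Qed.

Lemma card_orbitJG Q L : #|orbit 'JG Q L| = #|Q : 'N_Q(L)|.
Proof. by rewrite card_orbit astab1JG. Qed.

Lemma orbitJG_cyc G Q L : Q \subset G -> L \in cyc G -> orbit 'JG Q L \subset cyc G.
Proof.
move=> sQG cL; apply/subsetP=> K /imsetP[u Qu ->].
by rewrite JG_cyc // (subsetP (normG G)) // (subsetP sQG).
Qed.

Lemma acts_cycD G H P : P \subset 'N(G) -> P \subset 'N(H) ->
  [acts P, on cyc G :\: cyc H | 'JG].
Proof.
move=> nGP nHP; apply/actsP=> x Px L.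
by rewrite !in_setD !JG_cyc ?(subsetP nGP) ?(subsetP nHP).
Qed.

(** [D] and [L] are recovered from [D <*> L] as its normal Hall subgroups for p and p', so the join
    is injective on pairs. *)
Lemma card_cyc_join p P S :
    p.-group P -> {in S, forall L, p^'.-group L /\ L \subset 'C(P)} ->
  #|[set (u.1 <*> u.2)%G | u : {group gT} * {group gT} in setX (cyc P) S]| = (#|cyc P| * #|S|)%N.
Proof.
move=> pP hS; rewrite card_in_imset ?cardsX //.
suff core D L : D \in cyc P -> L \in S ->
   ('O_p(D <*> L) = D :> {set gT}) /\ ('O_p^'(D <*> L) = L :> {set gT}).
  move=> [D L] [D1 L1] /setXP[/= cD SL] /setXP[/= cD1 SL1] /(congr1 val) /= eqDL.
  have [eD eL] := core _ _ cD SL; have [eD1 eL1] := core _ _ cD1 SL1.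
  congr (_, _); apply: val_inj; first by rewrite /= -eD eqDL eD1.
  by rewrite /= -eL eqDL eL1.
rewrite mem_cyc => /andP[sDP cD] SL; have [p'L cLP] := hS _ SL.
have pD := pgroupS sDP pP; have cLD := subset_trans cLP (centS sDP).
have tiDL : D :&: L = 1 := coprime_TIg (pnat_coprime pD p'L).
have defDL : D \x L = D <*> L by rewrite dprodEY.
have [_ defM _ _] := dprodP defDL.
have hD : p.-Hall(D <*> L) D.
  rewrite pHallE joing_subl -(dprod_card defDL) partnM ?cardG_gt0 //=.
  by rewrite (part_pnat_id pD) part_p'nat // muln1.
have hL : p^'.-Hall(D <*> L) L.
  rewrite pHallE joing_subr -(dprod_card defDL) partnM ?cardG_gt0 //=.
  by rewrite (part_pnat_id p'L) part_p'nat ?mul1n // pnatNK.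
split; apply: normal_Hall_pcore => //.
  by rewrite /normal joing_subl join_subG normG cents_norm.
by rewrite /normal joing_subr join_subG normG cents_norm // centsC.
Qed.

Lemma joing_cyc p G P L D : p.-group P -> p^'.-group L -> L \subset 'C(P) ->
  D \in cyc P -> cyclic L -> P \subset G -> L \subset G -> (D <*> L)%G \in cyc G.
Proof.
move=> pP p'L cLP; rewrite !mem_cyc => /andP[sDP cD] cL sPG sLG.
rewrite /= join_subG (subset_trans sDP) // sLG /=.
have cLD := subset_trans cLP (centS sDP).
have coDL := pnat_coprime (pgroupS sDP pP) p'L.
by rewrite (cyclic_dprod (dprodEY cLD (coprime_TIg coDL))).
Qed.

End Counting.

Lemma isog_cyc (gT rT : finGroupType) (G : {group gT}) (H : {group rT}) :
  G \isog H -> #|cyc G| = #|cyc H|.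
Proof.
case/isogP=> f injf defH.
suff ->: cyc H = [set (f @* L)%G | L in cyc G].
  rewrite card_in_imset // => L K; rewrite !mem_cyc => /andP[sLG _] /andP[sKG _].
  by move/(congr1 val)/(injm_morphim_inj injf sLG sKG)/val_inj.
apply/setP=> K; apply/idP/imsetP=> [|[L]]; last first.
  rewrite !mem_cyc => /andP[sLG cL] ->.
  by rewrite /= morphim_cyclic // -defH morphimS.
rewrite mem_cyc -defH => /andP[sKH cK]; exists (f @*^-1 K)%G; last first.
  by apply: val_inj; rewrite /= morphpreK.
rewrite mem_cyc /= subsetIl /= -(injm_cyclic injf) ?subsetIl //.
by rewrite morphpreK.
Qed.

(** * Groups of prime power order *)

Lemma card_cyc_cyclic_pgroup (gT : finGroupType) (G : {group gT}) p n :
  prime p -> cyclic G -> #|G| = (p ^ n)%N -> #|cyc G| = n.+1.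
Proof.
move=> p_pr cG oG; have p_gt1 := prime_gt1 p_pr.
have /cyclicP[x defG] := cG; have ox : #[x] = (p ^ n)%N by rewrite orderE -defG.
pose f (i : 'I_n.+1) := <[x ^+ (p ^ i)]>%G.
have of_ i : #|f i| = (p ^ (n - i))%N by rewrite -orderE (orderXexp _ ox).
have sfG i : f i \subset G by rewrite defG cycle_subG mem_cycle.
suff ->: cyc G = f @: setT.
  rewrite card_imset ?cardsT ?card_ord // => i j eqf; apply: val_inj => /=.
  have /eqP: #|f i| = #|f j| by rewrite eqf.
  rewrite !of_ eqn_exp2l // => /eqP e.
  by have := ltn_ord i; have := ltn_ord j; rewrite !ltnS => jn in_;
    rewrite -(subKn jn) -e subKn.
apply/setP=> L; apply/idP/imsetP=> [|[i _ ->]]; last first.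
  by rewrite mem_cyc sfG cycle_cyclic.
rewrite mem_cyc => /andP[sLG cL].
have /(dvdn_pfactor _ _ p_pr)[m le_mn oL] : #|L| %| p ^ n.
  by rewrite -oG cardSg.
have lt_nm : n - m < n.+1 by rewrite ltnS leq_subr.
exists (Ordinal lt_nm) => //; apply: val_inj; apply/eqP.
by rewrite [_ == _](eq_subG_cyclic cG) // of_ oL /= subKn.
Qed.

Lemma card_cyc_p2Elem (gT : finGroupType) (A : {set gT}) (E : {group gT}) p :
  prime p -> E \in 'E_p^2(A) -> #|cyc E| = p.+2.
Proof.
move=> p_pr E2E; have [_ abE _] := pnElemP E2E.
rewrite -(card_p1Elem_p2Elem E2E) (cardsD1 1%G (cyc E)) cyc1 add1n; congr _.+1.
apply: eq_card => L; rewrite p1ElemE // !inE; apply/andP/andP=> [] [].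
  move=> ntL /andP[sLE cL]; split=> //.
  by rewrite (cyclic_abelem_prime (abelemS sLE abE)) // -val_eqE.
move=> sLE /eqP oL; rewrite sLE prime_cyclic ?oL //; split=> //.
by apply: contraTneq p_pr => L1; rewrite -oL L1 cards1.
Qed.

Section Extremal.

Variable gT : finGroupType.
Implicit Type G : {group gT}.

(** Outside the cyclic subgroup <x> of index 2, dihedral groups have only involutions and quaternion
    groups only elements of order 4; in a semidihedral group everything there is conjugate to [y] or
    to [x * y], of orders 2 and 4. *)
Lemma extremal2_orders G n x y : extremal_generators G 2 n (x, y) ->
    extremal2 G -> (extremal_class G == SemiDihedral) ==> (#[y] == 2) ->
  {in G :\: <[x]>, forall z, #[z] \in [:: 2; 4]} /\
  (extremal_class G != Quaternion -> #[y] = 2).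
Proof.
move=> genG xG oy; have [_ _ _ Yy] := genG.
have [[_ ordz _ _] _ _ [defD _ _] _] := extremal2_structure genG xG oy.
have [sd | nsd] := eqVneq (extremal_class G) SemiDihedral.
  move: oy ordz; rewrite sd /= => /eqP oy oxy; split=> // z.
  rewrite -defD !inE; case/orP=> /imsetP[g _ ->]; rewrite orderJ ?oy ?oxy //.
move: ordz; rewrite (negPf nsd) => ordz; split=> [z Dz | nq].
  by rewrite (ordz z Dz); case: ifP.
rewrite (ordz y Yy); suff /eqP->: extremal_class G == Dihedral by [].
move: xG nsd nq; rewrite /extremal2 /=; by case: (extremal_class G).
Qed.

Lemma extremal2_generators G : extremal2 G ->
  exists n, exists x, exists2 y, 1 < n & extremal_generators G 2 n (x, y) /\
    ((extremal_class G == SemiDihedral) ==> (#[y] == 2)).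
Proof.
move=> xG; case: (boolP (extremal_class G == Dihedral)) => [dG | ndG].
  have [n n_gt1 isoG] := (dihedral_classP G).1 (eqP dG); exists n.
  have [[x y] gen _] := generators_2dihedral n_gt1 isoG.
  by exists x, y => //; split=> //; rewrite (eqP dG).
case: (boolP (extremal_class G == SemiDihedral)) => [dG | nsG].
  have [n n_gt3 isoG] := (semidihedral_classP G).1 (eqP dG); exists n.
  have [[x y] gen [oy _]] := generators_semidihedral n_gt3 isoG.
  by exists x, y; rewrite ?(ltn_trans _ n_gt3) // oy eqxx implybT.
have /quaternion_classP[n n_gt2 isoG]: extremal_class G = Quaternion.
  by move: xG ndG nsG; rewrite /extremal2 /=; case: (extremal_class G).
exists n; have [[x y] gen _] := generators_quaternion n_gt2 isoG.
by exists x, y; rewrite ?(ltn_trans _ n_gt2) // (negPf nsG).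
Qed.

Lemma card_cyc_index2 G n x y : 0 < n -> extremal_generators G 2 n (x, y) ->
  #|cyc G| = n + #|cyc G :\: cyc <[x]>| /\
  \sum_(L in cyc G :\: cyc <[x]>) totient #|L| = (2 ^ n.-1)%N.
Proof.
case: n => // n _ [oG Gx ox _]; have sxG : <[x]> \subset G by rewrite cycle_subG.
rewrite sum_totient_cycD // oG -orderE ox /= expnS mul2n -addnn addnK; split=> //.
rewrite -(cardsID (cyc <[x]>) (cyc G)) (setIidPr (cycS sxG)).
by rewrite (card_cyc_cyclic_pgroup (p := 2) (n := n)) ?cycle_cyclic.
Qed.

Lemma mem_cycD G x (L : {group gT}) : L \in cyc G :\: cyc <[x]> ->
  exists2 z, z \in G :\: <[x]> & #|L| = #[z].
Proof.
rewrite in_setD (cyc_imset G) => /andP[nL /imsetP[z Gz defL]]; exists z.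
  by rewrite inE Gz andbT; move: nL; rewrite defL cycle_cyc.
by rewrite defL.
Qed.

(** Let k count the cyclic subgroups outside <x>. Each has one or two generators, so 2^(n-2) <= k <=
    2^(n-1), and n + k = 13 leaves only n = 5, k = 8. Then all k have order 4, so there is no
    involution outside <x> and G is quaternion. *)
Lemma extremal2_cyc13 G : extremal2 G -> #|cyc G| = 13 -> G \isog 'Q_32.
Proof.
move=> xG c13; have [n [x [y n_gt1 [gen oy]]]] := extremal2_generators xG.
have [ordz yQ] := extremal2_orders gen xG oy.
have [cE sumE] := card_cyc_index2 (ltnW n_gt1) gen.
have le1 : #|cyc G :\: cyc <[x]>| <= 2 ^ n.-1.
  rewrite -sumE -sum1_card; apply: leq_sum => L _.
  by rewrite totient_gt0 cardG_gt0.
have le2 : 2 ^ n.-1 <= 2 * #|cyc G :\: cyc <[x]>|.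
  rewrite -sumE -sum1_card big_distrr; apply: leq_sum => L /mem_cycD[z Dz ->].
  by have:= ordz z Dz; rewrite !inE => /orP[] /eqP->.
have n5 : n = 5.
  case: n n_gt1 {gen sumE} cE le1 le2 => // [[|[|[|[|[|n]]]]]] //=;
    rewrite ?c13 // => _; move: #|_| => k; try lia.
  by move=> e _; rewrite !expnS; have:= expn_gt0 2 n; lia.
case: (boolP (extremal_class G == Quaternion)) => [| /yQ y2].
  case/eqP/quaternion_classP=> m m_gt2 isoG.
  have: #|G| = (2 ^ m)%N by rewrite (card_isog isoG) card_quaternion.
  case: gen => -> _ _ _ /eqP; rewrite eqn_exp2l // n5 => /eqP e.
  by move: isoG; rewrite -e.
have e16: (2 * #|cyc G :\: cyc <[x]>| = 16)%N by lia.
have [_ _ _ Dy] := gen; have Ly : <[y]>%G \in cyc G :\: cyc <[x]>.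
  by rewrite inE !cycle_cyc -in_setD.
suff: 16 < 2 * #|cyc G :\: cyc <[x]>| by rewrite e16.
rewrite (_ : 16 = 2 ^ n.-1)%N ?n5 // -n5 -sumE -sum1_card big_distrr /=.
rewrite (bigD1 <[y]>%G) //= [X in _ < X](bigD1 <[y]>%G) //= -orderE y2 /=.
rewrite ltnS; apply: leq_sum => L /andP[/mem_cycD[z Dz ->] _].
by have:= ordz z Dz; rewrite !inE => /orP[] /eqP->.
Qed.

End Extremal.

Lemma card_cyc_Q32 : #|cyc [set: 'Q_32]%G| = 13.
Proof.
have isoQ : [set: 'Q_32]%G \isog 'Q_(2 ^ 5) by apply: isog_refl.
have [[x y] gen [oy y2 xy]] := generators_quaternion (isT : 2 < 5) isoQ.
have [[_ ordz _] _ _ _ _] := quaternion_structure (isT : 2 < 5) gen isoQ.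
have [-> sumE] := card_cyc_index2 (isT : 0 < 5) gen.
suff: (#|cyc [set: 'Q_32]%G :\: cyc <[x]>| * 2 = 2 ^ 4)%N by lia.
rewrite -sumE -sum_nat_const; apply: eq_bigr => L /mem_cycD[z Dz ->].
by rewrite ordz.
Qed.

(** * Fibres of the cyclic subgroups over a quotient *)

Section Fibres.

Variables (gT : finGroupType) (G E : {group gT}).
Hypothesis nEG : E <| G.
Implicit Types (L : {group gT}) (M : {group coset_of E}).

Definition cyc_fibre M := [set L in cyc G | (L / E)%G == M].

Lemma in_cyc_fibre M L : (L \in cyc_fibre M) = (L \in cyc G) && ((L / E)%G == M).
Proof. exact: in_set. Qed.

Lemma card_coset_preim (A : {set coset_of E}) : A \subset G / E ->
  #|[set x in G | coset E x \in A]| = (#|A| * #|E|)%N.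
Proof.
have [sEG nEG'] := andP nEG; move=> sAG.
rewrite -sum1_card (partition_big (coset E) (mem A)) /=; last first.
  by move=> x; rewrite inE => /andP[].
rewrite -sum_nat_const; apply: eq_bigr => c Ac.
have /morphimP[y Ny Gy defc] := subsetP sAG c Ac.
rewrite -(card_rcoset E y) -sum1_card; apply: eq_bigl => x; rewrite inE.
apply/andP/idP=> [[/andP[Gx _] /eqP eq_xc] | Exy].
  by apply/rcoset_kercosetP; rewrite ?(subsetP nEG') // eq_xc defc.
have Gx : x \in G.
  by case/rcosetP: Exy => e Ee ->; apply: groupM => //; apply: (subsetP sEG).
have -> : coset E x = c.
  by rewrite defc; apply/rcoset_kercosetP; rewrite ?(subsetP nEG').
by rewrite Gx Ac eqxx.
Qed.

Lemma card_cyc_fibres : #|cyc G| = \sum_(M in cyc (G / E)%G) #|cyc_fibre M|.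
Proof.
rewrite -sum1_card (partition_big (fun L => (L / E)%G) (mem (cyc (G / E)%G))) /=.
  apply: eq_bigr => M _; rewrite -sum1_card; apply: eq_bigl => L.
  by rewrite in_cyc_fibre.
move=> L; rewrite !mem_cyc => /andP[sLG cL].
by rewrite quotientS // quotient_cyclic.
Qed.

Lemma cyc_fibre1 : cyc_fibre 1%G = cyc E.
Proof.
have [sEG nEG'] := andP nEG; apply/setP=> L; rewrite in_cyc_fibre !mem_cyc -andbA.
apply/and3P/andP=> [[sLG cL /eqP/(congr1 val)/= LE1] | [sLE cL]].
  by rewrite -quotient_sub1 ?LE1 // (subset_trans sLG).
split=> //; first exact: subset_trans sEG.
by rewrite -val_eqE /= quotientS1.
Qed.

(** An element of G generates a member of the fibre exactly when its image generates M, and each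
    generator of M has |E| preimages. *)
Lemma sum_totient_fibre M : M \in cyc (G / E)%G ->
  \sum_(L in cyc_fibre M) totient #|L| = (#|E| * totient #|M|)%N.
Proof.
have [sEG nEG'] := andP nEG; rewrite mem_cyc => /andP[sMG cM].
rewrite sum_totient_cyc => [|L]; last by rewrite in_cyc_fibre mem_cyc => /andP[/andP[]].
have [c defM] := cyclicP cM; rewrite defM -orderE totient_gen mulnC.
rewrite -card_coset_preim; last first.
  apply/subsetP=> d; rewrite inE => /eqP d_gen.
  by apply: subsetP sMG _ _; rewrite defM d_gen cycle_id.
congr #|pred_of_set _|; apply/setP=> x.
rewrite in_set in_cyc_fibre cycle_cyc in_set in_set.
rewrite -val_eqE /= defM /generator; case Gx: (x \in G) => //=.
by rewrite quotient_cycle ?(subsetP nEG') // eq_sym.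
Qed.

Lemma mem_cyc_fibre M L : L \in cyc_fibre M ->
  exists x, [/\ x \in G, L :=: <[x]> & M :=: <[coset E x]>].
Proof.
rewrite in_cyc_fibre cyc_imset => /andP[/imsetP[x Gx ->] /eqP/(congr1 val)/= defM].
exists x; split=> //; rewrite -defM quotient_cycle //.
by rewrite (subsetP (normal_norm nEG)).
Qed.

End Fibres.

(** * A normal subgroup of type (p, p) in a p-group *)

Section NormalP2.

Variables (gT : finGroupType) (p : nat) (G E : {group gT}).
Hypotheses (pG : p.-group G) (E2 : E \in 'E_p^2(G)) (nEG : E <| G).

Let sEG := normal_sub nEG.
Let nEG' := normal_norm nEG.
Let p_pr : prime p := pnElem_prime E2.
Let abE : p.-abelem E. Proof. by have [] := pnElemP E2. Qed.
Let oE : #|E| = (p ^ 2)%N. Proof. exact: card_pnElem E2. Qed.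
Let ntE : E :!=: 1.
Proof.
by rewrite trivg_card1 oE -(exp1n 2) eqn_exp2r // -(eqn_exp2r _ _ (isT : 0 < 1)) neq_ltn prime_gt1 ?orbT.
Qed.

(** Nilpotency makes [E, G] proper in E, hence of order 1 or p. A normal subgroup of order p is
    central; if [E, G] = 1, then E is central and any of its subgroups of order p serves. *)
Lemma commEG_central : exists Z : {group gT},
  [/\ #|Z| = p, Z \subset E, Z \subset 'Z(G) & [~: E, G] \subset Z].
Proof.
have nilG := pgroup_nil pG; have p_gt1 := prime_gt1 p_pr.
have prD : [~: E, G] \proper E.
  by apply: nil_comm_properl nilG _ _ _; rewrite // subsetI subxx.
have [D1 | ntD] := eqVneq [~: E, G] 1.
  have [|x Ex ox] := Cauchy p_pr (_ : p %| #|E|); first by rewrite oE dvdn_exp.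
  exists <[x]>%G; rewrite -orderE ox D1 sub1G cycle_subG Ex subsetI.
  rewrite !cycle_subG (subsetP sEG x Ex) (subsetP _ x Ex) //.
  by apply/commG1P; rewrite D1.
have oD : #|[~: E, G]| = p.
  have [k le_k oD] : exists2 k, k <= 2 & #|[~: E, G]| = (p ^ k)%N.
    by apply/dvdn_pfactor; rewrite // -oE cardSg // proper_sub.
  have := proper_card prD; move: ntD; rewrite trivg_card1 oD oE.
  by rewrite ltn_exp2l //; case: k {le_k oD} => [|[|]].
have nDG : [~: E, G] <| G by rewrite /normal commg_normr andbT comm_subG.
exists [~: E, G]%G; rewrite oD proper_sub //; split=> //.
by apply: prime_meetG; rewrite /= ?oD // meet_center_nil.
Qed.

Let expE e : e \in E -> e ^+ p = 1.
Proof. by case/(abelemP p_pr): abE => _; apply. Qed.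

(** As [e, y] is central, (y e)^m = y^m e^m [e, y]^C(m, 2). For m = p^k the factor e^m vanishes, and
    p divides C(m, 2) unless p = 2 and k = 1: hence the three alternatives. *)
Lemma normalp2_expg e y k : e \in E -> y \in G -> 0 < k ->
    [|| odd p, 1 < k | [~ e, y] == 1] ->
  (y * e) ^+ (p ^ k) = y ^+ (p ^ k).
Proof.
move=> Ee Gy k_gt0 reg; have [Z [_ sZE cZ sDZ]] := commEG_central.
have Zc : [~ e, y] \in Z by rewrite (subsetP sDZ) ?mem_commg.
have cc x : x \in G -> commute x [~ e, y].
  by move=> Gx; have /centerP[_ /(_ x Gx)] := subsetP cZ _ Zc.
rewrite (expMg_Rmul _ (cc e (subsetP sEG e Ee)) (cc y Gy)); case: k k_gt0 reg => // k _ reg.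
rewrite {2}expnS expgM expE // expg1n mulg1.
have [->|reg'] := eqVneq [~ e, y] 1; first by rewrite expg1n mulg1.
suff /dvdnP[m ->]: p %| 'C(p ^ k.+1, 2).
  by rewrite mulnC expgM expE ?expg1n ?mulg1 // (subsetP sZE).
have := mul_bin_diag (p ^ k.+1) 1; rewrite (negPf reg') orbF in reg.
have [p_odd eC | /(prime_oddPn p_pr) p2] := boolP (odd p).
  rewrite -(@Gauss_dvdr _ 2) ?coprimen2 // -eC expnS -mulnA.
  exact: dvdn_mulr.
case: k reg => [|k _]; first by rewrite p2.
rewrite p2 !expnS -!mulnA => /eqP; rewrite eqn_pmul2l // => /eqP <-.
exact: dvdn_mulr.
Qed.

(** [x] is y^i e with i prime to p and e in E, so it has the same p^k-th power as y^i; and an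
    element whose image has order p^k has order p^k times that of its p^k-th power. *)
Lemma normalp2_order x y k : x \in G -> y \in G -> 0 < k ->
    <[coset E x]> = <[coset E y]> -> #[coset E y] = (p ^ k)%N ->
    [|| odd p, 1 < k | y \in 'C(E)] ->
  #[x] = #[y].
Proof.
move=> Gx Gy k_gt0 eq_xy oy reg.
have Ny : y \in 'N(E) by apply: (subsetP nEG').
have Nx : x \in 'N(E) by apply: (subsetP nEG').
have /cycleP[i def_x] : coset E x \in <[coset E y]> by rewrite -eq_xy cycle_id.
have co_i : coprime p i.
  have: generator <[coset E y]> (coset E y ^+ i) by rewrite /generator -def_x eq_xy.
  by rewrite generator_coprime oy coprime_pexpl.
have Gyi : y ^+ i \in G by rewrite groupX.
have [e Ee ->] : exists2 e, e \in E & x = y ^+ i * e.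
  have: x \in E :* (y ^+ i).
    by apply/rcoset_kercosetP; rewrite ?groupX // def_x -morphX.
  rewrite norm_rlcoset ?groupX // => /lcosetP[e Ee ->]; by exists e.
have -> : #[y] = #[y ^+ i].
  have /p_natP[m om] : p.-nat #[y] by apply: (mem_p_elt pG).
  by rewrite orderXgcd om (eqP (coprimeXl _ co_i)) divn1.
have oyi : #[coset E (y ^+ i)] = (p ^ k)%N.
  by rewrite morphX // -def_x -oy !orderE eq_xy.
have oyie : #[coset E (y ^+ i * e)] = (p ^ k)%N.
  have Ne : e \in 'N(E) by rewrite (subsetP (normG E)).
   by rewrite morphM ?groupX //= (coset_id Ee) mulg1.
have dvd z : z \in G -> #[coset E z] = (p ^ k)%N ->
    #[z] = (p ^ k * #[z ^+ (p ^ k)])%N.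
  move=> Gz oz; have dv : p ^ k %| #[z] by rewrite -oz morph_order ?(subsetP nEG').
  by rewrite orderXdiv // mulnC divnK.
have Ge := subsetP sEG e Ee.
rewrite dvd ?groupM // [in RHS]dvd // normalp2_expg //.
case/or3P: reg => [-> // | -> | cEy]; first by rewrite orbT.
suff /eqP-> : [~ e, y ^+ i] == 1 by rewrite eqxx !orbT.
by apply/commgP/commuteX; apply/esym; apply: (centP cEy).
Qed.

(** All members of the fibre have the same order, p^k or p^(k+1). Dividing |E| totient(p^k) by the
    totient of that order gives p^2 or p members. *)
Lemma card_cyc_fibre_regular (M : {group coset_of E}) k :
    M \in cyc (G / E)%G -> #|M| = (p ^ k)%N -> 0 < k ->
    [|| odd p, 1 < k | M \subset 'C_G(E) / E] ->
  p %| #|cyc_fibre G M|.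
Proof.
move=> cM oM k_gt0 reg; have p_gt0 := prime_gt0 p_pr.
have sum_eq := sum_totient_fibre nEG cM.
have [-> | [L0 fL0]] := set_0Vmem (cyc_fibre G M); first by rewrite cards0.
have [y [Gy _ defM]] := mem_cyc_fibre nEG fL0.
have oy : #[coset E y] = (p ^ k)%N by rewrite orderE -defM.
have reg' : [|| odd p, 1 < k | y \in 'C(E)].
  case/or3P: reg => [->|->|]; rewrite ?orbT //; rewrite defM cycle_subG.
  case/morphimP=> z _ /setIP[Gz Cz] eq_yz.
  have: y \in E :* z by apply/rcoset_kercosetP; rewrite ?(subsetP nEG').
  case/rcosetP=> e Ee ->; rewrite groupM ?orbT //.
  by rewrite (subsetP (abelem_abelian abE)).
rewrite oE oM in sum_eq; move: sum_eq.
rewrite (eq_bigr (fun=> totient #[y])) => [|L /(mem_cyc_fibre nEG)[x [Gx -> defM']]];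
  last by rewrite -orderE (normalp2_order Gx Gy k_gt0) // -defM' defM.
rewrite sum_nat_const.
have Eyk : y ^+ (p ^ k) \in E.
  by apply: coset_idr; rewrite ?groupX ?(subsetP nEG') // morphX ?(subsetP nEG') // -oy expg_order.
have -> : #[y] = (p ^ k * #[y ^+ (p ^ k)])%N.
  have dv : p ^ k %| #[y] by rewrite -oy morph_order ?(subsetP nEG').
  by rewrite orderXdiv // mulnC divnK.
have dvp : #[y ^+ (p ^ k)] %| p by rewrite order_dvdn expE.
have phi_gt0 : 0 < totient (p ^ k) by rewrite totient_gt0 expn_gt0 p_gt0.
have [/eqP-> | /eqP->] := orP ((proj2 (primeP p_pr)) _ dvp).
  by rewrite muln1 => /eqP; rewrite eqn_pmul2r // => /eqP->; rewrite dvdn_exp.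
have -> : totient (p ^ k * p) = (p * totient (p ^ k))%N.
  rewrite -expnSr !totient_pfactor //=; case: (k) k_gt0 => // k' _.
  by rewrite expnS mulnCA.
rewrite mulnA => /eqP; rewrite eqn_pmul2r // expnS expn1 eqn_pmul2r //.
by move/eqP->.
Qed.

(** For e in E outside the central Z, E = Z <e>, so C_G(E) = C_G(e); and the conjugates of e stay in
    the coset e Z, of size 2. *)
Lemma card_cent_p2 : p = 2 -> #|G : 'C_G(E)| <= 2.
Proof.
move=> p2; have [Z [oZ sZE cZ sDZ]] := commEG_central; rewrite p2 in oZ.
have oE4 : #|E| = 4 by rewrite oE p2.
have abE2 : 2.-abelem E by rewrite -p2.
have [e Ee nZe] : exists2 e, e \in E & e \notin Z.
  by apply/subsetPn/negP=> /subset_leq_card; rewrite oE4 oZ.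
have defE : Z * <[e]> = E.
  apply/eqP; rewrite eqEcard mul_subG ?cycle_subG //= oE4.
  have tiZe : Z :&: <[e]> = 1.
    rewrite setIC; apply: prime_TIg; rewrite ?cycle_subG // -orderE.
    by rewrite (abelem_order_p abE2) //; apply: contraNneq nZe => ->.
  rewrite TI_cardMg // oZ -orderE (abelem_order_p abE2) //.
  by apply: contraNneq nZe => ->.
have -> : 'C_G(E) = 'C_G[e].
  rewrite -defE centM setIA cent_cycle; congr (_ :&: _); apply/setIidPl.
  by rewrite centsC (subset_trans cZ) // subsetIr.
rewrite index_cent1 -oZ -(card_lcoset Z e); apply: subset_leq_card.
apply/subsetP=> f /imsetP[g Gg ->]; rewrite mem_lcoset conjg_mulR mulKg.
by rewrite (subsetP sDZ) // mem_commg.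
Qed.

(** The preimage of M is dihedral of order 8. Its coset y E contains two involutions, each
    generating its own subgroup, and two elements of order 4, which generate the same one. *)
Lemma card_cyc_fibre_irregular (M : {group coset_of E}) : p = 2 ->
    M \in cyc (G / E)%G -> #|M| = 2 -> ~~ (M \subset 'C_G(E) / E) ->
  #|cyc_fibre G M| = 3.
Proof.
move=> p2 cM oM nCM; have [Z [oZ sZE cZ sDZ]] := commEG_central; rewrite p2 in oZ.
have oE4 : #|E| = 4 by rewrite oE p2.
have abE2 : 2.-abelem E by rewrite -p2.
have expE2 e : e \in E -> e ^+ 2 = 1 by rewrite -p2; apply: expE.
have [y0 [Gy0 nCy0 defM0]] : exists y, [/\ y \in G, y \notin 'C(E) & M :=: <[coset E y]>].
  have [c defM] := cyclicP (proj2 (andP (etrans (esym (mem_cyc _ _)) cM))).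
  have Mc : c \in M by rewrite defM cycle_id.
  have [sMG _] := andP (etrans (esym (mem_cyc _ _)) cM).
  have /morphimP[y Ny Gy defc] := subsetP sMG c Mc.
  exists y; split; rewrite // -?defc //; apply: contra nCM => Cy.
  by rewrite defM cycle_subG defc mem_morphim // inE Gy.
have CEZ y : y \in G -> y \notin 'C(E) -> 'C_E[y] = Z.
  move=> Gy nCy; apply/eqP; rewrite eq_sym eqEcard subsetI sZE /=.
  rewrite sub_cent1 (subsetP _ y Gy) /=; last first.
    by rewrite centsC (subset_trans cZ) ?subsetIr.
  have: 'C_E[y] \proper E.
    rewrite properEneq subsetIl andbT; apply: contra nCy => /eqP/setIidPl.
    by rewrite sub_cent1.
  move/proper_card; rewrite oE4 oZ => lt4.
  have : #|'C_E[y]| %| 4 by rewrite -oE4 cardSg ?subsetIl.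
  by case: #|_| lt4 => [|[|[|[|]]]].
have sq y e : y \in G -> e \in E -> (y * e) ^+ 2 = y ^+ 2 * [~ e, y].
  move=> Gy Ee; have Zc : [~ e, y] \in Z by rewrite (subsetP sDZ) ?mem_commg.
  have /setIP[_ /centP cG] := subsetP cZ _ Zc.
  rewrite (@expMg_Rmul _ 2) ?(expE2 e) // ?mulg1 //.
    by apply/esym/cG; rewrite (subsetP sEG).
  exact/esym/cG.
(* If y0^2 is not 1, it is the involution of Z; multiplying y0 by an e that does not commute with it
   multiplies the square by [e, y0], the same involution. *)
have [y [Gy nCy defM y2]] : exists y, [/\ y \in G, y \notin 'C(E),
    M :=: <[coset E y]> & y ^+ 2 = 1].
  have Ny0 := subsetP nEG' _ Gy0.
  have Ey2 : y0 ^+ 2 \in E.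
    by apply: coset_idr; rewrite ?groupX // morphX //= -oM defM0 expg_order.
  have Zy2 : y0 ^+ 2 \in Z.
    by rewrite -(CEZ _ Gy0 nCy0) inE Ey2 groupX ?cent1id.
  have [y21 | ny2] := eqVneq (y0 ^+ 2) 1; first by exists y0.
  have [e Ee nCe] : exists2 e, e \in E & e \notin 'C_E[y0].
    apply/subsetPn/negP=> /subset_leq_card; rewrite (CEZ _ Gy0 nCy0) oZ oE4 //.
  have Ge := subsetP sEG e Ee.
  have ny1 : [~ e, y0] != 1.
    by apply: contra nCe => /commgP cey; rewrite inE Ee; apply/cent1P.
  have Zc : [~ e, y0] \in Z by rewrite (subsetP sDZ) ?mem_commg.
  exists (y0 * e); rewrite groupM // sq // groupMr; last first.
    by rewrite (subsetP (abelem_abelian abE)).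
  split=> //.
    by rewrite defM0 morphM ?(subsetP nEG') //= (coset_id Ee) mulg1.
  have oy2 : #[y0 ^+ 2] = 2 by exact: nt_prime_order (isT : prime 2) (expE2 _ Ey2) ny2.
  have defZ : Z :=: <[y0 ^+ 2]>.
    apply/esym/eqP; rewrite eqEcard cycle_subG Zy2 oZ -orderE.
    by rewrite oy2.
  have: [~ e, y0] \in [set 1; y0 ^+ 2].
    by rewrite -cycle2g -?defZ // oy2.
  by rewrite !inE (negPf ny1) /= => /eqP->; exact: (expE2 _ Ey2).
have memF x : (<[x]>%G \in cyc_fibre G M) = (x \in y *: E).
  rewrite in_cyc_fibre cycle_cyc -norm_rlcoset ?(subsetP nEG') //.
  apply/andP/idP=> [[Gx /eqP/(congr1 val)/=] | ].
    rewrite quotient_cycle ?(subsetP nEG') // => eqM.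
    apply/rcoset_kercosetP; rewrite ?(subsetP nEG') //.
    have: coset E x \in [set 1; coset E y].
      by rewrite -cycle2g ?orderE -?defM // -eqM cycle_id.
    rewrite !inE => /orP[/eqP cx1 | /eqP //].
    by move: oM; rewrite -eqM cx1 cycle1 cards1.
  move=> Ex; have Gx : x \in G.
    by case/rcosetP: Ex => e Ee ->; apply: groupM => //; apply: (subsetP sEG).
  split=> //; apply/eqP/val_inj; rewrite /= quotient_cycle ?(subsetP nEG') // defM.
  by congr <[_]>; apply/rcoset_kercosetP; rewrite ?(subsetP nEG').
have cycF : {in cyc_fibre G M, forall L : {group gT}, cyclic L}.
  by move=> L; rewrite in_cyc_fibre mem_cyc => /andP[/andP[]].
have FE L : L \in cyc_fibre G M -> exists2 e, e \in E & L = <[y * e]>%G.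
  move=> FL; have [x defL] := cyclicP (cycF L FL).
  have defL' : L = <[x]>%G by apply: val_inj.
  by move: FL; rewrite defL' memF => /lcosetP[e Ee ->]; exists e.
have nye e : e \in E -> y * e != 1.
  move=> Ee; apply: contra nCy; rewrite -eq_invg_mul => /eqP yE.
  by rewrite -groupV yE (subsetP (abelem_abelian abE)).
pose S2 := [set L in cyc_fibre G M | #|L| == 2].
have cS2 : #|S2| = 2.
  have -> : #|S2| = \sum_(L in S2) totient #|L|.
    by rewrite -sum1_card; apply: eq_bigr => L; rewrite inE => /andP[_ /eqP->].
  rewrite sum_totient_cyc => [|L]; last by rewrite inE => /andP[/cycF].
  rewrite -oZ -(card_lcoset Z y); apply: eq_card => x.
  rewrite inE inE memF; apply/andP/lcosetP=> [[/lcosetP[e Ee ->]] | [e Ze ->]].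
    rewrite -orderE => /eqP oye; exists e => //.
    rewrite -(CEZ y Gy nCy) inE Ee; apply/cent1P/commgP.
    by rewrite -[X in X == _]mul1g -{1}y2 -sq // -oye expg_order.
  have Ee := subsetP sZE e Ze; rewrite mem_lcoset mulKg Ee -orderE; split=> //.
  apply/eqP/nt_prime_order; rewrite ?nye // sq // y2 mul1g; apply/eqP/commgP.
  by apply/cent1P; move: Ze; rewrite -(CEZ y Gy nCy) inE => /andP[].
have := sum_totient_fibre nEG cM; rewrite oE4 oM muln1.
rewrite (big_setID S2) /= (setIidPr _); last by apply/subsetP=> L; rewrite inE => /andP[].
rewrite (eq_bigr (fun=> 1%N)) => [|L]; last by rewrite inE => /andP[_ /eqP->].
rewrite sum1_card cS2 (eq_bigr (fun=> 2)) => [|L]; last first.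
  rewrite inE => /andP[nS2 FL]; have [e Ee defL] := FE L FL.
  rewrite inE FL /= defL -orderE in nS2.
  have : #[y * e] %| 4.
    have Zc : [~ e, y] \in Z by rewrite (subsetP sDZ) ?mem_commg.
    by rewrite order_dvdn (expgM _ 2 2) (sq y e) // y2 mul1g expE2 ?(subsetP sZE).
  rewrite defL -orderE; move: (order_gt1 (y * e)) nS2; rewrite nye //.
  by case: #[_] => [|[|[|[|[|]]]]].
rewrite sum_nat_const => e4; rewrite -(cardsID S2) (setIidPr _) ?cS2; last first.
  by apply/subsetP=> L; rewrite inE => /andP[].
have: (2 + #|cyc_fibre G M :\: S2| * 2 = 4)%N by exact: e4.
by clear; move: #|_| => k; lia.
Qed.

Lemma dvdn_sum_fibres : 8 < #|G| ->
  p %| \sum_(M in cyc (G / E)%G | M != 1%G) #|cyc_fibre G M|.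
Proof.
move=> G_gt8; have pq : p.-group (G / E) by apply: quotient_pgroup.
have pM (M : {group coset_of E}) : M \in cyc (G / E)%G -> M != 1%G ->
    exists2 k, 0 < k & #|M| = (p ^ k)%N.
  rewrite mem_cyc => /andP[sMG _] ntM.
  have /p_natP[[|k] oM] : p.-group M := pgroupS sMG pq; last by exists k.+1.
  by case/negP: ntM; rewrite -val_eqE /= trivg_card1 oM.
have [odd_p | /(prime_oddPn p_pr) p2] := boolP (odd p).
  apply: dvdn_sum => M /andP[cM ntM]; have [k k_gt0 oM] := pM M cM ntM.
  by apply: (card_cyc_fibre_regular cM oM k_gt0); rewrite odd_p.
have sCG : 'C_G(E) / E \subset G / E by rewrite quotientS ?subsetIl.
have evenq : 2 %| #|G / E|.
  have /p_natP[[|k] oq] := pq; last by rewrite oq p2 expnS dvdn_mulr.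
  by move: G_gt8; rewrite -(Lagrange sEG) -card_quotient // oq oE p2.
(* The bound on |G| matters here: C_G(E) has index at most 2, so its order exceeds 4. In the
   dihedral group of order 8, C_G(E) = E and the sum is 3. *)
have evenC : 2 %| #|'C_G(E) / E|.
  have /p_natP[[|k] oq] := pgroupS sCG pq; last by rewrite oq p2 expnS dvdn_mulr.
  have sEC : E \subset 'C_G(E) by rewrite subsetI sEG; apply: abelem_abelian abE.
  have nEC : 'C_G(E) \subset 'N(E) by rewrite subIset // nEG'.
  have := card_cent_p2 p2; move: G_gt8.
  rewrite -(Lagrange (subsetIl G 'C(E))) -(Lagrange sEC) -card_quotient // oq oE p2.
  by rewrite expn0 muln1; move: #|_ : _|; clear; case=> [|[|[|]]].
(* The exceptional fibres, of size 3, lie over the subgroups of order 2 of G / E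
   outside 'C_G(E) / E. By Frobenius both groups have an odd number of subgroups
   of order 2, so these fibres are even in number. *)
pose I H := [set M in cyc H | #|(M : {group coset_of E})| == 2].
pose B := I (G / E)%G :\: I ('C_G(E) / E)%G.
have inI (H M : {group coset_of E}) : (M \in I H) = (M \in cyc H) && (#|M| == 2).
  exact: in_set.
have inB M : (M \in B) = (M \notin I ('C_G(E) / E)%G) && (M \in I (G / E)%G).
  exact: in_setD.
have cI (H : {group coset_of E}) : #|I H|.+1 = #|'Ldiv_2(H)|.
  have -> : #|I H| = \sum_(M in I H) totient #|M|.
    by rewrite -sum1_card; apply: eq_bigr => L; rewrite inE => /andP[_ /eqP->].
  rewrite sum_totient_cyc => [|L]; last by rewrite inE mem_cyc => /andP[/andP[]].
  rewrite [RHS](cardsD1 1) !inE group1 expg1n eqxx add1n; congr _.+1.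
  apply: eq_card => x; rewrite !inE -/(cyc H) -orderE.
  rewrite -mem_cyc cycle_cyc andbCA; congr (_ && _).
  apply/eqP/andP=> [ox | [nt1 /eqP x2]]; last exact: nt_prime_order.
  by rewrite -order_dvdn ox -order_gt1 ox.
have odI (H : {group coset_of E}) : 2 %| #|H| -> odd #|I H|.
  by move/Frobenius_Ldiv; rewrite -cI dvdn2 /= negbK.
have sII : I ('C_G(E) / E)%G \subset I (G / E)%G.
  apply/subsetP=> M; rewrite !inE => /andP[/andP[sMC ->] ->].
  by rewrite (subset_trans sMC).
have evenB : 2 %| #|B|.
  have := cardsID (I ('C_G(E) / E)%G) (I (G / E)%G); rewrite (setIidPr sII) => eI.
  by have := odI _ evenq; rewrite -eI oddD odI // dvdn2.
rewrite (bigID (mem B)) /= dvdn_add //.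
  rewrite (eq_bigr (fun=> 3)) => [|M /andP[/andP[cM ntM] BM]]; last first.
    have: M \in B by [].
    rewrite inB inI [M \in I (G / E)%G]inI cM /= => /andP[nI oM].
    apply: card_cyc_fibre_irregular => //; first exact/eqP.
    apply: contra nI => sMC; rewrite oM andbT mem_cyc sMC.
    by move: cM; rewrite mem_cyc => /andP[].
  rewrite sum_nat_const p2 dvdn_mulr // (eq_card (B := B)) // => M.
  rewrite unfold_in /= -[RHS]andTb; apply/andP/andP=> [[_ BM] | [_ BM]]; split=> //.
  have: M \in B by [].
  rewrite inB [M \in I (G / E)%G]inI => /andP[_ /andP[-> /eqP oM]] /=.
  by apply/eqP=> M1; move: oM; rewrite M1 cards1.
apply: dvdn_sum => M /andP[/andP[cM ntM] nBM]; have [k k_gt0 oM] := pM M cM ntM.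
apply: (card_cyc_fibre_regular cM oM k_gt0); case: (ltngtP k 1) k_gt0 => // [_ _ | k1 _].
  by rewrite orbT.
rewrite k1 p2 in oM; have {nBM}: M \notin B by [].
apply: contraR; rewrite !negb_or => /and3P[_ _ nCM].
rewrite inB !inI cM oM /= andbT mem_cyc; by rewrite (negPf nCM).
Qed.

Lemma card_cyc_normalp2_modp : 8 < #|G| -> #|cyc G| = 2 %[mod p].
Proof.
move=> G_gt8; rewrite (card_cyc_fibres G E).
rewrite (bigD1 1%G) ?cyc1 //= (cyc_fibre1 nEG) (card_cyc_p2Elem p_pr E2).
have [m ->] := dvdnP (dvdn_sum_fibres G_gt8).
have -> : (p.+2 + m * p = m.+1 * p + 2)%N.
  by rewrite mulSn addnAC addn2.
by rewrite modnMDl.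
Qed.

End NormalP2.

Lemma pgroup_cyc13 (gT : finGroupType) (p : nat) (G : {group gT}) :
    p.-group G -> #|cyc G| = 13 ->
  [\/ 11.-abelem G /\ #|G| = 121, cyclic G /\ exists2 q, prime q & #|G| = (q ^ 12)%N
    | G \isog 'Q_32].
Proof.
move=> pG c13; have G_ge13 : 13 <= #|G| by rewrite -c13 leq_cyc_card.
have ntG : G :!=: 1 by apply: contraTneq G_ge13 => ->; rewrite cards1.
have [p_pr _ [n oG]] := pgroup_pdiv pG ntG.
have [cG | ncG] := boolP (cyclic G).
  have := card_cyc_cyclic_pgroup p_pr cG oG; rewrite c13 => -[n12].
  by constructor 2; split=> //; exists p; rewrite // oG -n12.
have [xG | nxG] := boolP (extremal2 G).
  by constructor 3; apply: extremal2_cyc13.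
constructor 1.
(* If all normal abelian subgroups were cyclic, [normal_rank1_structure] would make G cyclic or a
   2-group of maximal class. *)
have [X [nXG cXX ncX]] : exists X : {group gT}, [/\ X <| G, abelian X & ~~ cyclic X].
  have [/existsP[X /and3P[nXG cXX ncX]] | ] :=
    boolP [exists X : {group gT}, [&& X <| G, abelian X & ~~ cyclic X]].
    by exists X.
  move/existsPn=> noX; have [|| /and3P[_ xG _]] := normal_rank1_structure pG.
  - move=> X nXG cXX; apply: contraR (noX X) => ncX.
    by rewrite nXG cXX ncX.
  - by move=> cG; rewrite cG in ncG.
  by rewrite xG in nxG.
have pX := pgroupS (normal_sub nXG) pG.
have abO : p.-abelem 'Ohm_1(X) by rewrite Ohm1_abelem.
have nOG : 'Ohm_1(X) <| G := gFnormal_trans _ nXG.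
have dvO : 2 <= logn p #|'Ohm_1(X)|.
  rewrite -(rank_abelem abO) rank_Ohm1 ltnNge; apply: contra ncX => r1.
  by rewrite abelian_rank1_cyclic.
have [E [sEO nEG oE]] := normal_pgroup pG nOG dvO.
have E2 : E \in 'E_p^2(G).
  by rewrite pnElemE // !inE (normal_sub nEG) (abelemS sEO abO) oE eqxx.
have := card_cyc_normalp2_modp pG E2 nEG (ltn_trans (isT : 8 < 12) G_ge13).
rewrite c13 => /eqP; rewrite (eqn_mod_dvd p (isT : 2 <= 13)) => p11.
have {}p11 : p = 11 by apply/eqP; rewrite -(dvdn_prime2 p_pr).
have cE := card_cyc_p2Elem p_pr E2.
(* E alone has 11 + 2 cyclic subgroups, so none lies outside E. *)
have -> : G :=: E by apply: cyc_sub_eq (normal_sub nEG) _; rewrite c13 cE p11.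
by rewrite oE p11; have [_ + _] := pnElemP E2; rewrite p11.
Qed.

(** * Noncentral coprime actions in non-nilpotent groups *)

(* Counting: in a simple group, nilpotency of the maximal subgroups forces them
   to intersect trivially, so each conjugacy class of them covers at least half
   of the group, and there is no room for two classes. *)
Lemma simple_nil_maximal_sol (gT : finGroupType) (G : {group gT}) : simple G ->
  (forall M : {group gT}, maximal M G -> nilpotent M) -> solvable G.
Proof.
case/simpleP=> ntG simG nilM; apply/idPn=> nsolG.
have cyc_pr x : x \in G -> <[x]> \proper G.
  move=> Gx; rewrite properEneq cycle_subG Gx andbT.
  by apply: contraNneq nsolG => <-; rewrite abelian_sol ?cycle_abelian.
have maxE x : x \in G -> exists2 M : {group gT}, maximal M G & x \in M.
  move=> Gx; have [eqG | [M maxM sxM]] := maximal_exists (proper_sub (cyc_pr x Gx)).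
    by have := cyc_pr x Gx; rewrite [<[x]>]eqG properxx.
  by exists M; rewrite // -cycle_subG.
have norm_pr (D : {group gT}) : D :!=: 1 -> D \proper G -> 'N_G(D) \proper G.
  move=> ntD prD; rewrite properE subsetIl subsetI subxx /=.
  apply/negP=> nDG; case: (simG D) => [|D1|DG]; first by rewrite /normal proper_sub.
    by rewrite D1 eqxx in ntD.
  by rewrite DG properxx in prD.
have maxpr (M : {group gT}) : maximal M G -> M \proper G by case/maxgroupP.
have eqmax (M L : {group gT}) : maximal M G -> maximal L G -> M \subset L -> M = L.
  by case/maxgroupP=> _ maxM /maxpr prL sML; apply/val_inj/esym/maxM.
pose gP (D : {group gT}) := (D :!=: 1) && [exists M : {group gT}, exists L : {group gT},
  [&& maximal M G, maximal L G, M != L & D :==: M :&: L]].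
(* Let D be maximal among the nontrivial intersections, and let the maximal subgroup K contain
   N_G(D). Normalisers grow in the nilpotent M1 and M2, so K meets each of them in more than D;
   maximality of D forces K = M1 and K = M2. *)
have TI (M L : {group gT}) : maximal M G -> maximal L G -> M != L -> M :&: L = 1.
  move=> maxM maxL neML; apply/eqP/idPn=> ntML.
  have [D] : {D : {group gT} | maxgroup D gP}.
    apply: ex_maxgroup; exists (M :&: L)%G; rewrite /gP ntML /=.
    by apply/existsP; exists M; apply/existsP; exists L; rewrite maxM maxL neML /=.
  case/maxgroupP=> /andP[ntD /existsP[M1 /existsP[M2 /and4P[max1 max2 ne12 /eqP defD]]]] maxD.
  have prD (M' L' : {group gT}) : maximal M' G -> maximal L' G -> M' != L' -> D :=: M' :&: L' -> D \proper M'.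
    move=> mM' mL' ne eqD; rewrite eqD properEneq subsetIl andbT.
    apply: contra ne => /eqP/setIidPl sML'; exact/eqP/eqmax.
  have prDG : D \proper G.
    by apply: proper_sub_trans (prD _ _ max1 max2 ne12 defD) (proper_sub (maxpr _ max1)).
  have [eqG | [K maxK sNK]] := maximal_exists (proper_sub (norm_pr D ntD prDG)).
    by have := norm_pr D ntD prDG; rewrite eqG properxx.
  have eqK (M' L' : {group gT}) : maximal M' G -> maximal L' G -> M' != L' -> D :=: M' :&: L' -> K = M'.
    move=> mM' mL' ne eqD; apply/eqP/idPn=> neKM.
    have prD' := prD _ _ mM' mL' ne eqD.
    have prN := nilpotent_proper_norm (nilM _ mM') prD'.
    have sNKM : 'N_M'(D) \subset K :&: M'.
      by rewrite subsetI subsetIl (subset_trans _ sNK) // setSI // proper_sub ?maxpr.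
    have sDK : D \subset K :&: M' := subset_trans (proper_sub prN) sNKM.
    have eqDK : K :&: M' = D.
      apply: (maxD (K :&: M')%G) => //; rewrite /gP; apply/andP; split.
        by apply: contra ntD => /eqP KM1; rewrite -subG1 -KM1.
      by apply/existsP; exists K; apply/existsP; exists M'; rewrite maxK mM' neKM /=.
    by rewrite eqDK in sNKM; rewrite properE sNKM andbF in prN.
  have defD' : D :=: M2 :&: M1 by rewrite setIC.
  have ne21 : M2 != M1 by rewrite eq_sym.
  by case/eqP: (ne12); rewrite -(eqK _ _ max1 max2 ne12 defD) (eqK _ _ max2 max1 ne21 defD').
have maxJ (M : {group gT}) g : g \in G -> maximal M G -> maximal (M :^ g)%G G.
  by move=> Gg maxM; rewrite -(maximalJ _ _ g) /= in maxM; rewrite (conjGid Gg) in maxM.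
have cs (M : {group gT}) : maximal M G -> M :!=: 1 ->
    #|class_support M^# G| = (#|M|.-1 * #|G : M|)%N.
  move=> maxM ntM; have -> : #|M|.-1 = #|M^#| by rewrite (cardsD1 1 M) group1.
  apply: card_support_normedTI; apply/normedTI_P; rewrite setD_eq0 subG1 ntM.
  split=> // [|g Gg ntI].
    rewrite subsetI (proper_sub (maxpr M maxM)); apply/subsetP=> g Mg.
    by rewrite inE conjD1g conjGid.
  have defN : 'N_G(M) = M.
    have prN := norm_pr M ntM (maxpr M maxM).
    have [_ maxM'] := maxgroupP maxM; apply: maxM' => //.
    by rewrite subsetI normG proper_sub ?maxpr.
  rewrite -defN inE Gg; apply/normP/eqP; rewrite eq_sym; apply: contraR ntI => neM.
  have nex : M != (M :^ g)%G by rewrite -val_eqE.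
  rewrite conjD1g -setI_eq0 -setDIl (TI _ _ maxM (maxJ _ _ Gg maxM) nex).
  by rewrite setDv.
have [x0 Gx0 ntx0] := trivgPn _ ntG.
have [M maxM Mx] := maxE x0 Gx0.
have ntM (L : {group gT}) z : z != 1 -> z \in L -> L :!=: 1.
  by move=> nt Lz; apply: contraNneq nt => L1; rewrite L1 inE in Lz.
have csM := cs M maxM (ntM _ _ ntx0 Mx).
have big (L : {group gT}) : maximal L G -> L :!=: 1 -> #|G| <= 2 * (#|L|.-1 * #|G : L|).
  move=> maxL; rewrite -cardG_gt1 -(Lagrange (proper_sub (maxpr L maxL))).
  by rewrite mulnA leq_mul2r => gt1; apply/orP; right; move: gt1; clear; lia.
have csG (L : {group gT}) : maximal L G -> class_support L^# G \subset G^#.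
  move=> maxL; apply/subsetP=> _ /imset2P[u g /setD1P[ntu Lu] Gg ->].
  by rewrite !inE conjg_eq1 ntu groupJ // (subsetP (proper_sub (maxpr L maxL))).
(* The conjugates of M^# cover |G| - |G : M| elements, fewer than the |G| - 1 of G^#. *)
have [y] : exists2 y, y \in G^# & y \notin class_support M^# G.
  apply/subsetPn/negP=> /subset_leq_card; rewrite csM => le.
  have lt1 : 1 < #|G : M| by rewrite indexg_gt1 proper_subn ?maxpr.
  have := cardsD1 1 G; rewrite group1 -(Lagrange (proper_sub (maxpr M maxM))).
  have := cardG_gt0 M; move: le lt1; case: #|M| => // m.
  rewrite mulSn /= add1n; move: #|G^#| #|G : M| (m * _)%N => a b c; clear; lia.
case/setD1P=> nty Gy ncy; have [L maxL Ly] := maxE y Gy.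
have ntL := ntM _ _ nty Ly.
have dis : [disjoint class_support M^# G & class_support L^# G].
  apply/pred0P=> z /=; apply/negP=> /andP[/imset2P[u g Mu Gg defz] /imset2P[v h Lv Gh defz']].
  have [/setD1P[ntu Mu'] /setD1P[ntv Lv']] := (Mu, Lv).
  have Gk : g * h^-1 \in G by rewrite groupM ?groupV.
  have eqML : (M :^ (g * h^-1))%G = L.
    apply/eqP/idPn=> ne; have := TI _ _ (maxJ _ _ Gk maxM) maxL ne.
    move/setP/(_ v); rewrite !inE Lv' (negPf ntv) andbT /=.
    suff -> : v \in M :^ (g * h^-1) by [].
    by rewrite mem_conjg invMg invgK conjgM -defz' defz conjgK.
  case/negP: ncy; rewrite -eqML mem_conjg in Ly.
  apply/imset2P; exists (y ^ (g * h^-1)^-1) (g * h^-1) => //; last by rewrite conjgKV.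
  by rewrite !inE Ly conjg_eq1 nty.
have: #|class_support M^# G :|: class_support L^# G| <= #|G^#|.
  by apply: subset_leq_card; rewrite subUset !csG.
rewrite (eqP (etrans (leq_card_setU _ _).2 dis)) csM (cs L maxL ntL).
have := big M maxM (ntM _ _ ntx0 Mx); have := big L maxL ntL.
have := cardsD1 1 G; rewrite group1; rewrite /= add1n.
move: (#|M|.-1 * _)%N (#|L|.-1 * _)%N #|G^#| #|G| => a b c d.
by clear; lia.
Qed.

(** Schmidt's theorem. A proper nontrivial normal N is nilpotent, and proper subgroups of G / N lift
    to proper subgroups of G, so induction applies to G / N. *)
Lemma nil_proper_sol (gT : finGroupType) (G : {group gT}) :
  (forall H : {group gT}, H \proper G -> nilpotent H) -> solvable G.
Proof.
have [n] := ubnP #|G|; elim: n => // n IHn in gT G * => leGn nilH.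
have [-> | ntG] := eqVneq G 1%G; first exact: solvable1.
have [simG | nsimG] := boolP (simple G).
  by apply: simple_nil_maximal_sol => // M /maxgroupp; apply: nilH.
have [N [nNG prN ntN]] : exists N : {group gT}, [/\ N <| G, N \proper G & N :!=: 1].
  have [/existsP[N /and3P[]] | /existsPn noN] :=
    boolP [exists N : {group gT}, [&& N <| G, N \proper G & N :!=: 1]].
    by exists N.
  case/simpleP: nsimG; split=> // H nHG; have := noN H; rewrite nHG /=.
  rewrite properEneq normal_sub // andbT negb_and !negbK.
  by case/orP=> /eqP; [right | left].
rewrite (series_sol nNG) nilpotent_sol ?nilH //=; apply: IHn => [|K].
  by rewrite (leq_trans _ (leGn : #|G| <= n)) // ltn_quotient // normal_sub.
rewrite properE => /andP[sKG nsGK]; rewrite -(cosetpreK K) quotient_nil // nilH //.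
rewrite properE -{1}(quotientGK nNG) morphpreS //=; apply: contra nsGK => sGK.
by rewrite -(cosetpreK K) quotientS.
Qed.

(** A nilpotent group is generated by its cores O_q, so centralising them all means centralising
    F. *)
Lemma nil_noncent_pcore (gT : finGroupType) (P F : {group gT}) :
    nilpotent F -> ~~ (P \subset 'C(F)) ->
  exists2 q : nat, q \in \pi(F) & ~~ (P \subset 'C('O_q(F))).
Proof.
move=> nilF ncPF.
have [/existsP[q /andP[pi_q ncq]] | /existsPn cPq] :=
    boolP [exists q : 'I_#|F|.+1, ((q : nat) \in \pi(F)) && ~~ (P \subset 'C('O_q(F)))].
  by exists q.
case/negP: ncPF; rewrite centsC -{1}(nilpotent_Fitting nilF) FittingEgen.
rewrite gen_subG; apply/bigcupsP=> q pi_q; rewrite centsC.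
by have := cPq q; rewrite pi_q negbK.
Qed.

Definition noncentral_action (gT : finGroupType) (G : {group gT}) p q x (Q : {group gT}) :=
  [/\ prime p /\ prime q, p != q, x \in G /\ p.-elt x, Q \subset G /\ q.-group Q
    & (x \in 'N(Q)) && (x \notin 'C(Q))].

(** In a minimal non-nilpotent G, soluble by [nil_proper_sol], let M be normal of prime index p. The
    p'-core F of the nilpotent M is a normal p-complement of G, and a Sylow p-subgroup P
    centralising F would make G = F P nilpotent. So P acts nontrivially on some O_q(F). *)
Lemma nonnil_noncentral_action (gT : finGroupType) (G : {group gT}) :
  ~~ nilpotent G -> exists p q x Q, noncentral_action G p q x Q.
Proof.
have [n] := ubnP #|G|; elim: n => // n IHn in gT G * => leGn nnG.
have [/existsP[H /andP[prH nnH]] | /existsPn nilH] :=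
  boolP [exists H : {group gT}, (H \proper G) && ~~ nilpotent H].
  have [|p [q [x [Q [pq ne [Hx px] [sQH qQ] nQ]]]]] := IHn gT H _ nnH.
    exact: leq_trans (proper_card prH) leGn.
  have sHG := proper_sub prH; exists p, q, x, Q; split=> //; split=> //.
    exact: subsetP Hx.
  exact: subset_trans sHG.
have {}nilH (H : {group gT}) : H \proper G -> nilpotent H.
  by move=> prH; have := nilH H; rewrite prH negbK.
have solG := nil_proper_sol nilH.
have ntG : G :!=: 1 by apply: contraNneq nnG => ->; apply: nilpotent1.
have [M nMG p_pr] := sol_prime_factor_exists solG ntG; set p := #|G : M| in p_pr.
have prM : M \proper G by rewrite properE normal_sub //= -indexg_eq1 neq_ltn prime_gt1 ?orbT.
have nilM := nilH M prM; pose F := 'O_p^'(M)%G.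
have nFG : F <| G := gFnormal_trans _ nMG.
have hF : p^'.-Hall(M) F := nilpotent_pcore_Hall _ nilM.
have [P sylP] := Sylow_exists p G; have [sPG pP _] := and3P sylP.
have defG : F * P = G.
  apply/eqP; rewrite eqEcard mul_subG ?(normal_sub nFG) //=.
  have coFP : coprime #|F| #|P|.
    by rewrite coprime_sym; apply: pnat_coprime pP (pHall_pgroup hF).
  rewrite TI_cardMg ?coprime_TIg // (card_Hall hF) (card_Hall sylP).
  rewrite -(Lagrange (normal_sub nMG)) -/p partnM ?cardG_gt0 ?(prime_gt0 p_pr) //.
  rewrite (part_pnat_id (pnat_id p_pr)) mulnA leq_mul2r.
  by rewrite mulnC partnC // leqnn orbT.
have nilF : nilpotent F := nilpotentS (pcore_sub _ _) nilM.
have [cPF | ncPF] := boolP (P \subset 'C(F)).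
  have: nilpotent (F * P) by rewrite mulg_nil // nilF (pgroup_nil pP).
  by rewrite defG (negPf nnG).
have [q pi_q /subsetPn[x Px ncx]] := nil_noncent_pcore nilF ncPF.
have q_pr : prime q by move: pi_q; rewrite mem_primes => /and3P[].
exists p, q, x, 'O_q(F)%G; split=> //.
- move: pi_q; rewrite mem_primes eq_sym => /and3P[_ _ qF].
  by have := pnatP _ (cardG_gt0 F) (pHall_pgroup hF) q q_pr qF.
- by split; [apply: subsetP Px | apply: mem_p_elt pP Px].
- split; last exact: pcore_pgroup.
  exact: subset_trans (pcore_sub _ _) (normal_sub nFG).
rewrite ncx andbT (subsetP _ x (subsetP sPG x Px)) // normal_norm //.
exact: gFnormal_trans.
Qed.

(** [B] acts on [L] through Aut(L), of order [totient #|L|]. *)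
Lemma coprime_totient_cent (gT : finGroupType) (B L : {group gT}) :
  B \subset 'N(L) -> cyclic L -> coprime #|B| (totient #|L|) -> B \subset 'C(L).
Proof.
move=> nLB cL co; rewrite -ker_conj_aut ker_trivg_morphim nLB subG1 /=.
have := coprime_dvdl (dvdn_morphim (conj_aut L) B) co.
have dvA : #|conj_aut L @* B| %| totient #|L|.
  by rewrite -card_Aut_cyclic // cardSg // Aut_conj_aut.
by rewrite /coprime (gcdn_idPl dvA) => /eqP/card1_trivg->.
Qed.

Lemma der1_cent_cyclic (gT : finGroupType) (G L : {group gT}) :
  G \subset 'N(L) -> cyclic L -> G^`(1) \subset 'C(L).
Proof.
move=> nLG cL; rewrite -ker_conj_aut ker_trivg_morphim subG1.
rewrite (subset_trans (der_sub 1 G)) //= morphim_der //; apply/eqP/derG1P.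
exact: abelianS (Aut_conj_aut L G) (Aut_cyclic_abelian cL).
Qed.

Lemma pcore_join_cyclic (gT : finGroupType) p (L : {group gT}) :
  cyclic L -> 'O_p(L) <*> 'O_p^'(L) = L.
Proof.
move/cyclic_abelian/abelian_nil/(nilpotent_pcoreC p) => defL.
by have [_ defM cLL _] := dprodP defL; rewrite cent_joinEr.
Qed.

Lemma card_cyc_dprod (gT : finGroupType) (p : nat_pred) (P K G : {group gT}) :
  P \x K = G -> p.-group P -> p^'.-group K -> #|cyc G| = (#|cyc P| * #|cyc K|)%N.
Proof.
move=> defG pP p'K; have [_ defPK cPK tiPK] := dprodP defG.
have [sPG sKG] : P \subset G /\ K \subset G by rewrite -defPK mulG_subl mulG_subr.
have [nPG nKG] := dprod_normal2 defG.
have hP : p.-Hall(G) P.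
  rewrite pHallE sPG -(dprod_card defG) partnM ?cardG_gt0 //=.
  by rewrite (part_pnat_id pP) part_p'nat // muln1.
have hK : p^'.-Hall(G) K.
  rewrite pHallE sKG -(dprod_card defG) partnM ?cardG_gt0 //=.
  by rewrite (part_pnat_id p'K) part_p'nat ?mul1n // pnatNK.
rewrite -(card_cyc_join (p := p) pP) => [|L]; last first.
  rewrite mem_cyc => /andP[sLK _]; split; first exact: pgroupS p'K.
  exact: subset_trans cPK.
congr #|pred_of_set _|; apply/setP=> L; apply/idP/imsetP=> [|[[D M]]].
  rewrite mem_cyc => /andP[sLG cL].
  exists ('O_p(L)%G, 'O_p^'(L)%G); last by apply: val_inj; rewrite /= pcore_join_cyclic.
  have sO pi : 'O_pi(L) \subset G by apply: subset_trans (pcore_sub _ _) sLG.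
  apply/setXP; rewrite !mem_cyc /= !(cyclicS (pcore_sub _ L) cL) !andbT.
  by rewrite (sub_normal_Hall hP nPG (sO _)) (sub_normal_Hall hK nKG (sO _)) !pcore_pgroup.
case/setXP=> /= cD; rewrite mem_cyc => /andP[sMK cM] ->.
apply: (joing_cyc pP (pgroupS sMK p'K)) => //; exact: subset_trans sMK _.
Qed.

Section Orbits.

Variable gT : finGroupType.
Implicit Types (A G K L Q : {group gT}).

(** If N_A(K) is nontrivial it is all of A. When A and K meet trivially, [A, K] = 1; otherwise A
    lies in the abelian K. Either way K centralises A. *)
Lemma orbit_prime A K : prime #|A| -> K \subset 'N(A) -> abelian K ->
  ~~ (K \subset 'C(A)) -> #|orbit 'JG A K| = #|A|.
Proof.
move=> A_pr nAK cKK ncK; rewrite card_orbitJG.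
suff -> : 'N_A(K) = 1 by rewrite indexg1.
apply: contraNeq ncK => ntI; have sAN : A \subset 'N(K) := prime_meetG A_pr ntI.
have [tiAK | ntAK] := eqVneq (A :&: K) 1.
  rewrite (sameP commG1P eqP) -subG1 -tiAK setIC commg_subI //.
    by rewrite subsetI subxx.
  by rewrite subsetI subxx.
by rewrite centsC (subset_trans (prime_meetG A_pr ntAK)).
Qed.

(** The commutators of N_Q(<x>) with <x> lie in both Q and <x>, of coprime orders. *)
Lemma coprime_norm_cycle Q x : x \in 'N(Q) -> coprime #|Q| #[x] ->
  'N_Q(<[x]>) = 'C_Q[x].
Proof.
move=> nQx coQx; apply/eqP; rewrite -cent_cycle eqEsubset.
rewrite [X in _ && X]setIS ?cent_sub // andbT subsetI subsetIl /=.
rewrite (sameP commG1P eqP) -subG1 -(coprime_TIg coQx).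
rewrite commg_subI // subsetI ?subxx ?cycle_subG //.
Qed.

End Orbits.

(** The congruence comes from <x> acting on its own Q-orbit: it fixes only itself, for it is a Sylow
    p-subgroup of Q<x>, and together with another fixed conjugate it would generate a larger
    p-group. *)
Lemma noncentral_action_index (gT : finGroupType) (G : {group gT}) p q x (Q : {group gT}) :
    noncentral_action G p q x Q ->
  [/\ #|orbit 'JG Q <[x]>%G| = #|Q : 'C_Q[x]|, 1 < #|Q : 'C_Q[x]|,
      #|Q : 'C_Q[x]| = 1 %[mod p] & q.-nat #|Q : 'C_Q[x]|].
Proof.
case=> [[p_pr q_pr] ne_pq [Gx px] [sQG qQ] /andP[nQx ncQx]].
have qp' : p \in q^' by rewrite inE /= inE.
have coQx : coprime #|Q| #[x].
  by rewrite (pnat_coprime qQ) // (sub_in_pnat _ px) // => r _ /eqnP->.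
have nQX : <[x]> \subset 'N(Q) by rewrite cycle_subG.
have oO : #|orbit 'JG Q <[x]>%G| = #|Q : 'C_Q[x]|.
  by rewrite card_orbitJG coprime_norm_cycle.
split=> //.
- by rewrite indexg_gt1 subsetI subxx sub_cent1.
- have actO : [acts <[x]>, on orbit 'JG Q <[x]>%G | 'JG].
    apply/subsetP=> y Xy; rewrite !inE /=; apply/subsetP=> L.
    case/orbitJG_P=> u Qu defL; rewrite inE; apply/orbitJG_P.
    exists (u ^ y); first by rewrite memJ_norm // (subsetP nQX).
    by rewrite /= defL -conjsgM conjgC conjsgM /= (conjGid Xy).
  rewrite -oO (pgroup_fix_mod px actO).
  suff -> : 'Fix_(orbit 'JG Q <[x]>%G | 'JG)(<[x]>) = [set <[x]>%G] by rewrite cards1.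
  apply/setP=> L; rewrite !inE; apply/andP/eqP=> [[] | ->]; last first.
    rewrite orbit_refl; split=> //; apply/subsetP=> y Xy; rewrite inE.
    by apply/eqP/val_inj; rewrite /= conjGid.
  case/orbitJG_P=> u Qu defL fixL.
  have nLX : <[x]> \subset 'N(L).
    apply/subsetP=> y Xy; apply/normP; have := subsetP fixL y Xy; rewrite inE.
    by move/eqP/(congr1 val).
  have pL : p.-group L by rewrite defL pgroupJ.
  have pJ : p.-group (L <*> <[x]>) by rewrite norm_joinEr // pgroupM pL.
  have sJ : L <*> <[x]> \subset Q <*> <[x]>.
    rewrite join_subG joing_subr andbT defL.
    by rewrite -(conjGid (subsetP (joing_subl Q <[x]>) u Qu)) conjSg joing_subr.
  have hX : p.-Sylow(Q <*> <[x]>) <[x]>.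
    rewrite pHallE joing_subr /= norm_joinEr // TI_cardMg ?coprime_TIg //.
    rewrite partnM ?cardG_gt0 // (@part_p'nat _ #|Q|) ?mul1n ?part_pnat_id //.
    by rewrite (sub_in_pnat _ qQ) // => r _ /eqnP->; rewrite inE /= inE eq_sym.
  apply: val_inj; apply/eqP; rewrite /= eqEcard {2}defL cardJg leqnn andbT.
  have eqJ : L <*> <[x]> = <[x]>.
    apply/esym/eqP; rewrite eqEcard joing_subr /=.
    rewrite (card_Hall hX) dvdn_leq ?part_gt0 //.
    by rewrite -(part_pnat_id pJ) partn_dvd ?cardSg.
  by apply: subset_trans (joing_subl L <[x]>) _; rewrite eqJ.
- by rewrite (pnat_dvd (dvdn_indexg _ _)).
Qed.

(** * A normal subgroup of prime order *)

Section PrimeNormal.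

Variables (gT : finGroupType) (p q : nat) (G A : {group gT}) (x : gT).
Hypotheses (p_pr : prime p) (q_pr : prime q) (ne_pq : p != q).
Hypotheses (nAG : A <| G) (oA : #|A| = q) (Gx : x \in G) (ncAx : x \notin 'C(A)).

Let nAx : x \in 'N(A). Proof. by rewrite (subsetP (normal_norm nAG)). Qed.

Lemma orbit_prime_cycle y : y \in 'N(A) -> y \notin 'C(A) ->
  #|orbit 'JG A <[y]>%G| = q.
Proof.
by move=> nAy ncy; rewrite orbit_prime ?oA ?cycle_subG ?cycle_abelian.
Qed.

Let actA : [acts A, on cyc G :\: cyc 'C_G(A) | 'JG].
Proof.
apply: acts_cycD; apply: subset_trans (normal_sub nAG) _; first exact: normG.
by rewrite normsI ?normG ?norms_cent // normal_norm.
Qed.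

Lemma orbit_outside y : y \in G -> y \notin 'C(A) ->
  orbit 'JG A <[y]>%G \subset cyc G :\: cyc 'C_G(A).
Proof.
move=> Gy ncy.
by rewrite (acts_sub_orbit _ actA) in_setD !cycle_cyc inE Gy ncy.
Qed.

Lemma dvdn_outside : q %| #|cyc G :\: cyc 'C_G(A)|.
Proof.
have qA : q.-group A by rewrite /pgroup oA pnat_id.
rewrite /dvdn (pgroup_fix_mod qA actA) eq_card0 ?mod0n // => L.
rewrite !inE /= -!mem_cyc; apply/negP=> /andP[/andP[nCL cL] fixL].
have /imsetP[y Gy defL] : L \in [set <[y]>%G | y in G] by rewrite -cyc_imset.
rewrite defL cycle_cyc inE Gy /= in nCL.
have nAy : y \in 'N(A) by rewrite (subsetP (normal_norm nAG)).
have := orbit_prime_cycle nAy nCL; rewrite -defL.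
suff -> : orbit 'JG A L = [set L].
  by rewrite cards1 => q1; move: q_pr; rewrite -q1.
apply/setP=> K; rewrite inE; apply/imsetP/eqP=> [[a Aa ->]|->].
  by have := subsetP fixL a Aa; rewrite inE => /eqP.
by exists 1; rewrite ?act1.
Qed.

(** C_G(A) = A x <x^p> has 2n cyclic subgroups. The q conjugates of <x> have q(p - 1)p^(n-1) = |G| -
    |C_G(A)| generators in all, so they are all that lies outside C_G(A). *)
Lemma card_cyc_semidirect n : A * <[x]> = G -> #[x] = (p ^ n)%N -> 0 < n ->
  x ^+ p \in 'C(A) -> #|cyc G| = (q + n.*2)%N.
Proof.
move=> defG ox n_gt0 cxp; have p_gt1 := prime_gt1 p_pr.
have coqp : coprime q (p ^ n) by rewrite coprimeXr // prime_coprime // dvdn_prime2 // eq_sym.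
have tiAX : A :&: <[x]> = 1 by rewrite coprime_TIg // oA -orderE ox.
have oG : #|G| = (q * p ^ n)%N by rewrite -[G : {set gT}]defG TI_cardMg // oA -orderE ox.
have oxp : #[x ^+ p] = (p ^ n.-1)%N.
  by rewrite orderXdiv ox -(prednK n_gt0) ?dvdn_exp // expnS mulKn ?prime_gt0.
have cAA : abelian A by rewrite cyclic_abelian // prime_cyclic // oA.
have sAC : A \subset 'C_G(A) by rewrite subsetI normal_sub.
have defXC : <[x]> :&: 'C_G(A) = <[x ^+ p]>.
  have sxpC : <[x ^+ p]> \subset <[x]> :&: 'C_G(A).
    by rewrite subsetI cycle_subG mem_cycle cycle_subG inE groupX.
  apply/esym/eqP; rewrite eqEcard sxpC -orderE oxp /=.
  have /(dvdn_pfactor _ _ p_pr)[m le_mn oD] : #|<[x]> :&: 'C_G(A)| %| p ^ n.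
    by rewrite -ox orderE cardSg ?subsetIl.
  rewrite oD leq_exp2l // -ltnS prednK // ltn_neqAle le_mn andbT.
  apply: contra ncAx => /eqP eq_mn; have: <[x]> :&: 'C_G(A) = <[x]>.
    by apply/eqP; rewrite eqEcard subsetIl oD eq_mn -ox -orderE leqnn.
  by move/setIidPl; rewrite cycle_subG inE => /andP[].
have defC : A \x <[x ^+ p]> = 'C_G(A).
  have tiAXp : A :&: <[x ^+ p]> = 1.
    by apply/trivgP; rewrite -tiAX setIS // cycle_subG mem_cycle.
  rewrite dprodE //; last by rewrite cycle_subG.
  rewrite /= -defXC group_modl // defG.
  by apply/setIidPr; apply: subsetIl.
have cC : #|cyc 'C_G(A)| = n.*2.
  rewrite (card_cyc_dprod (p := q) defC).
  - rewrite (@card_cyc_cyclic_pgroup _ _ q 1) ?prime_cyclic ?oA ?expn1 //.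
    rewrite (@card_cyc_cyclic_pgroup _ _ p n.-1) ?cycle_cyclic -?orderE //.
    by rewrite prednK // mul2n.
  - by rewrite /pgroup oA pnat_id.
  by rewrite /pgroup -orderE oxp pnatX pnatE // inE /= inE ne_pq.
have sCG : 'C_G(A) \subset G := subsetIl _ _.
suff oD : #|cyc G :\: cyc 'C_G(A)| = q.
  by rewrite -(cardsID (cyc 'C_G(A)) (cyc G)) (setIidPr (cycS sCG)) oD cC addnC.
have sumD := sum_totient_cycD sCG.
have oX : #|orbit 'JG A <[x]>%G| = q by apply: orbit_prime_cycle.
have sOD := orbit_outside Gx ncAx.
suff -> : cyc G :\: cyc 'C_G(A) = orbit 'JG A <[x]>%G by [].
apply/eqP; rewrite eq_sym eqEsubset sOD /=; apply/subsetP=> L DL; apply/idPn=> nOL.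
have := sumD; rewrite (bigID (mem (orbit 'JG A <[x]>%G))) /=.
rewrite (eq_bigl (mem (orbit 'JG A <[x]>%G))) => [|K]; last first.
  by rewrite andb_idl //; apply: (subsetP sOD).
rewrite (eq_bigr (fun=> totient (p ^ n))) => [|K /orbitJG_P[a _ ->]]; last first.
  by rewrite cardJg -orderE ox.
rewrite sum_nat_const oX (bigD1 L) /=; last by rewrite DL.
rewrite oG -(dprod_card defC) oA -orderE oxp totient_pfactor //.
have t_gt0 : 0 < totient #|L| by rewrite totient_gt0 cardG_gt0.
have -> : (q * p ^ n - q * p ^ n.-1 = q * (p.-1 * p ^ n.-1))%N.
  by rewrite -mulnBr -{1}(prednK n_gt0) expnS -{2}[(p ^ _)%N]mul1n -mulnBl subn1.
by move/eqP; rewrite -[X in _ == X]addn0 eqn_add2l addn_eq0 -leqn0 leqNgt t_gt0.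
Qed.

(** The A-orbit of <x> already has q members, so every element outside C_G(A) generates a conjugate
    of <x>. Its smaller order puts x^p inside C_G(A); and an element y of C_G(A) lies in A<x>
    because y x is outside. *)
Lemma outside_orbit_structure : p.-elt x -> #|cyc G :\: cyc 'C_G(A)| = q ->
  exists n, [/\ 0 < n, #[x] = (p ^ n)%N, A * <[x]> = G & x ^+ p \in 'C(A)].
Proof.
move=> px oD.
have defD : cyc G :\: cyc 'C_G(A) = orbit 'JG A <[x]>%G.
  apply/esym/eqP; rewrite eqEcard orbit_outside //= oD.
  by rewrite orbit_prime_cycle.
have outE y : y \in G -> y \notin 'C(A) -> exists2 a, a \in A & <[y]> = <[x]> :^ a.
  move=> Gy ncy; have: <[y]>%G \in cyc G :\: cyc 'C_G(A).
    by rewrite (subsetP (orbit_outside Gy ncy)) // orbit_refl.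
  by rewrite defD => /orbitJG_P.
have /p_natP[n ox] := px.
have n_gt0 : 0 < n.
  rewrite lt0n; apply: contra ncAx => /eqP n0; rewrite n0 in ox.
  by have /eqP := ox; rewrite expn0 order_eq1 => /eqP->; apply: group1.
have cxp : x ^+ p \in 'C(A).
  apply/idPn=> ncxp; have [|a _ eq_xa] := outE _ _ ncxp; first exact: groupX.
  have /eqP := congr1 (fun S : {set gT} => #|S|) eq_xa.
  rewrite cardJg -!orderE orderXdiv ox -(prednK n_gt0) ?dvdn_exp //.
  by rewrite expnS mulKn ?prime_gt0 // -expnS eqn_exp2l ?prime_gt1 // ltn_eqF.
exists n; split=> //; have nAX : <[x]> \subset 'N(A) by rewrite cycle_subG.
rewrite -norm_joinEr //; apply/eqP; rewrite eqEsubset join_subG normal_sub //=.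
rewrite cycle_subG Gx /=; apply/subsetP=> y Gy.
have outJ z : z \in G -> z \notin 'C(A) -> z \in A <*> <[x]>.
  move=> Gz ncz; have [a Aa eq_z] := outE z Gz ncz.
  have Ja := subsetP (joing_subl A <[x]>) a Aa.
  by rewrite -cycle_subG eq_z -(conjGid Ja) conjSg joing_subr.
have [cy | ncy] := boolP (y \in 'C(A)); last exact: outJ.
have Jx : x \in A <*> <[x]> by rewrite -cycle_subG joing_subr.
by rewrite -(groupMr _ Jx); apply: outJ; [apply: groupM | rewrite groupMl].
Qed.

End PrimeNormal.

(** * Disjoint families, and subgroups of prime order *)

Section PrimeSubgroups.

Variable gT : finGroupType.
Implicit Types (A B E G H K L Q : {group gT}) (S T U : {set {group gT}}).

Lemma disjointP_pred S T (P : pred {group gT}) :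
  {in S, forall L, P L} -> {in T, forall L, ~~ P L} -> [disjoint S & T].
Proof.
move=> PS nPT; apply/pred0P=> L /=; apply/negP=> /andP[/PS PL /nPT].
by rewrite PL.
Qed.

Lemma leq_card_disjoint3 U S1 S2 S3 : S1 \subset U -> S2 \subset U -> S3 \subset U ->
    [disjoint S1 & S2] -> [disjoint S1 & S3] -> [disjoint S2 & S3] ->
  #|S1| + #|S2| + #|S3| <= #|U|.
Proof.
move=> s1 s2 s3 d12 d13 d23.
have := @sum_card_leq _ U [:: S1; S2; S3]; rewrite /= s1 s2 s3 d12 d13 d23 addn0 addnA.
exact.
Qed.

Lemma leq_card_disjoint4 U S1 S2 S3 S4 :
    S1 \subset U -> S2 \subset U -> S3 \subset U -> S4 \subset U ->
    [disjoint S1 & S2] -> [disjoint S1 & S3] -> [disjoint S1 & S4] ->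
    [disjoint S2 & S3] -> [disjoint S2 & S4] -> [disjoint S3 & S4] ->
  #|S1| + #|S2| + #|S3| + #|S4| <= #|U|.
Proof.
move=> s1 s2 s3 s4 d12 d13 d14 d23 d24 d34.
have := @sum_card_leq _ U [:: S1; S2; S3; S4].
rewrite /= s1 s2 s3 s4 d12 d13 d14 d23 d24 d34 addn0 !addnA; exact.
Qed.

Lemma leq_card_disjoint5 U S1 S2 S3 S4 S5 :
    S1 \subset U -> S2 \subset U -> S3 \subset U -> S4 \subset U -> S5 \subset U ->
    [disjoint S1 & S2] -> [disjoint S1 & S3] -> [disjoint S1 & S4] -> [disjoint S1 & S5] ->
    [disjoint S2 & S3] -> [disjoint S2 & S4] -> [disjoint S2 & S5] ->
    [disjoint S3 & S4] -> [disjoint S3 & S5] -> [disjoint S4 & S5] ->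
  #|S1| + #|S2| + #|S3| + #|S4| + #|S5| <= #|U|.
Proof.
move=> s1 s2 s3 s4 s5 d12 d13 d14 d15 d23 d24 d25 d34 d35 d45.
have := @sum_card_leq _ U [:: S1; S2; S3; S4; S5].
by rewrite /= s1 s2 s3 s4 s5 d12 d13 d14 d15 d23 d24 d25 d34 d35 d45 addn0 !addnA; exact.
Qed.

Lemma orbitJG_card Q L K : K \in orbit 'JG Q L -> #|K| = #|L|.
Proof. by case/orbitJG_P=> u _ ->; rewrite cardJg. Qed.

Definition prime_subgroups q G := [set L : {group gT} in cyc G | #|L| == q].

Lemma in_prime_subgroups q G L : prime q ->
  (L \in prime_subgroups q G) = (L \subset G) && (#|L| == q).
Proof.
move=> q_pr; rewrite in_set mem_cyc -andbA; congr (_ && _).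
by case: eqP => [oL | _]; rewrite ?andbF // prime_cyclic ?oL.
Qed.

Lemma prime_subgroup_cent q A B : prime q -> #|A| = q -> #|B| = q ->
  A \subset 'N(B) -> A \subset 'C(B).
Proof.
move=> q_pr oA oB nBA; apply: coprime_totient_cent; rewrite ?prime_cyclic ?oB //.
rewrite oA totient_prime // prime_coprime //.
by case: (q) (prime_gt1 q_pr) => [|[|n]] // _; rewrite gtnNdvd.
Qed.

Lemma prime_subgroups_p2Elem q A B : prime q -> #|A| = q -> #|B| = q -> A != B ->
  A \subset 'N(B) -> (A <*> B)%G \in 'E_q^2(A <*> B).
Proof.
move=> q_pr oA oB neAB nBA; have cBA := prime_subgroup_cent q_pr oA oB nBA.
have tiAB : A :&: B = 1.
  apply: prime_TIg; rewrite ?oA //; apply: contra neAB => sAB.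
  by rewrite -val_eqE /= eqEcard sAB oA oB leqnn.
have abel K : #|K| = q -> q.-abelem K by move=> oK; rewrite prime_abelem ?oK.
have defE : A \x B = A <*> B by rewrite dprodEY // centsC.
rewrite pnElemE // !inE subxx -(dprod_card defE) oA oB /= eqxx andbT.
by rewrite (dprod_abelem _ defE) !abel.
Qed.

(** If A normalises B, they span a group of type (q, q), with q + 1 subgroups of order q; otherwise
    take A and the q conjugates of B under A. *)
Lemma card_prime_subgroups q G A B : prime q -> A \subset G -> B \subset G ->
  #|A| = q -> #|B| = q -> A != B -> q < #|prime_subgroups q G|.
Proof.
move=> q_pr sAG sBG oA oB neAB.
have [nBA | nnBA] := boolP (A \subset 'N(B)).
  have E2 := prime_subgroups_p2Elem q_pr oA oB neAB nBA.
  rewrite -(card_p1Elem_p2Elem E2); apply: subset_leq_card; apply/subsetP=> L.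
  rewrite p1ElemE // inE in_prime_subgroups // => /andP[sL ->]; rewrite andbT.
  by move: sL; rewrite inE => /subset_trans->//; rewrite join_subG sAG.
have oO : #|orbit 'JG A B| = q.
  rewrite card_orbitJG; suff -> : 'N_A(B) = 1 by rewrite indexg1.
  by apply: contraNeq nnBA; apply: prime_meetG; rewrite oA.
have nOA : A \notin orbit 'JG A B.
  apply: contra neAB => /orbitJG_P[a Aa defA].
  by rewrite -val_eqE /= -(conjsgK a B) -defA conjGid // groupV.
suff /subset_leq_card: A |: orbit 'JG A B \subset prime_subgroups q G.
  by rewrite cardsU1 nOA oO.
apply/subsetP=> L; rewrite in_prime_subgroups // => /setU1P[-> | /orbitJG_P[a Aa ->]].
  by rewrite sAG oA eqxx.
by rewrite cardJg oB eqxx andbT -(conjGid (subsetP sAG a Aa)) conjSg.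
Qed.

Lemma cent_2elt A y : odd #|A| -> 2.-elt y -> A \subset 'N(<[y]>) -> y \in 'C(A).
Proof.
move=> A_odd y2 nyA; rewrite -cycle_subG centsC.
apply: (@coprime_totient_cent _ A <[y]>%G); rewrite ?cycle_cyclic //= -orderE.
have /p_natP[[|n] ->] := y2; first by rewrite coprimen1.
by rewrite totient_pfactor //= mul1n coprimeXr // coprimen2.
Qed.

Lemma orbit_2elt A y : prime #|A| -> odd #|A| -> 2.-elt y -> y \notin 'C(A) ->
  #|orbit 'JG A <[y]>%G| = #|A|.
Proof.
move=> A_pr A_odd y2 ncy; rewrite card_orbitJG.
suff -> : 'N_A(<[y]>) = 1 by rewrite indexg1.
apply: contraNeq ncy => ntN; apply: cent_2elt => //.
exact: prime_meetG.
Qed.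

End PrimeSubgroups.

(** For distinct primes p and q: Z_q extended by Z_(p^n), whose generator induces an automorphism of
    order p. *)
Definition metacyclic_struct (gT : finGroupType) (G : {group gT}) p q n :=
  exists A : {group gT}, exists x, [/\ A <| G, #|A| = q, x \in G /\ x \notin 'C(A),
    #[x] = (p ^ n)%N & A * <[x]> = G /\ x ^+ p \in 'C(A)].

(** q + 2n is the number of cyclic subgroups found in [card_cyc_semidirect]; with p dividing q - 1,
    six triples (p, q, n) remain. *)
Definition metacyclic13 (gT : finGroupType) (G : {group gT}) :=
  exists p, exists q, exists2 n, [/\ prime p, prime q, p != q & p %| q.-1] /\
     0 < n /\ q + n.*2 = 13 & metacyclic_struct G p q n.

Section ThirteenCyclic.

Variables (gT : finGroupType) (G : {group gT}).
Hypothesis c13 : #|cyc G| = 13.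

Lemma normal_prime_metacyclic13 p q x (A : {group gT}) :
    noncentral_action G p q x A -> A <| G -> #|A| = q ->
  #|cyc G :\: cyc 'C_G(A)| = q -> metacyclic13 G.
Proof.
move=> act nAG oA oD; have [oO _ modp _] := noncentral_action_index act.
have [[p_pr q_pr] ne_pq [Gx px] _ /andP[_ ncx]] := act.
have [n [n_gt0 ox defG cxp]] := outside_orbit_structure p_pr q_pr nAG oA Gx ncx px oD.
have c_eq := card_cyc_semidirect p_pr q_pr ne_pq nAG oA Gx ncx defG ox n_gt0 cxp.
exists p, q, n; last by exists A, x.
split; split=> //; last by rewrite -c_eq.
move: modp; rewrite -oO (orbit_prime_cycle q_pr oA) ?(subsetP (normal_norm nAG)) //.
by move/eqP; rewrite eqn_mod_dvd ?prime_gt0 // subn1.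
Qed.

(** The trivial group and a subgroup of order q in Q come besides the orbit of <x>. *)
Lemma noncentral_action_index_le p q x Q : noncentral_action G p q x Q ->
  #|Q : 'C_Q[x]| <= 11.
Proof.
move=> act; have [oO k_gt1 _ _] := noncentral_action_index act.
have [[p_pr q_pr] ne_pq [Gx px] [sQG qQ] /andP[_ ncx]] := act.
have ntQ : Q :!=: 1 by apply: contraNneq ncx => ->; rewrite cent1T inE.
have qp' : p \in q^' by rewrite inE /= inE.
pose S2 := [set <[x]>%G; 1%G].
have sS2 : [set 1%G] \subset cyc G by rewrite sub1set cyc1.
have [A sAQ oA] : exists2 A : {group gT}, A \subset Q & #|A| = q.
  have [_ qQdv _] := pgroup_pdiv qQ ntQ; have [y Qy oy] := Cauchy q_pr qQdv.
  by exists <[y]>%G; rewrite ?cycle_subG.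
have cA : A \in cyc G by rewrite mem_cyc (subset_trans sAQ) // prime_cyclic ?oA.
have ntx : #[x] != 1%N.
  by rewrite order_eq1; apply: contraNneq ncx => ->; apply: group1.
have pOx : {in orbit 'JG Q <[x]>%G, forall L : {group gT}, #|L| = #[x]}.
  by move=> L /orbitJG_card.
have nqx : q != #[x].
  apply: contraNneq ncx => def_q; move: px; rewrite /p_elt -def_q.
  by rewrite pnatE // inE eq_sym (negPf ne_pq).
suff: #|[set 1%G : {group gT}]| + #|[set A]| + #|orbit 'JG Q <[x]>%G| <= #|cyc G|.
  by rewrite !cards1 oO c13.
apply: leq_card_disjoint3 => //.
- by rewrite sub1set.
- by rewrite orbitJG_cyc // cycle_cyc.
- apply: (disjointP_pred (P := fun L => L == 1%G)) => L; rewrite inE // => /eqP->.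
  by apply/eqP=> A1; move: q_pr; rewrite -oA A1 cards1.
- apply: (disjointP_pred (P := fun L => L == 1%G)) => L; rewrite ?inE //.
  by move/pOx=> oL; apply: contraNneq ntx => L1; rewrite -oL L1 cards1.
apply: (disjointP_pred (P := fun L : {group gT} => #|L| == q)) => L.
  by rewrite inE => /eqP->; rewrite oA.
by move/pOx->; rewrite eq_sym.
Qed.

(** As q >= 7, two subgroups of order q would mean q + 1 of them, besides an orbit with at least q
    members: more than 13. So there is a single A of order q; it is normal in G, and Q is cyclic.
    The number of cyclic subgroups outside C_G(A) is a positive multiple of q and at most 11, hence
    q. *)
Lemma large_prime_metacyclic13 p q x Q : noncentral_action G p q x Q -> 6 < q ->
  metacyclic13 G.
Proof.
move=> act q_gt6; have [oO k_gt1 _ qk] := noncentral_action_index act.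
have [[p_pr q_pr] ne_pq [Gx px] [sQG qQ] /andP[nQx ncx]] := act.
have le_qk : q <= #|Q : 'C_Q[x]|.
  have /p_natP[[|m] ek] := qk; first by rewrite ek in k_gt1.
  by rewrite ek -{1}[q]expn1 leq_exp2l ?prime_gt1.
have uniq_q (A B : {group gT}) : A \subset G -> B \subset G -> #|A| = q -> #|B| = q -> A = B.
  move=> sAG sBG oA oB; apply/eqP/idPn=> neAB.
  have := card_prime_subgroups q_pr sAG sBG oA oB neAB.
  suff: #|prime_subgroups q G| + #|orbit 'JG Q <[x]>%G| <= #|cyc G|.
    by rewrite oO c13; move: le_qk q_gt6; clear; lia.
  rewrite -(cardsUI (prime_subgroups q G)) [X in _ + X](_ : _ = 0) ?addn0.
    rewrite subset_leq_card // subUset orbitJG_cyc ?cycle_cyc // andbT.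
    by apply/subsetP=> L; rewrite inE => /andP[].
  apply/eqP; rewrite cards_eq0 setI_eq0.
  apply: (disjointP_pred (P := fun L : {group gT} => #|L| == q)) => L.
    by rewrite in_prime_subgroups // => /andP[].
  move/orbitJG_card->; apply: contraNneq ncx => def_q; move: px.
  by rewrite /p_elt orderE def_q pnatE // inE eq_sym (negPf ne_pq).
have ntQ : Q :!=: 1 by apply: contraNneq ncx => ->; rewrite cent1T inE.
have [_ qQdv _] := pgroup_pdiv qQ ntQ; have [y Qy oy] := Cauchy q_pr qQdv.
pose A := <[y]>%G; have oA : #|A| = q by [].
have sAQ : A \subset Q by rewrite cycle_subG.
have sAG := subset_trans sAQ sQG.
have nAG : A <| G.
  rewrite /normal sAG; apply/subsetP=> g Gg; apply/normP.
  suff /(congr1 val) : (A :^ g)%G = A by [].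
  by apply: uniq_q; rewrite //= ?cardJg // -(conjGid Gg) conjSg.
have uniqA z : z \in Q -> #[z] = q -> z \in A.
  move=> Qz oz; rewrite -(uniq_q <[z]>%G A) ?cycle_id //.
  by rewrite cycle_subG (subsetP sQG).
have cQ : cyclic Q.
  have oddq : odd q by case: (even_prime q_pr) q_gt6 => [->|].
  have oddQ : odd #|Q| by have /p_natP[m ->] := qQ; rewrite oddX oddq orbT.
  rewrite (odd_pgroup_rank1_cyclic qQ oddQ) leqNgt; apply/negP => /p_rank_geP[E E2].
  have [sEQ abE _] := pnElemP E2; have oE := card_pnElem E2.
  have /subsetPn[e Ee nAe] : ~~ (E \subset A).
    apply/negP=> /subset_leq_card; rewrite oE oA.
    by rewrite -[X in _ <= X]expn1 leq_exp2l // prime_gt1.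
  have nte : e != 1 by apply: contraNneq nAe => ->; apply: group1.
  case/negP: nAe; apply: uniqA; first exact: (subsetP sEQ).
  exact: abelem_order_p abE Ee nte.
(* In the coprime action on the abelian Q, x fixes only 1 in [Q, x], yet [Q, x] contains A. *)
have ncAx : x \notin 'C(A).
  apply/negP=> cAx; have coQx : coprime #|Q| #|<[x]>|.
    rewrite (pnat_coprime qQ) // (sub_in_pnat _ px) // => r _ /eqnP->.
    by rewrite inE /= inE.
  have nQX : <[x]> \subset 'N(Q) by rewrite cycle_subG.
  have TI := coprime_abel_cent_TI nQX coQx (cyclic_abelian cQ).
  have sDQ : [~: Q, <[x]>] \subset Q by rewrite commg_subl.
  have ntD : [~: Q, <[x]>] != 1.
    by apply: contra ncx => /eqP/commG1P; rewrite centsC cycle_subG.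
  have [_ qDdv _] := pgroup_pdiv (pgroupS sDQ qQ) ntD; have [z Dz oz] := Cauchy q_pr qDdv.
  have: z \in 'C_[~: Q, <[x]>](<[x]>).
    rewrite inE Dz cent_cycle.
    have Az : z \in A by apply: uniqA => //; apply: (subsetP sDQ).
    by apply/cent1P; first [apply: (centP cAx) | apply/commute_sym/(centP cAx)].
  rewrite TI => /set1P z1; move: q_pr; by rewrite -oz z1 order1.
have act' : noncentral_action G p q x A.
  split=> //; last by rewrite ncAx (subsetP (normal_norm nAG)).
  by split=> //; rewrite /pgroup oA pnat_id.
apply: (normal_prime_metacyclic13 act' nAG oA).
have dv := dvdn_outside q_pr nAG oA.
have le_out : #|cyc G :\: cyc 'C_G(A)| <= 11.
  have sCG : 'C_G(A) \subset G := subsetIl _ _.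
  have := cardsID (cyc 'C_G(A)) (cyc G); rewrite (setIidPr (cycS sCG)) c13.
  suff: 1 < #|cyc 'C_G(A)| by clear; lia.
  have cA : A \in cyc 'C_G(A).
    rewrite mem_cyc cycle_cyclic subsetI sAG andbT; exact: cycle_abelian.
  rewrite (cardD1 1%G) cyc1 (cardD1 A) inE /= cA andbT add1n ltnS.
  by rewrite -val_eqE /= -cardG_gt1 -/A oA prime_gt1.
have gt0_out : 0 < #|cyc G :\: cyc 'C_G(A)|.
  rewrite card_gt0; apply/set0Pn; exists <[x]>%G.
  by rewrite in_setD !cycle_cyc inE Gx ncAx.
case/dvdnP: dv => [[|[|m]] em]; rewrite em ?mul1n // in gt0_out le_out *.
by move: le_out q_gt6; clear; rewrite !mulSn; lia.
Qed.

End ThirteenCyclic.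

(** * A 2-element inverting an element of order 3 or 5 *)

(** [y] is the last of the powers x^(2^j) that does not centralise Q. As y^2 does, the commutator b
    = u^-1 u^y is inverted by y, and a power of b has order q. *)
Lemma noncentral_action_inverted (gT : finGroupType) (G : {group gT}) q x Q :
    noncentral_action G 2 q x Q ->
  exists a, exists y, [/\ a \in G, #[a] = q, y \in G, 2.-elt y & a ^ y = a^-1].
Proof.
case=> [[_ q_pr] ne_2q [Gx px] [sQG qQ] /andP[nQx ncx]].
have exj : exists j, x ^+ (2 ^ j) \in 'C(Q).
  by have /p_natP[j ox] := px; exists j; rewrite -ox expg_order group1.
case: (ex_minnP exj) => [[|j] Cxj minj]; first by rewrite expg1 in Cxj; rewrite Cxj in ncx.
set y := x ^+ (2 ^ j); have Cy2 : y ^+ 2 \in 'C(Q) by rewrite -expgM -expnSr.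
have ncy : y \notin 'C(Q) by apply/negP=> /minj; rewrite ltnn.
have nQy : y \in 'N(Q) by rewrite groupX.
have [u Qu ncuy] : exists2 u, u \in Q & u ^ y != u.
  apply/exists_inP; apply: contraR ncy => /exists_inPn cQy.
  apply/centP=> u Qu; have /negPn/eqP uy := cQy u Qu.
  by apply/commute_sym/commgP; rewrite -conjg_fix uy.
pose b := u^-1 * u ^ y; have Qb : b \in Q by rewrite groupM ?groupV ?memJ_norm.
have by_ : b ^ y = b^-1.
  have cyy : y * y \in 'C(Q) by exact: Cy2.
  rewrite /b conjMg conjVg -conjgM [RHS]invMg invgK; congr (_ * _).
  by apply/conjg_fixP/commgP/commute_sym; apply: (centP cyy).
have ntb : b != 1 by rewrite -eq_mulVg1 eq_sym.
have qb : q %| #[b].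
  have /p_natP[[|m] ob] := mem_p_elt qQ Qb; last by rewrite ob expnS dvdn_mulr.
  by rewrite -order_eq1 ob in ntb.
exists (b ^+ (#[b] %/ q)), y; split; rewrite ?groupX //; first exact: (subsetP sQG).
- have mq := divnK qb; have m_gt0 : 0 < #[b] %/ q.
    by rewrite divn_gt0 ?prime_gt0 // dvdn_leq.
  have dvm : #[b] %/ q %| #[b] by rewrite -{2}mq dvdn_mulr.
  by rewrite orderXdiv // -{1}mq mulKn.
- exact: p_eltX.
by rewrite conjXg by_ expgVn.
Qed.

Lemma index_cent_cyclic (gT : finGroupType) (G L : {group gT}) :
  G \subset 'N(L) -> cyclic L -> #|G : 'C_G(L)| %| totient #|L|.
Proof.
move=> nLG cL; have <- : #|conj_aut L @* G| = #|G : 'C_G(L)|.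
  by rewrite card_morphim ker_conj_aut (setIidPr nLG) indexgI.
by rewrite -card_Aut_cyclic // cardSg // Aut_conj_aut.
Qed.

Section Inverted.

Variables (gT : finGroupType) (G : {group gT}) (q : nat) (a x : gT).
Hypotheses (c13 : #|cyc G| = 13) (q_pr : prime q) (q_odd : odd q).
Hypotheses (Ga : a \in G) (oa : #[a] = q) (Gx : x \in G) (x2 : 2.-elt x).
Hypothesis ax : a ^ x = a^-1.

Let A := <[a]>%G.
Let oA : #|A| = q. Proof. exact: oa. Qed.
Let A_pr : prime #|A|. Proof. by rewrite oA. Qed.
Let A_odd : odd #|A|. Proof. by rewrite oA. Qed.
Let sAG : A \subset G. Proof. by rewrite cycle_subG. Qed.
Let q_gt2 : 2 < q. Proof. exact: odd_prime_gt2. Qed.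

Let nAx : x \in 'N(A).
Proof. by apply/normP; rewrite -cycleJ ax cycleV. Qed.

Let invA b : b ^ x = b^-1 -> b ^ x = b -> odd #[b] -> b = 1.
Proof.
move=> -> eqb odd_b; apply/eqP; rewrite -order_eq1 -dvdn1.
have b2 : #[b] %| 2 by rewrite order_dvdn expgS expg1 -{1}eqb mulVg.
by move: (dvdn_leq (isT : 0 < 2) b2) odd_b (order_gt0 b); case: #[b] => [|[|[|]]].
Qed.

Let ncx : x \notin 'C(A).
Proof.
apply: contraL A_pr => cAx; have ax' : a ^ x = a.
  by apply/conjg_fixP/commgP/commute_sym; apply: (centP cAx); rewrite cycle_id.
by rewrite /= (invA ax ax') ?oa // cycle1 cards1.
Qed.

Let actA : noncentral_action G 2 q x A.
Proof.
split=> //; last by rewrite nAx ncx.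
  by rewrite neq_ltn q_gt2.
by split=> //; rewrite /pgroup oA pnat_id.
Qed.

Let oO1 : #|orbit 'JG A <[x]>%G| = q.
Proof. exact: orbit_prime_cycle. Qed.

Let orbit_nC (y : gT) L : y \notin 'C(A) -> L \in orbit 'JG A <[y]>%G ->
  ~~ (L \subset 'C(A)).
Proof.
move=> ncy /orbitJG_P[b Ab ->].
have Nb : b \in 'N('C(A)) by rewrite (subsetP _ b Ab) // norms_cent // normG.
by rewrite -(normP Nb) conjSg cycle_subG.
Qed.

Let oddCq (y : gT) : 2.-elt y -> #[y] != q.
Proof.
case/p_natP=> m ->; apply/eqP=> def_q; move: q_odd; rewrite -def_q oddX orbF.
by case: m def_q => // e; move: q_pr; rewrite -e.
Qed.

(** E = A x B has q + 2 cyclic subgroups. If N_E(<x>) were trivial, <x> would have q^2 conjugates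
    under E, too many; so x commutes with some z of order q in E, and the A-orbits of <x> and <x z>
    force q = 3. These make 5 + 3 + 3 = 11 subgroups, so no three further ones exist. This yields in
    turn x^2 = 1, the normality of E and of A, and a wrong total. *)
Lemma inverted_no_p2Elem (B : {group gT}) : B \subset G -> #|B| = q -> A != B -> A \subset 'N(B) -> False.
Proof.
move=> sBG oB neAB nBA.
have E2 := prime_subgroups_p2Elem q_pr oA oB neAB nBA.
set E := (A <*> B)%G in E2; have [_ abE _] := pnElemP E2; have oE := card_pnElem E2.
have cEE := abelem_abelian abE.
have sAE : A \subset E := joing_subl _ _.
have sEG : E \subset G by rewrite join_subG sAG.
have qE : q.-group E := abelem_pgroup abE.
have oddE (K : {group gT}) : K \subset E -> odd #|K|.
  move=> sKE; have /p_natP[m ->] := pgroupS sKE qE; by rewrite oddX q_odd orbT.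
have cE := card_cyc_p2Elem q_pr E2.
pose N := 'N_E(<[x]>)%G; have sNE : N \subset E := subsetIl _ _.
have cNx : x \in 'C(N).
  by apply: cent_2elt => //; [apply: oddE | apply: subsetIr].
have sEC : E \subset 'C(A) by rewrite centsC (subset_trans sAE).
have evx : ~~ odd #[x].
  have /p_natP[[|m] ox] := x2; last by rewrite ox oddX.
  by case/negP: ncx; have /eqP := ox; rewrite expn0 order_eq1 => /eqP->; apply: group1.
have disE (T : {set {group gT}}) : {in T, forall L : {group gT}, ~~ odd #|L|} ->
    [disjoint cyc E & T].
  move=> evT; apply: (disjointP_pred (P := fun L : {group gT} => odd #|L|)) => L.
    by rewrite mem_cyc => /andP[/oddE].
  exact: evT.
have sO1 : orbit 'JG A <[x]>%G \subset cyc G by rewrite orbitJG_cyc // cycle_cyc.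
have [N1 | ntN] := eqVneq N 1%G.
  have oO : #|orbit 'JG E <[x]>%G| = (q ^ 2)%N.
    by rewrite card_orbitJG [X in #|_ : X|](congr1 val N1) indexg1.
  suff: #|cyc E| + #|orbit 'JG E <[x]>%G| <= #|cyc G|.
    rewrite cE oO c13 => le13; have: 9 <= q ^ 2 by rewrite -[9]/(3 ^ 2)%N leq_exp2r.
    by move: le13 q_gt2; clear; lia.
  have dis : [disjoint cyc E & orbit 'JG E <[x]>%G].
    by apply: disE => L /orbitJG_card->.
  rewrite -(eqP (etrans (leq_card_setU _ _).2 dis)) subset_leq_card // subUset.
  by rewrite cycS // orbitJG_cyc // cycle_cyc.
have [z Nz oz] : exists2 z, z \in N & #[z] = q.
  have [_ qN _] := pgroup_pdiv (pgroupS sNE qE) ntN.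
  by have [z Nz oz] := Cauchy q_pr qN; exists z.
have Ez := subsetP sNE z Nz; have Gz := subsetP sEG z Ez.
have cxz : commute x z by apply: (centP cNx).
have coxz : coprime #[x] #[z].
  by rewrite oz (pnat_coprime x2) // pnatE // !inE neq_ltn q_gt2 orbT.
have cAz : z \in 'C(A) by rewrite (subsetP _ z Ez) // centsC (subset_trans sAE).
pose y := x * z; have Gy : y \in G by rewrite groupM.
have oy : #[y] = (#[x] * q)%N by rewrite orderM // oz.
have ncy : y \notin 'C(A) by rewrite groupMr.
have nAy : y \in 'N(A) by rewrite groupM // (subsetP (cent_sub _)).
have oO2 : #|orbit 'JG A <[y]>%G| = q by apply: orbit_prime_cycle.
have sO2 : orbit 'JG A <[y]>%G \subset cyc G by rewrite orbitJG_cyc // cycle_cyc.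
have evO1 : {in orbit 'JG A <[x]>%G, forall L : {group gT}, ~~ odd #|L|}.
  by move=> L /orbitJG_card->.
have evO2 : {in orbit 'JG A <[y]>%G, forall L : {group gT}, ~~ odd #|L|}.
  by move=> L /orbitJG_card->; rewrite -orderE oy oddM negb_and evx.
have d12 : [disjoint orbit 'JG A <[x]>%G & orbit 'JG A <[y]>%G].
  apply: (disjointP_pred (P := fun L : {group gT} => #|L| == #[x])) => L /orbitJG_card-> //.
  by rewrite -orderE oy -{2}[#[x]]muln1 eqn_pmul2l ?order_gt0 // neq_ltn prime_gt1 ?orbT.
have sEc := cycS sEG; have dE1 := disE _ evO1; have dE2 := disE _ evO2.
have q3 : q = 3.
  have := leq_card_disjoint3 sEc sO1 sO2 dE1 dE2 d12; rewrite cE oO1 oO2 c13.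
  by move: q_gt2 q_odd; case: (q) => [|[|[|[|[|q']]]]] //; clear; lia.
have nsNA : ~~ (A \subset N).
  by apply: contra ncx => sAN; apply: (subsetP (centS sAN)).
have tiAz : A :&: <[z]> = 1.
  apply: prime_TIg => //; apply: contra nsNA => /subset_trans-> //.
  by rewrite cycle_subG.
have defE : A * <[z]> = E.
  have oAz : #|A * <[z]>| = #|E| by rewrite TI_cardMg // oE oA -orderE oz mulnn.
  by apply/eqP; rewrite eqEcard oAz leqnn andbT mul_subG // cycle_subG.
(* Otherwise x^2 centralises E, and its joins with the five cyclic subgroups of E are new: they have
   even order and centralise A. *)
have ox : #[x] = 2.
  have [x21 | ntx2] := eqVneq (x ^+ 2) 1.
    by apply: nt_prime_order => //; apply: contraNneq ncx => ->; apply: group1.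
  have cEx2 : <[x ^+ 2]> \subset 'C(E).
    have ca : a \in 'C[x ^+ 2].
      by apply/cent1P/commgP/conjg_fixP; rewrite conjgM ax conjVg ax invgK.
    have cz : z \in 'C[x ^+ 2] by apply/cent1P/commuteX/commute_sym.
    by rewrite centsC cent_cycle -defE mul_subG // cycle_subG.
  pose T := [set (u.1 <*> u.2)%G | u : {group gT} * {group gT} in
    setX (cyc E) [set <[x ^+ 2]>%G]].
  have q'x2 : q^'.-group <[x ^+ 2]>.
    apply: (sub_in_pnat _ (p_eltX 2 x2)) => r _ /eqnP->.
    by rewrite inE /= inE q3.
  have oT : #|T| = 5.
    have -> : #|T| = (#|cyc E| * #|[set <[x ^+ 2]>%G]|)%N.
      by apply: (card_cyc_join qE) => L /set1P->.
    by rewrite cards1 muln1 cE q3.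
  have inT L : L \in T -> [/\ L \in cyc G, ~~ odd #|L| & L \subset 'C(A)].
    case/imsetP=> [[D M]] /setXP[/= cD /set1P->] ->; split.
    - by apply: (joing_cyc qE q'x2 cEx2 cD) => //; rewrite ?cycle_cyclic // cycle_subG groupX.
    - apply: (contra (fun o => dvdn_odd (cardSg (joing_subr D <[x ^+ 2]>)) o)).
      have /p_natP[[|m] ox2] := p_eltX 2 x2; last by rewrite /= -orderE ox2 oddX.
      by have /eqP := ox2; rewrite expn0 order_eq1 (negPf ntx2).
    move: cD; rewrite mem_cyc /= join_subG => /andP[sDE _].
    rewrite (subset_trans sDE sEC) /=; exact: subset_trans cEx2 (centS sAE).
  have sT : T \subset cyc G by apply/subsetP=> L /inT[].
  have dT1 : [disjoint orbit 'JG A <[x]>%G & T].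
    rewrite disjoint_sym; apply: (disjointP_pred (P := fun L : {group gT} => L \subset 'C(A))) => L.
      by case/inT.
    exact: orbit_nC.
  have dT2 : [disjoint orbit 'JG A <[y]>%G & T].
    rewrite disjoint_sym; apply: (disjointP_pred (P := fun L : {group gT} => L \subset 'C(A))) => L.
      by case/inT.
    exact: orbit_nC.
  have dET : [disjoint cyc E & T] by apply: disE => L /inT[].
  have := leq_card_disjoint4 sEc sO1 sO2 sT dE1 dE2 dET d12 dT1 dT2.
  by rewrite cE oO1 oO2 oT c13 q3.

(* A subgroup of order 3 outside E brings three of them: its conjugates under A, or those other than
   A in the group of type (3, 3) that it spans with A. *)
have prime3_E (B1 : {group gT}) : B1 \subset G -> #|B1| = q -> B1 \subset E.
  move=> sB1G oB1; apply/idPn=> nsB1E.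
  suff [T [sT T3 oT nET]] : exists T : {set {group gT}}, [/\ T \subset cyc G, 2 < #|T|,
      {in T, forall L : {group gT}, #|L| = q} & {in T, forall L : {group gT}, ~~ (L \subset E)}].
    have dET : [disjoint cyc E & T].
      apply: (disjointP_pred (P := fun L : {group gT} => L \subset E)) => [L|]; last by [].
      by rewrite mem_cyc => /andP[].
    have dT1 : [disjoint orbit 'JG A <[x]>%G & T].
      apply: (disjointP_pred (P := fun L : {group gT} => ~~ odd #|L|)) => L; first exact: evO1.
      by move/oT->; rewrite q_odd.
    have dT2 : [disjoint orbit 'JG A <[y]>%G & T].
      apply: (disjointP_pred (P := fun L : {group gT} => ~~ odd #|L|)) => L; first exact: evO2.
      by move/oT->; rewrite q_odd.
    have := leq_card_disjoint4 sEc sO1 sO2 sT dE1 dE2 dET d12 dT1 dT2.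
    by rewrite cE oO1 oO2 c13 q3; move: T3; clear; lia.
  have [nB1A | nnB1A] := boolP (A \subset 'N(B1)); last first.
    exists (orbit 'JG A B1); split.
    - by rewrite orbitJG_cyc // mem_cyc sB1G prime_cyclic ?oB1.
    - rewrite card_orbitJG; suff -> : 'N_A(B1) = 1 by rewrite indexg1 oA.
      by apply: contraNeq nnB1A; apply: prime_meetG.
    - by move=> L /orbitJG_card->.
    move=> L /orbitJG_P[b Ab ->]; rewrite -(conjGid (subsetP sAE b Ab)) conjSg //.
  have neAB1 : A != B1 by apply: contraNneq nsB1E => <-.
  have E21 := prime_subgroups_p2Elem q_pr oA oB1 neAB1 nB1A.
  have cA1 : A \in 'E_q^1(A <*> B1) by rewrite p1ElemE // !inE joing_subl oA eqxx.
  exists ('E_q^1(A <*> B1) :\ A); split.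
  - apply/subsetP=> L; rewrite in_setD1 p1ElemE // !inE => /and3P[_ sL /eqP oL].
    rewrite -mem_cyc; rewrite mem_cyc prime_cyclic ?oL // andbT.
    by apply: subset_trans sL _; rewrite join_subG sAG.
  - have := cardsD1 A 'E_q^1(A <*> B1); rewrite cA1 (card_p1Elem_p2Elem E21).
    by move: q_gt2; clear; rewrite add1n => q_gt2 [<-].
  - by move=> L; rewrite in_setD1 p1ElemE // !inE => /and3P[_ _ /eqP].
  move=> L; rewrite in_setD1 p1ElemE // !inE => /and3P[neLA sL /eqP oL].
  apply: contra nsB1E => sLE; apply: subset_trans (joing_subr A B1) _.
  have nLA : A \subset 'N(L).
    apply: cents_norm; apply: subset_trans sAE _; exact: sub_abelian_cent cEE sLE.
  have neAL : A != L by rewrite eq_sym.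
  have E22 := prime_subgroups_p2Elem q_pr oA oL neAL nLA.
  have <- : A <*> L = A <*> B1.
    apply/eqP; rewrite eqEcard join_subG joing_subl sL /=.
    by rewrite (card_pnElem E21) (card_pnElem E22).
  by rewrite join_subG sAE.
have nEG : E <| G.
  rewrite /normal sEG; apply/subsetP=> g Gg; rewrite inE; apply/subsetP=> e'.
  rewrite mem_conjg => Ee; have [->|nte] := eqVneq e' 1; first exact: group1.
  rewrite -cycle_subG prime3_E // ?cycle_subG.
    by rewrite -(groupJr _ (groupVr Gg)) (subsetP sEG).
  rewrite -orderE -(orderJ e' g^-1); apply: abelem_order_p abE Ee _.
  by rewrite conjg_eq1.
have sGE g b : g \in G -> b \in E -> b ^ g \in E.
  by move=> Gg Eb; rewrite memJ_norm // (subsetP (normal_norm nEG)).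
have conjE u e b : u \in G -> e \in E -> b \in E -> b ^ (u ^ e) = b ^ u.
  move=> Gu Ee Eb; have fixE b1 e1 : b1 \in E -> e1 \in E -> b1 ^ e1 = b1.
    by move=> Eb1 Ee1; apply/conjg_fixP/commgP; apply: (centsP cEE).
  have -> : u ^ e = e^-1 * u * e by rewrite conjgE mulgA.
  have Ev : e^-1 \in E by rewrite groupV.
  by rewrite !conjgM (fixE b e^-1 Eb Ev) (fixE (b ^ u) e (sGE _ _ Gu Eb) Ee).
have Ex_inv b : b \in E -> b ^ x = b^-1 -> b \in A.
  rewrite -[E : {set gT}]defE => /mulsgP[a1 w Aa1 zw ->].
  have wx : w ^ x = w.
    by apply/conjg_fixP/commgP/commute_sym; apply: (centP cNx); apply: subsetP zw; rewrite cycle_subG.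
  have a1x : a1 ^ x = a1^-1 by case/cycleP: Aa1 => i ->; rewrite conjXg ax expgVn.
  have cwa : commute a1 w.
    have Ew : w \in E by apply: subsetP zw; rewrite cycle_subG.
    by apply: (centsP cEE) => //; apply: (subsetP sAE).
  rewrite conjMg wx a1x invMg -(commuteV (commute_sym (commuteV (commute_sym cwa)))).
  move/mulgI => wV; have wVx : w ^ x = w^-1 by rewrite wx.
  rewrite (invA wVx wx) ?mulg1 //.
  have : <[w]> \subset E by rewrite cycle_subG; apply: subsetP zw; rewrite cycle_subG.
  exact: oddE.
(* If A^g differs from A, the three conjugates of <x^g> under A^g are new. A coincidence with
   conjugates of <x> under A would make x invert a^g, since E is abelian; but the elements of E
   inverted by x lie in A. *)
have nAG : A <| G.
  rewrite /normal sAG; apply/subsetP=> g Gg; apply/normP/eqP/idPn=> neAg.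
  set xg := x ^ g; have Gxg : xg \in G by rewrite groupJ.
  have sAgE : A :^ g \subset E by rewrite -(normP (subsetP (normal_norm nEG) g Gg)) conjSg.
  have ncxg : xg \notin 'C(A :^ g) by rewrite centJ memJ_conjg.
  have oO3 : #|orbit 'JG (A :^ g) <[xg]>%G| = q.
    by rewrite (@orbit_2elt _ (A :^ g)%G) /= ?cardJg // /p_elt orderJ.
  have sO3 : orbit 'JG (A :^ g) <[xg]>%G \subset cyc G.
    by apply: (@orbitJG_cyc _ G (A :^ g)%G); rewrite ?cycle_cyc //= (subset_trans sAgE).
  have ordO3 : {in orbit 'JG (A :^ g) <[xg]>%G, forall L : {group gT}, #|L| = #[x]}.
    by move=> L /(@orbitJG_card _ (A :^ g)%G)->; rewrite -orderE orderJ.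
  have d23 : [disjoint orbit 'JG A <[y]>%G & orbit 'JG (A :^ g) <[xg]>%G].
    rewrite disjoint_sym; apply: (disjointP_pred (P := fun L : {group gT} => #|L| == #[x])) => L.
      by move/ordO3->.
    move/orbitJG_card->.
    by rewrite -orderE oy -{2}[#[x]]muln1 eqn_pmul2l ?order_gt0 // neq_ltn prime_gt1 ?orbT.
  have dE3 : [disjoint cyc E & orbit 'JG (A :^ g) <[xg]>%G].
    by apply: disE => L /ordO3->.
  have d13 : [disjoint orbit 'JG A <[x]>%G & orbit 'JG (A :^ g) <[xg]>%G].
    apply/pred0P=> L /=; apply/negP=> /andP[/orbitJG_P[e Ae defL]].
    case/(@orbitJG_P _ (A :^ g)%G) => e1 Ae1; rewrite defL /= -!cycleJ => eqx.
    have {}eqx : x ^ e = xg ^ e1.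
      have: x ^ e \in <[xg ^ e1]> by rewrite -eqx cycle_id.
      rewrite cycle2g ?orderJ // !inE => /orP[/eqP x1 | /eqP //].
      by have := orderJ x e; rewrite x1 order1 ox.
    have Ee := subsetP sAE e Ae; have Ee1 := subsetP sAgE e1 Ae1.
    have Ea : a \in E by rewrite (subsetP sAE) // cycle_id.
    have Eag := sGE g a Gg Ea.
    have Aag : a ^ g \in A.
      apply: Ex_inv => //; rewrite -(conjE x e) // eqx conjE //.
      by rewrite /xg -conjJg ax conjVg.
    case/eqP: neAg; apply/eqP; rewrite eqEcard cardJg leqnn andbT.
    by rewrite -cycleJ cycle_subG.
  have := leq_card_disjoint4 sEc sO1 sO2 sO3 dE1 dE2 dE3 d12 d13 d23.
  by rewrite cE oO1 oO2 oO3 c13 q3.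
have sECG : E \subset 'C_G(A) by rewrite subsetI sEG.
have sCG : 'C_G(A) \subset G := subsetIl _ _.
(* |D| is a multiple of 3, at least 6 by the two orbits and at most 13 - 5, hence 6. The 3 + 6
   generators in the two orbits then make up |G| - |C_G(A)|, which forces |C_G(A)| = 9, so C_G(A) =
   E and the total is 5 + 6. *)
pose D := cyc G :\: cyc 'C_G(A).
have cardD : #|cyc 'C_G(A)| + #|D| = 13.
  by rewrite -c13 -(cardsID (cyc 'C_G(A)) (cyc G)) (setIidPr (cycS sCG)).
have sOD : orbit 'JG A <[x]>%G :|: orbit 'JG A <[y]>%G \subset D.
  by rewrite subUset !(orbit_outside nAG).
have oU : #|orbit 'JG A <[x]>%G :|: orbit 'JG A <[y]>%G| = 6.
  by rewrite (eqP (etrans (leq_card_setU _ _).2 d12)) oO1 oO2 q3.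
have le5 : 5 <= #|cyc 'C_G(A)| by rewrite (leq_trans _ (subset_leq_card (cycS sECG))) // cE q3.
have dvD := dvdn_outside q_pr nAG oA; rewrite -/D q3 in dvD.
have oD : #|D| = 6.
  have := subset_leq_card sOD; rewrite oU; case/dvdnP: dvD => m em.
  by move: em cardD le5; move: #|D| #|cyc _| => d c; clear; lia.
have eqD : D = orbit 'JG A <[x]>%G :|: orbit 'JG A <[y]>%G.
  by apply/esym/eqP; rewrite eqEcard sOD oU oD.
have := sum_totient_cycD sCG; rewrite -/D eqD (big_setID (orbit 'JG A <[x]>%G)) /=.
rewrite setUK setDUl setDv set0U (setDidPl _); last by rewrite disjoint_sym.
rewrite (eq_bigr (fun=> 1%N)) => [|L /orbitJG_card->]; last by rewrite -orderE ox.
rewrite [X in _ + X](eq_bigr (fun=> 2%N)) => [|L /orbitJG_card->]; last first.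
  by rewrite -orderE oy ox q3.
rewrite !sum_nat_const oO1 oO2 q3 -(Lagrange sCG) => eq9.
have le9 : 9 <= #|'C_G(A)| by rewrite (leq_trans _ (subset_leq_card sECG)) // oE q3.
have oC : #|'C_G(A)| = 9.
  move: eq9 le9; move: #|'C_G(A)| #|G : _| => c [|[|k]]; clear; try lia.
have eqC : 'C_G(A) = E.
  by apply/esym/eqP; rewrite eqEcard sECG oC oE q3.
have : 'C_G(A)%G = E by apply: val_inj.
by move=> eqC'; move: cardD; rewrite eqC' cE oD q3.
Qed.

Let ev_x : ~~ odd #[x].
Proof.
have /p_natP[[|m] ox] := x2; last by rewrite ox oddX.
by case/negP: ncx; have /eqP := ox; rewrite expn0 order_eq1 => /eqP->; apply: group1.
Qed.

Lemma inverted_isolated (B : {group gT}) : B \subset G -> #|B| = q ->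
  A \subset 'N(B) -> B = A.
Proof.
move=> sBG oB nBA; apply/eqP; rewrite eq_sym; apply/idPn => neAB.
exact: inverted_no_p2Elem sBG oB neAB nBA.
Qed.

Let Omega := orbit 'JG G A.
Let sOG : Omega \subset cyc G.
Proof. by apply: orbitJG_cyc; rewrite ?subxx // cycle_cyc. Qed.
Let oOm : {in Omega, forall L : {group gT}, #|L| = q}.
Proof. by move=> L /orbitJG_card->. Qed.
Let sO1 : orbit 'JG A <[x]>%G \subset cyc G.
Proof. by rewrite orbitJG_cyc // cycle_cyc. Qed.
Let oO1x : {in orbit 'JG A <[x]>%G, forall L : {group gT}, #|L| = #[x]}.
Proof. by move=> L /orbitJG_card->. Qed.

Let disj_card (S T : {set {group gT}}) m n :
  {in S, forall L : {group gT}, #|L| = m} -> {in T, forall L : {group gT}, #|L| = n} ->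
  m != n -> [disjoint S & T].
Proof.
move=> Sm Tn ne; apply: (disjointP_pred (P := fun L : {group gT} => #|L| == m)) => L.
  by move/Sm->.
by move/Tn->; rewrite eq_sym.
Qed.

Let set1_card (B : {group gT}) m : #|B| = m ->
  {in [set B], forall L : {group gT}, #|L| = m}.
Proof. by move=> oB L /set1P->. Qed.

Let neq_ox m : odd m -> #[x] != m.
Proof. by apply: contraTneq => <-. Qed.

Let ne1q : 1%N != q. Proof. by rewrite neq_ltn prime_gt1. Qed.
Let dis1O : [disjoint [set 1%G] & Omega].
Proof. by apply: disj_card (set1_card _) oOm ne1q; rewrite cards1. Qed.
Let dis11 : [disjoint [set 1%G] & orbit 'JG A <[x]>%G].
Proof.
by apply: disj_card (set1_card _) oO1x _; rewrite ?cards1 // eq_sym neq_ox.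
Qed.
Let disO1 : [disjoint Omega & orbit 'JG A <[x]>%G].
Proof. by apply: disj_card oOm oO1x _; rewrite eq_sym neq_ox. Qed.
Let s1G : [set 1%G] \subset cyc G. Proof. by rewrite sub1set cyc1. Qed.

(** By [inverted_isolated], A normalises no conjugate of itself other than A. *)
Lemma inverted_orbit_mod : #|Omega| = 1 %[mod q].
Proof.
have qA : q.-group A by rewrite /pgroup oA pnat_id.
have actO : [acts A, on Omega | 'JG].
  by apply: subset_trans sAG _; apply: acts_orbit; apply: subsetT.
rewrite (pgroup_fix_mod qA actO) -[in RHS](cards1 A); congr (#|pred_of_set _| %% _)%N.
apply/setP=> B; rewrite !inE; apply/andP/eqP=> [[OB fixB] | ->]; last first.
  rewrite orbit_refl; split=> //; apply/subsetP=> b Ab; rewrite inE.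
  by apply/eqP/val_inj; rewrite /= conjGid.
apply: inverted_isolated; rewrite ?oOm //.
  by have := subsetP sOG B OB; rewrite mem_cyc => /andP[].
apply/subsetP=> b Ab; have := subsetP fixB b Ab; rewrite !inE.
by move/eqP/(congr1 val)=> /= ->.
Qed.

Lemma inverted_orbit_le : 1 + #|Omega| + q <= 13.
Proof.
have := leq_card_disjoint3 s1G sOG sO1 dis1O dis11 disO1.
by rewrite cards1 oO1 c13.
Qed.

Let norm_small (L : {group gT}) r : L \subset G -> prime r -> #|L| = r -> r != q ->
    odd r -> 13 < 1 + #|Omega| + q + q -> A \subset 'N(L).
Proof.
move=> sLG r_pr oL ne_rq r_odd gt13; apply: contraLR gt13 => nnLA; rewrite -leqNgt.
have oO : #|orbit 'JG A L| = q.
  rewrite card_orbitJG; suff -> : 'N_A(L) = 1 by rewrite indexg1.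
  by apply: contraNeq nnLA; apply: prime_meetG.
have cL : L \in cyc G by rewrite mem_cyc sLG prime_cyclic ?oL.
have oOL : {in orbit 'JG A L, forall K : {group gT}, #|K| = r}.
  by move=> K /orbitJG_card->.
have := leq_card_disjoint4 s1G sOG sO1 (orbitJG_cyc sAG cL) dis1O dis11.
rewrite cards1 oO1 oO c13; apply; rewrite ?disO1 //.
- by apply: disj_card (set1_card _) oOL _; rewrite ?cards1 // neq_ltn prime_gt1.
- by apply: disj_card oOm oOL _; rewrite eq_sym.
by apply: disj_card oO1x oOL _; rewrite neq_ox.
Qed.

Let cent_join (L B : {group gT}) r : prime r -> #|L| = r -> r != q -> #|B| = q ->
  B \subset G -> L \subset G -> B \subset 'C(L) -> (B <*> L)%G \in cyc G /\ #|B <*> L| = (q * r)%N.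
Proof.
move=> r_pr oL ne_rq oB sBG sLG cLB.
have coBL : coprime #|B| #|L|.
  by rewrite oB oL prime_coprime // dvdn_prime2 // eq_sym.
have defBL : B \x L = B <*> L by rewrite dprodEY ?coprime_TIg // centsC.
rewrite -(dprod_card defBL) oB oL; split=> //.
rewrite mem_cyc join_subG sBG sLG (cyclic_dprod defBL) //.
  by rewrite prime_cyclic ?oB.
by rewrite prime_cyclic ?oL.
Qed.

(** 3 divides |G|. A subgroup L of order 3 is normalised by A for lack of room, hence centralised; L
    and A L bring the count to 1 + 6 + 5 + 2 = 14. *)
Lemma inverted_orbit_not6 : q = 5 -> #|Omega| = 6 -> False.
Proof.
move=> q5 k6; have dv3 : 3 %| #|G|.
  apply: (@dvdn_trans 6) => //; rewrite -k6 /Omega card_orbitJG dvdn_indexg //.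
have [t Gt ot] := Cauchy (isT : prime 3) dv3; pose L := <[t]>%G.
have sLG : L \subset G by rewrite cycle_subG.
have ne3q : 3 != q by rewrite q5.
have nLA : A \subset 'N(L) by apply: (norm_small sLG (isT : prime 3)); rewrite ?k6 ?q5.
have cLA : A \subset 'C(L).
  by apply: coprime_totient_cent; rewrite ?cycle_cyclic // oA [#|L|]ot q5.
have [cAL oAL] := cent_join (isT : prime 3) ot ne3q oA sAG sLG cLA.
have sL : [set L] \subset cyc G by rewrite sub1set cycle_cyc.
have sAL : [set (A <*> L)%G] \subset cyc G by rewrite sub1set.
suff: #|[set 1%G : {group gT}]| + #|Omega| + #|orbit 'JG A <[x]>%G| + #|[set L]|
    + #|[set (A <*> L)%G]| <= #|cyc G| by rewrite !cards1 oO1 k6 q5 c13.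
apply: leq_card_disjoint5 => //.
- by apply: disj_card (set1_card _) (set1_card ot) _; rewrite ?cards1.
- by apply: disj_card (set1_card _) (set1_card oAL) _; rewrite ?cards1 // q5.
- by apply: disj_card oOm (set1_card ot) _; rewrite q5.
- by apply: disj_card oOm (set1_card oAL) _; rewrite q5.
- by apply: disj_card oO1x (set1_card ot) _; rewrite neq_ox.
- by apply: disj_card oO1x (set1_card oAL) _; rewrite neq_ox // q5.
by apply: disj_card (set1_card ot) (set1_card oAL) _; rewrite q5.
Qed.

(** 7 divides |G|. Two subgroups of order 7 would mean eight, so L of order 7 is normal and
    centralised by G'. As a = [a, x] lies in G', the conjugates of A centralise L too; two products
    of order 21 bring the count to 1 + 7 + 3 + 1 + 2 = 14. *)
Lemma inverted_orbit_not7 : q = 3 -> #|Omega| = 7 -> False.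
Proof.
move=> q3 k7; have dv7 : 7 %| #|G|.
  by rewrite -k7 /Omega card_orbitJG dvdn_indexg.
have [t Gt ot] := Cauchy (isT : prime 7) dv7; pose L := <[t]>%G.
have sLG : L \subset G by rewrite cycle_subG.
have ne7q : 7 != q by rewrite q3.
have ot' : #|L| = 7 by [].
have nLG : G \subset 'N(L).
  apply/subsetP=> g Gg; rewrite inE; apply/idPn=> nLg.
  have neL : L != (L :^ g)%G.
    by apply: contra nLg => /eqP/(congr1 val)/= <-.
  have sLgG : L :^ g \subset G by rewrite -(conjGid Gg) conjSg.
  have := card_prime_subgroups (isT : prime 7) sLG sLgG ot' (etrans (cardJg _ _) ot') neL.
  have o7 : {in prime_subgroups 7 G, forall K : {group gT}, #|K| = 7}.
    by move=> K; rewrite in_prime_subgroups // => /andP[_ /eqP].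
  have s7 : prime_subgroups 7 G \subset cyc G.
    by apply/subsetP=> K; rewrite in_set => /andP[].
  have d7 : [disjoint Omega & prime_subgroups 7 G].
    by apply: disj_card oOm o7 _; rewrite q3.
  have : #|Omega :|: prime_subgroups 7 G| <= 13.
    by rewrite -c13 subset_leq_card // subUset sOG.
  rewrite (eqP (etrans (leq_card_setU _ _).2 d7)) k7.
  by move: #|prime_subgroups _ _| => m; clear; lia.
have cLder : G^`(1) \subset 'C(L) by apply: der1_cent_cyclic nLG (cycle_cyclic t).
have a3 : a ^+ 3 = 1 by rewrite -q3 -oa expg_order.
have cLA : A \subset 'C(L).
  rewrite cycle_subG; apply: (subsetP cLder).
  have -> : a = [~ a, x].
    rewrite commgEl ax; apply: (mulgI (a ^+ 2)).
    by rewrite -expgSr a3 expgS expg1 mulgA mulgK mulgV.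
  exact: mem_commg.
have [B OB neBA] : exists2 B, B \in Omega & B != A.
  have: Omega != [set A] by apply/eqP=> eqO; rewrite eqO cards1 in k7.
  rewrite eqEsubset [in X in _ && X]sub1set orbit_refl andbT => /subsetPn[B OB].
  by rewrite inE => neBA; exists B.
have [g Gg defB] := orbitJG_P _ _ _ OB.
have cLB : B \subset 'C(L).
  have nC : g \in 'N('C(L)) by rewrite (subsetP _ g Gg) // norms_cent.
  by rewrite defB -(normP nC) conjSg.
have sBG : B \subset G by have := subsetP sOG B OB; rewrite mem_cyc => /andP[].
have [cAL oAL] := cent_join (isT : prime 7) ot' ne7q oA sAG sLG cLA.
have [cBL oBL] := cent_join (isT : prime 7) ot' ne7q (oOm OB) sBG sLG cLB.
have neABL : (A <*> L)%G != (B <*> L)%G.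
  apply: contra neBA => /eqP eqL; rewrite -val_eqE /=.
  have cyAL : cyclic (A <*> L) by move: cAL; rewrite mem_cyc => /andP[].
  rewrite (eq_subG_cyclic cyAL) ?joing_subl //; first by rewrite (oOm OB) oA.
  by move/(congr1 val): eqL => /= ->; apply: joing_subl.
have s2 : [set (A <*> L)%G; (B <*> L)%G] \subset cyc G by rewrite subUset !sub1set cAL.
have sL : [set L] \subset cyc G by rewrite sub1set cycle_cyc.
have o2 : {in [set (A <*> L)%G; (B <*> L)%G], forall K : {group gT}, #|K| = (q * 7)%N}.
  by move=> K /set2P[] ->.
suff: #|[set 1%G : {group gT}]| + #|Omega| + #|orbit 'JG A <[x]>%G| + #|[set L]|
    + #|[set (A <*> L)%G; (B <*> L)%G]| <= #|cyc G|.
  by rewrite !cards1 cards2 neABL oO1 k7 q3 c13.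
apply: leq_card_disjoint5 => //.
- by apply: disj_card (set1_card _) (set1_card ot') _; rewrite ?cards1.
- by apply: disj_card (set1_card _) o2 _; rewrite ?cards1 // q3.
- by apply: disj_card oOm (set1_card ot') _; rewrite q3.
- by apply: disj_card oOm o2 _; rewrite q3.
- by apply: disj_card oO1x (set1_card ot') _; rewrite neq_ox.
- by apply: disj_card oO1x o2 _; rewrite neq_ox // q3.
by apply: disj_card (set1_card ot') o2 _; rewrite q3.
Qed.

(** Three 2-elements are told apart by their action on the four conjugates of A: x fixes A, some x^g
    moves A but fixes another conjugate, some z moves all four. Their A-orbits, with 1 and [Omega],
    make 1 + 4 + 9 = 14. *)
Lemma inverted_orbit_not4 : q = 3 -> #|Omega| = 4 -> False.
Proof.
move=> q3 k4.
have [B OB neBA] : exists2 B, B \in Omega & B != A.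
  have: Omega != [set A] by apply/eqP=> eqO; rewrite eqO cards1 in k4.
  rewrite eqEsubset [in X in _ && X]sub1set orbit_refl andbT => /subsetPn[B OB].
  by rewrite inE => neBA; exists B.
have OJ K g : g \in G -> K \in Omega -> (K :^ g)%G \in Omega.
  move=> Gg /orbitJG_P[h Gh defK]; apply/orbitJG_P; exists (h * g); first exact: groupM.
  by rewrite /= defK conjsgM.
have sKG K : K \in Omega -> K \subset G.
  by move=> OK; have := subsetP sOG K OK; rewrite mem_cyc => /andP[].
(* If all conjugates of x normalised A, x would normalise every member of [Omega]. As x inverts a,
   the conjugates of B by a and by a^-1 would agree, so a^2 and hence a would normalise B. *)
have [g Gg nxg] : exists2 g, g \in G & x ^ g \notin 'N(A).
  apply/exists_inP; apply: contraT; rewrite negb_exists_in => /forall_inP nx.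
  have nOx K : K \in Omega -> x \in 'N(K).
    case/orbitJG_P=> g Gg ->; have := nx g^-1 (groupVr Gg); rewrite negbK.
    by rewrite normJ mem_conjg.
  case/eqP: neBA; apply: inverted_isolated; [exact: sKG | exact: oOm |].
  rewrite cycle_subG; have a3 : a ^+ 3 = 1 by rewrite -q3 -oa expg_order.
  have nB2 : a ^+ 2 \in 'N(B).
    have nBx := normP (nOx B OB); have nBax := normP (nOx _ (OJ B a Ga OB)).
    have : B :^ a^-1 = B :^ a.
      rewrite -{1}nBx -conjsgM -ax -conjgC conjsgM; exact: nBax.
    by move=> eqB; apply/normP; rewrite expgS expg1 conjsgM -eqB conjsgKV.
  have -> : a = a ^+ 2 ^+ 2 by rewrite -expgM (expgD a 3 1) a3 mul1g.
  exact: groupX.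
have [T sylT] := Sylow_exists 2 G; have [sTG pT _] := and3P sylT.
have orbT : orbit 'JG T A = Omega.
  apply/eqP; rewrite eqEcard imsetS //= k4 card_orbitJG.
  have eqG : #|G| = (4 * #|'N_G(A)|)%N.
    by rewrite -k4 /Omega card_orbitJG mulnC Lagrange // subsetIl.
  have sNN : 'N_T(A) \subset 'N_G(A) by rewrite setSI.
  rewrite -(leq_pmul2l (cardG_gt0 'N_T(A)%G)) Lagrange ?subsetIl //.
  rewrite (card_Hall sylT) eqG partnM ?cardG_gt0 // [(4`_2)%N]part_pnat_id //.
  rewrite mulnC leq_pmul2l // dvdn_leq ?part_gt0 //.
  have pN : 2.-group 'N_T(A) := pgroupS (subsetIl _ _) pT.
  by rewrite -(part_pnat_id pN) partn_dvd ?cardG_gt0 // cardSg.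
have actT : [acts T, on Omega | 'JG].
  by apply: subset_trans sTG _; apply: acts_orbit; apply: subsetT.
(* A transitive group has a fixed-point-free element: by Burnside's count the average number of
   fixed points is 1, while the identity has four. *)
have [z Tz fixz] : exists2 z, z \in T & #|'Fix_(Omega | 'JG)[z]| = 0.
  have [/existsP[z /andP[Tz /eqP fz]] | /existsPn nfix] :=
    boolP [exists z, (z \in T) && (#|'Fix_(Omega | 'JG)[z]| == 0)]; first by exists z.
  have := Frobenius_Cauchy actT.
  have -> : [set orbit 'JG T K | K in Omega] = [set Omega].
    apply/setP=> U; rewrite inE; apply/imsetP/eqP=> [[K OK ->] | ->].
      by rewrite -orbT; apply/orbit_eqP; rewrite orbT.
    by exists A; rewrite ?orbT // orbit_refl.
  rewrite cards1 mul1n (bigD1 1) //= => sumE.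
  have fix1 : #|'Fix_(Omega | 'JG)[1]| = 4.
    rewrite -k4; congr #|pred_of_set _|; apply/setIidPl/subsetP=> K _.
    by rewrite inE; apply/subsetP=> y /set1P->; rewrite inE act1.
  have : #|T| <= \sum_(i in T | i != 1) #|'Fix_(Omega | 'JG)[i]| + 1.
    rewrite (cardsD1 1) group1 addnC leq_add2r -sum1_card.
    rewrite [X in X <= _](eq_bigl (fun i => (i \in T) && (i != 1))) => [|i]; last first.
      by rewrite !inE andbC.
    apply: leq_sum => i /andP[Ti _]; rewrite lt0n.
    by have := nfix i; rewrite Ti.
  by rewrite -sumE fix1 addnC leq_add2l.
have nzK K : K \in Omega -> z \notin 'N(K).
  move=> OK; apply: contra_eqN fixz => nKz; rewrite -lt0n card_gt0.
  apply/set0Pn; exists K; rewrite !inE OK /=; apply/subsetP=> y /set1P->.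
  by rewrite inE; apply/eqP/val_inj; rewrite /= (normP nKz).
have OA : A \in Omega by apply: orbit_refl.
have nCN y : y \notin 'N(A) -> y \notin 'C(A).
  by apply: contra; apply: (subsetP (cent_sub A)).
have z2 : 2.-elt z := mem_p_elt pT Tz.
have Gz := subsetP sTG z Tz.
have nNA y b : b \in A -> (<[y]> :^ b \subset 'N(A)) = (y \in 'N(A)).
  move=> Ab; have nb : b \in 'N('N(A)) by rewrite (subsetP (normG _)) // (subsetP (normG A)).
  by rewrite -{1}(normP nb) conjSg cycle_subG.
have sO3 : orbit 'JG A <[x ^ g]>%G \subset cyc G.
  by rewrite orbitJG_cyc // cycle_cyc groupJ.
have sO4 : orbit 'JG A <[z]>%G \subset cyc G by rewrite orbitJG_cyc // cycle_cyc.
have xg2 : 2.-elt (x ^ g) by rewrite /p_elt orderJ.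
have oO3 : #|orbit 'JG A <[x ^ g]>%G| = q by rewrite orbit_2elt // nCN.
have oO4 : #|orbit 'JG A <[z]>%G| = q by rewrite orbit_2elt // nCN // nzK.
have oO3x : {in orbit 'JG A <[x ^ g]>%G, forall L : {group gT}, #|L| = #[x]}.
  by move=> L /orbitJG_card->; rewrite -(orderJ x g).
have oO4z : {in orbit 'JG A <[z]>%G, forall L : {group gT}, #|L| = #[z]}.
  by move=> L /orbitJG_card->.
suff: #|[set 1%G : {group gT}]| + #|Omega| + #|orbit 'JG A <[x]>%G|
   + #|orbit 'JG A <[x ^ g]>%G| + #|orbit 'JG A <[z]>%G| <= #|cyc G|.
  by rewrite cards1 oO1 oO3 oO4 k4 q3 c13.
apply: leq_card_disjoint5 => //.
- by apply: disj_card (set1_card _) oO3x _; rewrite ?cards1 // eq_sym neq_ox.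
- apply: disj_card (set1_card _) oO4z _; rewrite ?cards1 // eq_sym order_eq1.
  by apply: contraNneq (nzK A OA) => ->; apply: group1.
- by apply: disj_card oOm oO3x _; rewrite eq_sym neq_ox.
- by apply: disj_card oOm oO4z _; rewrite eq_sym oddCq.
- apply: (disjointP_pred (P := fun L : {group gT} => L \subset 'N(A))) => L /orbitJG_P[b Ab ->].
    by rewrite nNA.
  by rewrite nNA.
- apply: (disjointP_pred (P := fun L : {group gT} => L \subset 'N(A))) => L /orbitJG_P[b Ab ->].
    by rewrite nNA.
  by rewrite nNA // nzK.
apply: (disjointP_pred (P := fun L : {group gT} => [exists (K | K \in Omega), L \subset 'N(K)])).
  move=> L /orbitJG_P[b Ab ->]; have Gb := subsetP sAG b Ab.
  apply/exists_inP; exists ((A :^ g) :^ b)%G; first by rewrite !OJ.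
  by rewrite /= !normJ conjSg cycle_subG memJ_conjg.
move=> L /orbitJG_P[b Ab ->]; have Gb := subsetP sAG b Ab.
apply/exists_inP=> -[K OK]; rewrite -{1}(conjsgKV b K) normJ conjSg cycle_subG => nKz.
by have := nzK _ (OJ K _ (groupVr Gb) OK); rewrite nKz.
Qed.

(** |Omega| is 1 modulo q and at most 12 - q, which leaves 1, 4, 7 for q = 3 and 1, 6 for q = 5. *)
Lemma inverted_normal : q < 7 -> A <| G.
Proof.
move=> q_lt7; have := inverted_orbit_mod; have := inverted_orbit_le.
have [k1 _ _ | ] := eqVneq #|Omega| 1%N.
  rewrite /normal sAG; apply/subsetP=> g Gg; apply/normP.
  have /cards1P[B defO] : #|Omega| == 1%N by rewrite k1.
  have /set1P eqA : A \in [set B] by rewrite -defO orbit_refl.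
  have : (A :^ g)%G \in [set B].
    by rewrite -defO; apply/orbitJG_P; exists g.
  by move/set1P; rewrite -eqA => /(congr1 val).
have /orP[/eqP q3 | /eqP q5] : (q == 3) || (q == 5).
- by move: q_lt7 q_gt2 q_odd; case: (q) => [|[|[|[|[|[|[|q']]]]]]].
- have n4 := inverted_orbit_not4 q3; have n7 := inverted_orbit_not7 q3; rewrite q3.
  move=> h1 h2 h3; exfalso; move: n4 n7 h1 h2 h3; move: #|Omega| => k; clear; lia.
have n6 := inverted_orbit_not6 q5; rewrite q5.
move=> h1 h2 h3; exfalso; move: n6 h1 h2 h3; move: #|Omega| => k; clear; lia.
Qed.

Section Normal.

Hypothesis nAG : A <| G.

Let C := 'C_G(A)%G.
Let D := cyc G :\: cyc C.
Let sCG : C \subset G := subsetIl _ _.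
Let sAC : A \subset C.
Proof. by rewrite subsetI sAG; apply: cycle_abelian. Qed.
Let cCA : C \subset 'C(A) := subsetIr _ _.
Let nCG : G \subset 'N(C).
Proof. by rewrite normsI ?normG ?norms_cent // normal_norm. Qed.

Let card_CD : #|cyc C| + #|D| = 13.
Proof. by rewrite -c13 -(cardsID (cyc C) (cyc G)) (setIidPr (cycS sCG)). Qed.

Let dvD : q %| #|D|. Proof. exact: dvdn_outside. Qed.

Let sO1D : orbit 'JG A <[x]>%G \subset D. Proof. exact: orbit_outside. Qed.

Let uniqA (B : {group gT}) : B \subset C -> #|B| = q -> B = A.
Proof.
move=> sBC oB; apply: inverted_isolated; rewrite ?(subset_trans sBC) //.
by apply: cents_norm; rewrite centsC (subset_trans sBC).
Qed.

(** A prime other than q dividing |C| costs four cyclic subgroups. The last clause serves to play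
    them off against a Sylow q-subgroup of C larger than A. *)
Lemma card_cyc_C_gt3 r t : prime r -> r != q -> t \in C -> #[t] = r ->
  [/\ 3 < #|[set 1%G; A; <[t]>%G; (A <*> <[t]>)%G]|,
     [set 1%G; A; <[t]>%G; (A <*> <[t]>)%G] \subset cyc C
   & [forall L in [set 1%G; A; <[t]>%G; (A <*> <[t]>)%G], (q.-group L) ==> (L \subset A)]].
Proof.
move=> r_pr ne_rq Ct ot; pose R := <[t]>%G; have oR : #|R| = r by [].
have sRC : R \subset C by rewrite cycle_subG.
have cRA : A \subset 'C(R) by rewrite centsC (subset_trans sRC).
have [cAR oAR] := cent_join r_pr oR ne_rq oA sAG (subset_trans sRC sCG) cRA.
have r_gt1 := prime_gt1 r_pr; have q_gt1 := prime_gt1 q_pr.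
have n1A : 1%G != A by apply: contraTneq A_pr => <-; rewrite cards1.
have n1R : 1%G != R by apply: contraTneq r_pr => e; rewrite -oR -e cards1.
have nAR : A != R by apply: contraNneq ne_rq => e; rewrite -oR -e oA.
have gt (K : {group gT}) : #|K| < q * r -> K != (A <*> R)%G.
  by move=> lt; apply: contraTneq lt => ->; rewrite oAR ltnn.
have n1J : 1%G != (A <*> R)%G by apply: gt; rewrite cards1 (leq_trans q_gt1) // leq_pmulr // prime_gt0.
have nAJ : A != (A <*> R)%G by apply: gt; rewrite oA -{1}[q]muln1 ltn_pmul2l // prime_gt0.
have nRJ : R != (A <*> R)%G by apply: gt; rewrite oR -{1}[r]mul1n ltn_pmul2r // prime_gt0.
split.
- rewrite -!setUA !cardsU1 !inE !negb_or n1A n1R n1J nAR nAJ nRJ cards1 //.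
- rewrite !subUset !sub1set cyc1 !mem_cyc sAC cycle_cyclic sRC cycle_cyclic /=.
  by rewrite join_subG sAC sRC; move: cAR; rewrite mem_cyc => /andP[].
apply/forall_inP=> L; have qr (K : {group gT}) : r %| #|K| -> ~~ q.-group K.
  move=> dv; apply: contra ne_rq => /pgroupP/(_ r r_pr dv).
  by rewrite inE.
rewrite !inE -!orbA => /or4P[] /eqP->; apply/implyP=> //.
- by rewrite sub1G.
- by move=> qR; have := qr R; rewrite oR dvdnn qR => /(_ isT).
by move=> qJ; have := qr (A <*> R)%G; rewrite oAR dvdn_mull // qJ => /(_ isT).
Qed.

(** A is the only subgroup of order q in C, so a nontrivial normaliser would contain A, and A would
    centralise x. Hence <x> has |P| conjugates under P. *)
Let norm_trivial (P : {group gT}) : q.-group P -> P \subset C -> 'N_P(<[x]>) = 1.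
Proof.
move=> qP sPC; apply/eqP/idPn=> ntN.
have [_ dvN _] := pgroup_pdiv (pgroupS (subsetIl _ _) qP) ntN.
have [z Nz oz] := Cauchy q_pr dvN; have /setIP[Pz nxz] := Nz.
have eqA : <[z]>%G = A by apply: uniqA; rewrite // cycle_subG (subsetP sPC).
case/negP: ncx; apply: cent_2elt => //; rewrite -eqA cycle_subG //.
Qed.

Let orbitD (P : {group gT}) : P \subset C -> orbit 'JG P <[x]>%G \subset D.
Proof.
move=> sPC; have actP : [acts P, on D | 'JG].
  have sPG := subset_trans sPC sCG.
  by apply: acts_cycD; apply: subset_trans sPG _; rewrite ?normG.
by rewrite (acts_sub_orbit _ actP) (subsetP sO1D) // orbit_refl.
Qed.

Let good_D : #|D| = q -> metacyclic13 G.
Proof. exact: normal_prime_metacyclic13 actA nAG oA. Qed.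

Let D_gt0 : 0 < #|D|.
Proof. by rewrite (leq_trans _ (subset_leq_card sO1D)) // oO1 prime_gt0. Qed.

Let pgroupC_small : #|cyc C| <= 3 -> q.-group C.
Proof.
move=> le3; apply/pgroupP=> r r_pr dv; apply/idPn=> ne_rq.
have [t Ct ot] := Cauchy r_pr dv; rewrite inE /= in ne_rq.
have [gt3 s4 _] := card_cyc_C_gt3 r_pr ne_rq Ct ot.
by have := leq_trans gt3 (leq_trans (subset_leq_card s4) le3).
Qed.

(** |D| is 5 or 10. If it is 10, C has three cyclic subgroups and is a 5-group; its order is at most
    10, the orbit of <x> under C lying in D, but a group of order 5 has only two. *)
Lemma inverted5_metacyclic13 : q = 5 -> metacyclic13 G.
Proof.
move=> q5; case/dvdnP: (dvD) => m em; have c2 : 1 < #|cyc C|.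
  apply: leq_trans (subset_leq_card (cycS sAC)).
  by rewrite (@card_cyc_cyclic_pgroup _ A q 1) ?cycle_cyclic // oA expn1.
have [d5 | d5] := eqVneq #|D| q; first exact: good_D.
have d10 : #|D| = 10 by move: em d5 D_gt0 card_CD c2; rewrite q5; move: #|D| #|cyc C|; clear; lia.
have cC3 : #|cyc C| = 3 by move: card_CD; rewrite d10; move: #|cyc C|; clear; lia.
have qC : q.-group C by rewrite pgroupC_small ?cC3.
have := subset_leq_card (orbitD (subxx C)).
rewrite card_orbitJG norm_trivial // indexg1 d10 => le10.
have [[|[|j]] oC] := p_natP qC.
- by have := leq_cyc_card C; rewrite cC3 oC.
- have cyC : cyclic C by rewrite prime_cyclic // oC expn1.
  by have := card_cyc_cyclic_pgroup q_pr cyC oC; rewrite cC3.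
by move: le10; rewrite oC q5 !expnS; have := expn_gt0 5 j; clear; lia.
Qed.

(** C has index 2, so the members of D have |C| generators in all. A Sylow 3-subgroup S of C
    satisfies |S| <= |D| <= 11, hence |S| is 3 or 9. *)
Lemma inverted3_metacyclic13 : q = 3 -> metacyclic13 G.
Proof.
move=> q3; have nAG' := normal_norm nAG.
have indexC : #|G : C| = 2.
  have := index_cent_cyclic nAG' (cycle_cyclic a); rewrite -/A oA q3.
  move/(dvdn_leq (isT : 0 < 2)); have : 1 < #|G : C|.
    by rewrite indexg_gt1; apply: contra ncx => sGC; have /setIP[] := subsetP sGC x Gx.
  by rewrite -/C; move: #|G : C| => m; clear; lia.
have phiD : \sum_(L in D) totient #|L| = #|C|.
  by rewrite sum_totient_cycD // -(Lagrange sCG) indexC muln2 -addnn addnK.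
have leD : #|D| <= #|C|.
  rewrite -phiD -sum1_card; apply: leq_sum => L _.
  by rewrite totient_gt0 cardG_gt0.
case/dvdnP: (dvD) => m em; have c2 : 1 < #|cyc C|.
  apply: leq_trans (subset_leq_card (cycS sAC)).
  by rewrite (@card_cyc_cyclic_pgroup _ A q 1) ?cycle_cyclic // oA expn1.
have [d3 | d3] := eqVneq #|D| q; first exact: good_D.
have qA : q.-group A by rewrite /pgroup oA pnat_id.
have [S sylS sAS] := Sylow_superset sAC qA; have [sSC qS _] := and3P sylS.
have le11 : #|D| <= 11 by move: card_CD c2; move: #|D| #|cyc C|; clear; lia.
have := subset_leq_card (orbitD sSC); rewrite card_orbitJG norm_trivial // indexg1 => leSD.
(* If S = A, then C = A x K with |K| prime to 3, and C has an even number of cyclic subgroups, twice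
   that of K. So |D| = 9 and K has prime order r >= 5. *)
have [SA | neSA] := eqVneq S A.
  have hA : Hall C A by rewrite -SA (pHall_Hall sylS).
  have nAC : A <| C by apply: normalS nAG.
  have /splitsP[K /complP[tiAK defC]] := SchurZassenhaus_split hA nAC.
  have sKC : K \subset C by rewrite -defC mulG_subr.
  have defCd : A \x K = C by rewrite dprodE // (subset_trans sKC).
  have oC : #|C| = (3 * #|K|)%N by rewrite -(dprod_card defCd) oA q3.
  have q'K : q^'.-group K.
    have [_ _] := and3P sylS.
    by rewrite SA -divgS // -(dprod_card defCd) mulKn ?cardG_gt0.
  have cC : #|cyc C| = (2 * #|cyc K|)%N.
    rewrite (card_cyc_dprod defCd qA q'K).
    by rewrite (@card_cyc_cyclic_pgroup _ A q 1) ?cycle_cyclic // oA expn1.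
  have [d9 cK2] : #|D| = 9 /\ #|cyc K| = 2.
    move: em d3 D_gt0 card_CD le11; rewrite cC q3; move: #|D| #|cyc K|; clear; lia.
  have ntK : K :!=: 1.
    by apply: contra_eqN cK2 => /eqP K1; have := leq_cyc_card K; rewrite K1 cards1; case: #|_| => [|[|]].
  have r_pr : prime #|K|.
    have [r r_pr dvr] : exists2 r, prime r & r %| #|K|.
      by exists (pdiv #|K|); rewrite ?pdiv_dvd // pdiv_prime // cardG_gt1.
    have [t Kt ot] := Cauchy r_pr dvr.
    have -> : K :=: <[t]>.
      apply: cyc_sub_eq; rewrite ?cycle_subG // cK2.
      by rewrite (@card_cyc_cyclic_pgroup _ <[t]>%G r 1) ?cycle_cyclic // [LHS]ot expn1.
    by rewrite -orderE ot.
  have [r def_r] : exists r, r = #|K| by exists #|K|.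
  rewrite -def_r in oC r_pr.
  have ne_rq : r != q.
    by apply: contraL q'K => /eqP rq; rewrite /pgroup -def_r rq p'natE // dvdnn.
  have r_gt4 : 4 < r.
    move: leD ne_rq r_pr; rewrite d9 oC q3; case: (r) => [|[|[|[|[|]]]]] //.
  have oddC : odd #|C|.
    by rewrite oC oddM /=; case: (even_prime r_pr) r_gt4 => [->|].
  have Cx2 : x ^+ 2 \in C.
    rewrite inE groupX //= -sub_cent1 cycle_subG; apply/cent1P.
    by apply/commgP/conjg_fixP; rewrite conjgM ax conjVg ax invgK.
  have ox : #[x] = 2.
    have x21 : x ^+ 2 = 1.
      apply/eqP; rewrite -order_eq1 -dvdn1.
      have co : coprime #[x ^+ 2] #|C|.
        have /p_natP[j ->] := p_eltX 2 x2.
        by rewrite coprimeXl // coprime2n.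
      have := order_dvdG Cx2; rewrite -{1}[#|C|]mul1n Gauss_dvdl //.
    by apply: nt_prime_order => //; apply: contraNneq ncx => ->; apply: group1.
  (* |C : N| <= 9 < 3r makes N nontrivial, and 3 does not divide |N|, so some w of order r commutes
     with x. The orbits of <x> and <x w> use up all 3 + 3(r - 1) = |C| generators, leaving none for
     the other three members of D. *)
  have := subset_leq_card (orbitD (subxx C)); rewrite card_orbitJG d9.
  set N := 'N_C(<[x]>) => leN; have sNC : N \subset C := subsetIl _ _.
  have ntN : #|N| != 1%N.
    apply: contraTneq leN => N1; rewrite -divgS // N1 divn1 oC.
    by rewrite -ltnNge; move: r_gt4; clear; lia.
  have dvN : #|N| %| 3 * r by rewrite -oC cardSg.
  have n3N : ~~ (q %| #|N|).
    apply/negP=> dv; have [z Nz oz] := Cauchy q_pr dv; have /setIP[Cz nxz] := Nz.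
    have eqA : <[z]>%G = A by apply: uniqA; rewrite // cycle_subG.
    by case/negP: ncx; apply: cent_2elt => //; rewrite -eqA cycle_subG.
  have rN : r %| #|N|.
    rewrite Gauss_dvdr // in dvN.
      by rewrite (prime_nt_dvdP r_pr ntN dvN).
    by rewrite coprime_sym prime_coprime // -q3.
  have [w Nw ow] := Cauchy r_pr rN; have /setIP[Cw nxw] := Nw.
  have cxw : commute x w.
    have : x \in 'C(<[w]>).
      apply: (@cent_2elt _ <[w]>%G) => //=; last by rewrite cycle_subG.
      by rewrite -orderE ow; case: (even_prime r_pr) r_gt4 => [->|].
    by move/centP; apply; apply: cycle_id.
  have oy : #[x * w] = (2 * r)%N.
    by rewrite orderM // ox ow // coprime2n; case: (even_prime r_pr) r_gt4 => [->|].
  have Gw := subsetP sCG w Cw.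
  have ncy : x * w \notin 'C(A) by rewrite groupMr // (subsetP cCA).
  have Gy : x * w \in G by rewrite groupM.
  have nAy : x * w \in 'N(A) := subsetP nAG' _ Gy.
  have oO2 : #|orbit 'JG A <[x * w]>%G| = q by apply: orbit_prime_cycle.
  have sO2 : orbit 'JG A <[x * w]>%G \subset D by apply: orbit_outside.
  have oO2y : {in orbit 'JG A <[x * w]>%G, forall L : {group gT}, #|L| = (2 * r)%N}.
    by move=> L /orbitJG_card->.
  have d12 : [disjoint orbit 'JG A <[x]>%G & orbit 'JG A <[x * w]>%G].
    by apply: disj_card oO1x oO2y _; rewrite ox -{1}[2]muln1 eqn_pmul2l // neq_ltn prime_gt1.
  move: phiD; rewrite (big_setID (orbit 'JG A <[x]>%G :|: orbit 'JG A <[x * w]>%G)) /=.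
  rewrite (setIidPr _) ?subUset ?sO1D //.
  rewrite (big_setID (orbit 'JG A <[x]>%G)) /= setUK setDUl setDv set0U.
  have d21 : [disjoint orbit 'JG A <[x * w]>%G & orbit 'JG A <[x]>%G].
    by rewrite disjoint_sym.
  rewrite (setDidPl d21).
  rewrite (eq_bigr (fun=> 1%N)) => [|L /oO1x->]; last by rewrite ox.
  rewrite [X in _ + X + _](eq_bigr (fun=> r.-1)) => [|L /oO2y->]; last first.
    have odd_r : odd r by case: (even_prime r_pr) r_gt4 => [->|].
    by rewrite totient_coprime ?coprime2n // (totient_prime r_pr) mul1n.
  rewrite !sum_nat_const oO1 oO2 q3 oC.
  have oU : #|orbit 'JG A <[x]>%G :|: orbit 'JG A <[x * w]>%G| = 6.
    by rewrite (eqP (etrans (leq_card_setU _ _).2 d12)) oO1 oO2 q3.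
  have : 0 < #|D :\: (orbit 'JG A <[x]>%G :|: orbit 'JG A <[x * w]>%G)|.
    by rewrite cardsD (setIidPr _) ?subUset ?sO1D // d9 oU.
  case/card_gt0P=> L DL; rewrite (bigD1 L) //=.
  have : 0 < totient #|L| by rewrite totient_gt0 cardG_gt0.
  by move: (totient _) (\sum_(_ in _ | _) _); clear -r_gt4; lia.
(* Now |D| = 9 and C has four cyclic subgroups. Another prime dividing |C| would put all those of
   3-power order inside A, against S; so |C| = 9, and two cyclic subgroups of order 9 need 12
   generators among 6 elements. *)
have oS9 : #|S| = 9.
  have prSA : A \proper S by rewrite properEneq eq_sym -val_eqE /= in neSA *; rewrite neSA.
  have [j oS] := p_natP qS; move: (proper_card prSA) leSD le11; rewrite oS oA q3.
  case: j {oS} => [|[|[|j]]] //; rewrite !expnS; have := expn_gt0 3 j.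
  by move: #|D|; clear; lia.
have d9 : #|D| = 9.
  by move: em leSD le11; rewrite oS9 q3; move: #|D|; clear; lia.
have cC4 : #|cyc C| = 4 by move: card_CD; rewrite d9; move: #|cyc C|; clear; lia.
have qC : q.-group C.
  apply/pgroupP=> r r_pr dv; apply/idPn=> ne_rq.
  have [t Ct ot] := Cauchy r_pr dv; rewrite inE /= in ne_rq.
  have [gt3 s4 /forall_inP q4] := card_cyc_C_gt3 r_pr ne_rq Ct ot.
  have /eqP eq4 : [set 1%G; A; <[t]>%G; (A <*> <[t]>)%G] == cyc C by rewrite eqEcard s4 cC4.
  have /subsetPn[s Ss nAs] : ~~ (S \subset A).
    by apply: contra neSA => sSA; rewrite -val_eqE /= eqEsubset sSA.
  have /q4 : <[s]>%G \in [set 1%G; A; <[t]>%G; (A <*> <[t]>)%G].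
    by rewrite eq4 cycle_cyc (subsetP sSC).
  by rewrite (pgroupS _ qS) ?cycle_subG //= (negPf nAs).
have oC : #|C| = 9.
  by rewrite -oS9 (card_Hall sylS) part_pnat_id.
have sum6 := sum_totient_cycD sAC.
have D2 : #|cyc C :\: cyc A| = 2.
  rewrite cardsD (setIidPr (cycS sAC)) cC4.
  by rewrite (@card_cyc_cyclic_pgroup _ A q 1) ?cycle_cyclic // oA expn1.
move: sum6; rewrite oC oA q3 (eq_bigr (fun=> 6)) ?sum_nat_const ?D2 // => L.
rewrite in_setD mem_cyc => /andP[nAL cL]; move: (cL); rewrite mem_cyc => /andP[sLC cyL].
have [j oL] := p_natP (pgroupS sLC qC).
have : #|L| %| 9 by rewrite -oC cardSg.
rewrite oL q3; case: j oL => [|[|[|j]]] oL //.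
- by case/negP: nAL; have := card1_trivg oL => ->; rewrite sub1G cyclic1.
- have eqA : L = A by apply: uniqA; rewrite // oL expn1.
  by case/negP: nAL; rewrite eqA subxx cycle_cyclic.
by rewrite !expnS; move/(dvdn_leq (isT : 0 < 9)); have := expn_gt0 3 j; clear; lia.
Qed.

Lemma inverted_metacyclic13 : q < 7 -> metacyclic13 G.
Proof.
move=> q_lt7; have /orP[/eqP|/eqP] : (q == 3) || (q == 5).
- by move: q_lt7 q_gt2 q_odd; case: (q) => [|[|[|[|[|[|[|q']]]]]]].
- exact: inverted3_metacyclic13.
exact: inverted5_metacyclic13.
Qed.

End Normal.

End Inverted.

Lemma even_action_metacyclic13 (gT : finGroupType) (G : {group gT}) q x Q :
  #|cyc G| = 13 -> noncentral_action G 2 q x Q -> metacyclic13 G.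
Proof.
move=> c13 act; have [[_ q_pr] ne_2q _ _ _] := act.
have [q_gt6 | q_lt7] := ltnP 6 q; first exact: large_prime_metacyclic13 act q_gt6.
have q_odd : odd q by case: (even_prime q_pr) ne_2q => [->|].
have [a [y [Ga oa Gy y2 ay]]] := noncentral_action_inverted act.
have nAG := inverted_normal c13 q_pr q_odd Ga oa Gy y2 ay q_lt7.
exact: inverted_metacyclic13 c13 q_pr q_odd Ga oa Gy y2 ay nAG q_lt7.
Qed.

(** * Elements of odd order acting on a 2-group *)

(** Numerical data from which [sl23_quaternion] recovers generators of SL(2, 3), with Q as its
    quaternion subgroup. *)
Definition sl23_struct (gT : finGroupType) (G : {group gT}) :=
  exists x, exists Q : {group gT}, [/\ #|G| = 24, Q \subset G /\ x \in G,
    #|Q| = 8 /\ #[x] = 3, #|cyc Q| = 5 & x \in 'N(Q) /\ #|'C_Q[x]| = 2].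

Section OddAction.

Variables (gT : finGroupType) (G : {group gT}) (p : nat) (x : gT) (Q : {group gT}).
Hypotheses (c13 : #|cyc G| = 13) (p_odd : odd p) (act : noncentral_action G p 2 x Q).

Let C := 'C_Q[x]%G.
Let p_pr : prime p. Proof. by case: act => [[]]. Qed.
Let Gx : x \in G. Proof. by case: act => _ _ []. Qed.
Let px : p.-elt x. Proof. by case: act => _ _ []. Qed.
Let sQG : Q \subset G. Proof. by case: act => _ _ _ []. Qed.
Let pQ : 2.-group Q. Proof. by case: act => _ _ _ []. Qed.
Let nQx : x \in 'N(Q). Proof. by case: act => _ _ _ _ /andP[]. Qed.
Let ncx : x \notin 'C(Q). Proof. by case: act => _ _ _ _ /andP[]. Qed.
Let sCQ : C \subset Q := subsetIl _ _.

Let odd_x : odd #[x].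
Proof. by have /p_natP[n ->] := px; rewrite oddX p_odd orbT. Qed.
Let nt_x : x != 1. Proof. by apply: contraNneq ncx => ->; apply: group1. Qed.

Lemma cycle2_norm_cent (L : {group gT}) : 2.-group L -> cyclic L ->
  x \in 'N(L) -> L \subset 'C[x].
Proof.
move=> pL cL nLx; rewrite -cent_cycle centsC.
apply: coprime_totient_cent; rewrite ?cycle_subG //.
have /p_natP[[|n] ->] := pL; first by rewrite coprimen1.
by rewrite totient_pfactor //= mul1n coprimeXr // coprimen2 -orderE.
Qed.

(** If x normalises a cyclic 2-group it centralises it, so <x> fixes no cyclic subgroup of Q outside
    C. *)
Lemma dvdn_cycD_cent : p %| #|cyc Q :\: cyc C|.
Proof.
have actx : [acts <[x]>, on cyc Q :\: cyc C | 'JG].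
  apply: acts_cycD; first by rewrite cycle_subG.
  by rewrite /= -cent_cycle normsI ?norms_cent ?normG // cycle_subG.
have px' : p.-group <[x]> by [].
rewrite /dvdn (pgroup_fix_mod px' actx) eq_card0 ?mod0n // => L.
apply/negP; rewrite in_setI in_setD !mem_cyc => /andP[/andP[nCL /andP[sLQ cL]] fixL].
rewrite cL andbT subsetI sLQ cycle2_norm_cent ?(pgroupS sLQ) // in nCL.
have /afixP/(_ x (cycle_id x))/(congr1 val) /= nLx := fixL.
by rewrite inE nLx.
Qed.

Lemma cycD_cent_ge : p <= #|cyc Q :\: cyc C|.
Proof.
rewrite dvdn_leq ?dvdn_cycD_cent // card_gt0; apply/set0Pn.
have [u Qu ncu] : exists2 u, u \in Q & u \notin C.
  apply/subsetPn; apply: contra ncx => sQC.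
  by rewrite -sub_cent1 (subset_trans sQC) // subsetIr.
by exists <[u]>%G; rewrite in_setD !cycle_cyc Qu ncu.
Qed.

Lemma card_cyc_cent_le : #|cyc C| + p <= #|cyc Q|.
Proof.
rewrite -(cardsID (cyc C) (cyc Q)) (setIidPr (cycS sCQ)) leq_add2l.
exact: cycD_cent_ge.
Qed.

Let k := #|Q : C|.
Let oO1 : #|orbit 'JG Q <[x]>%G| = k.
Proof. by have [] := noncentral_action_index act. Qed.
Let oddO1 : {in orbit 'JG Q <[x]>%G, forall L : {group gT}, odd #|L|}.
Proof. by move=> L /orbitJG_card->. Qed.
Let sO1 : orbit 'JG Q <[x]>%G \subset cyc G.
Proof. by rewrite orbitJG_cyc // cycle_cyc. Qed.

Lemma disjoint_cyc_orbit : [disjoint cyc Q & orbit 'JG Q <[x]>%G].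
Proof.
apply: (disjointP_pred (P := fun L : {group gT} => 2.-group L)) => L.
  by rewrite mem_cyc => /andP[sLQ _]; apply: pgroupS sLQ pQ.
move=> OL; apply: contra nt_x => pL; rewrite -order_eq1 orderE -(orbitJG_card OL).
by have := oddO1 OL; have /p_natP[[|n] ->] := pL; rewrite ?oddX.
Qed.

(** k is a power of 2, congruent to 1 modulo p and at most 11: 4 with p = 3, or 8 with p = 7. In the
    latter case Q has at least 1 + 7 cyclic subgroups, and the total is at least 16. *)
Lemma odd_action_p3 : p = 3 /\ k = 4.
Proof.
have le11 := noncentral_action_index_le c13 act.
have [_ gt1 modp pk] := noncentral_action_index act.
have le : #|cyc Q| + k <= 13.
  rewrite -oO1 -c13 -(eqP (etrans (leq_card_setU _ _).2 disjoint_cyc_orbit)).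
  by rewrite subset_leq_card // subUset cycS.
have c1 : 0 < #|cyc C| by apply/card_gt0P; exists 1%G; apply: cyc1.
have cc := card_cyc_cent_le.
have dvk : p %| k - 1 by rewrite -eqn_mod_dvd ?(ltnW gt1) //; apply/eqP.
have /p_natP[n ek] := pk; rewrite -/k in le11 gt1 ek.
move: dvk le11 gt1 le; rewrite ek; case: n {ek modp pk} => [|[|[|[|n]]]] //.
- by rewrite dvdn1 => /eqP p1; move: p_pr; rewrite p1.
- by rewrite dvdn_prime2 // => /eqP->.
- by rewrite (dvdn_prime2 p_pr (isT : prime 7)) => /eqP p7 _ _; move: cc c1; rewrite p7; clear; lia.
by rewrite !expnS; have := expn_gt0 2 n; clear; lia.
Qed.

(** With z an involution in C, Q has at least 2 + 3 cyclic subgroups and the orbits of <x> and <x z>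
    at least 4 members each: 5 + 4 + 4 = 13 leaves no slack. So x^3 generates nothing new, x has
    order 3, and totients give |G| = 8 + 8 + 8. *)
Lemma odd_action_sl23 : C != 1%G -> sl23_struct G.
Proof.
move=> ntC; have [p3 k4] := odd_action_p3; have pC := pgroupS sCQ pQ.
have [_ dvC _] := pgroup_pdiv pC ntC; have [z Cz oz] := Cauchy (isT : prime 2) dvC.
have /setIP[Qz /cent1P czx] := Cz; have Gz := subsetP sQG z Qz.
have cxz := commute_sym czx; pose y := x * z.
have co : coprime #[x] #[z] by rewrite oz coprimen2.
have oy : #[y] = (#[x] * 2)%N by rewrite orderM // oz.
have Gy : y \in G by rewrite groupM.
have sO2 : orbit 'JG Q <[y]>%G \subset cyc G by rewrite orbitJG_cyc // cycle_cyc.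
have sxy : <[x]> \subset <[y]>.
  (* The exponent is 1 modulo the order of x and 0 modulo that of z, so it extracts x from y. *)
  rewrite cycle_subG; have xe : x = y ^+ (chinese #[x] #[z] 1 0).
    rewrite expgMn // -(expg_mod_order x) chinese_modl // -(expg_mod_order z) chinese_modr //.
    by rewrite !expg_mod_order expg0 mulg1 expg1.
  by rewrite xe mem_cycle.
have sNC : 'N_Q(<[y]>) \subset C.
  have coQx : coprime #|Q| #[x].
    by have /p_natP[n ->] := pQ; rewrite coprimeXl // coprime2n.
  rewrite /C /= -(coprime_norm_cycle nQx coQx); apply/subsetP=> u /setIP[Qu nyu].
  rewrite inE Qu; apply/normP/eqP.
  rewrite (eq_subG_cyclic (cycle_cyclic y)) ?cardJg //.
  by rewrite /= -(normP nyu) conjSg.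
have ge4 : 4 <= #|orbit 'JG Q <[y]>%G|.
  by rewrite card_orbitJG -k4 dvdn_leq // indexgS.
have oO2 : {in orbit 'JG Q <[y]>%G, forall L : {group gT}, #|L| = (#[x] * 2)%N}.
  by move=> L /orbitJG_card->.
have d12 : [disjoint orbit 'JG Q <[x]>%G & orbit 'JG Q <[y]>%G].
  apply: (disjointP_pred (P := fun L : {group gT} => odd #|L|)) => L; first exact: oddO1.
  by move/oO2->; rewrite oddM andbF.
have dQ2 : [disjoint cyc Q & orbit 'JG Q <[y]>%G].
  apply: (disjointP_pred (P := fun L : {group gT} => 2.-group L)) => L.
    by rewrite mem_cyc => /andP[sLQ _]; apply: pgroupS sLQ pQ.
  move/oO2; rewrite /pgroup => ->; rewrite pnatM // andbT.
  apply: contra nt_x => pL; rewrite -order_eq1; move: odd_x.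
  by have /p_natP[[|n] ->] := pL; rewrite ?oddX.
have sum := leq_card_disjoint3 (cycS sQG) sO1 sO2 disjoint_cyc_orbit dQ2 d12.
have cc := card_cyc_cent_le; rewrite p3 in cc; rewrite oO1 k4 c13 in sum.
have c2 : 1 < #|cyc C|.
  have sZC : <[z]>%G \subset C by rewrite cycle_subG.
  apply: leq_trans (subset_leq_card (cycS sZC)).
  by rewrite (@card_cyc_cyclic_pgroup _ <[z]>%G 2 1) ?cycle_cyclic.
have [cQ5 o2] : #|cyc Q| = 5 /\ #|orbit 'JG Q <[y]>%G| = 4.
  by move: sum cc c2 ge4; move: #|orbit _ _ _| #|cyc Q| #|cyc C|; clear; lia.
have cC2 : #|cyc C| = 2 by move: cc c2; rewrite cQ5; move: #|cyc C|; clear; lia.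
have oC : #|C| = 2.
  have -> : C :=: <[z]>.
    apply: cyc_sub_eq; rewrite ?cycle_subG // cC2.
    by rewrite (@card_cyc_cyclic_pgroup _ <[z]>%G 2 1) ?cycle_cyclic.
  by rewrite -orderE oz.
have oQ : #|Q| = 8 by rewrite -(Lagrange sCQ) oC -/k k4.
have eqG : cyc G = cyc Q :|: (orbit 'JG Q <[x]>%G :|: orbit 'JG Q <[y]>%G).
  apply/esym/eqP; rewrite eqEcard !subUset (cycS sQG) sO1 sO2 c13 /=.
  rewrite (eqP (etrans (leq_card_setU _ _).2 _)).
    by rewrite (eqP (etrans (leq_card_setU _ _).2 d12)) cQ5 oO1 k4 o2.
  rewrite disjoints_subset setCU subsetI -!disjoints_subset.
  by rewrite disjoint_cyc_orbit dQ2.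
have ox : #[x] = 3.
  apply: nt_prime_order => //; apply/eqP/idPn=> nt3.
  have odd3 : odd #[x ^+ 3].
    by have /p_natP[n ->] := p_eltX 3 px; rewrite oddX p_odd orbT.
  have : <[x ^+ 3]>%G \in cyc G by rewrite cycle_cyc groupX.
  have p3_x : 3 %| #[x].
    have /p_natP[[|n] ox] := px; last by rewrite ox p3 expnS dvdn_mulr.
    by have := nt_x; rewrite -order_eq1 ox.
  rewrite eqG !in_setU cycle_cyc => /or3P[Qx3 | /orbitJG_card | /oO2].
  - have := mem_p_elt pQ Qx3; rewrite /p_elt => /p_natP[[|n] e2].
      by move: nt3; rewrite -order_eq1 e2.
    by move: odd3; rewrite e2 oddX.
  - rewrite -!orderE orderXdiv // => /eqP; rewrite -{2}(divnK p3_x).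
    rewrite -{1}[(_ %/ 3)%N]muln1 eqn_pmul2l // divn_gt0 // dvdn_leq //.
  by rewrite -orderE => e2; move: odd3; rewrite e2 oddM andbF.
have oG : #|G| = 24.
  rewrite -sum_totient_cyc_group eqG.
  rewrite (big_setID (cyc Q)) /= setUK setDUl setDv set0U.
  rewrite sum_totient_cyc_group oQ (setDidPl _); last first.
    by rewrite disjoint_sym disjoints_subset setCU subsetI -!disjoints_subset disjoint_cyc_orbit dQ2.
  rewrite (big_setID (orbit 'JG Q <[x]>%G)) /= setUK setDUl setDv set0U.
  rewrite (setDidPl _); last by rewrite disjoint_sym.
  rewrite (eq_bigr (fun=> 2%N)) => [|L /orbitJG_card->]; last by rewrite -orderE ox.
  rewrite [X in _ + (_ + X)](eq_bigr (fun=> 2%N)) => [|L /oO2->]; last by rewrite ox.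
  by rewrite !sum_nat_const oO1 o2 k4.
by exists x, Q; split.
Qed.

End OddAction.

(** * A Klein four-group acted on by a 3-element *)

Section KleinFour.

Variables (gT : finGroupType) (G : {group gT}) (x : gT) (V : {group gT}).
Hypotheses (c13 : #|cyc G| = 13) (act : noncentral_action G 3 2 x V).
Hypothesis oV : #|V| = 4.

Let Gx : x \in G. Proof. by case: act => _ _ []. Qed.
Let px : 3.-elt x. Proof. by case: act => _ _ []. Qed.
Let sVG : V \subset G. Proof. by case: act => _ _ _ []. Qed.
Let pV : 2.-group V. Proof. by case: act => _ _ _ []. Qed.
Let nVx : x \in 'N(V). Proof. by case: act => _ _ _ _ /andP[]. Qed.
Let ncx : x \notin 'C(V). Proof. by case: act => _ _ _ _ /andP[]. Qed.

Let ncV : ~~ cyclic V.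
Proof.
apply: contra ncx => cV; rewrite -sub_cent1.
by apply: (cycle2_norm_cent _ act).
Qed.

Let E2V : V \in 'E_2^2(V).
Proof.
have cVV : abelian V by rewrite (p2group_abelian pV) // oV.
rewrite pnElemE // !inE subxx oV andbT /=; apply/abelemP=> //; split=> // y Vy.
have dv : #[y] %| 4 by rewrite -oV order_dvdG.
apply/eqP; rewrite -order_dvdn.
have ny4 : #[y] != 4.
  apply: contra ncV => /eqP oy; apply/cyclicP; exists y.
  by apply/esym/eqP; rewrite eqEcard cycle_subG Vy oV -orderE oy.
by have := dvdn_leq (isT : 0 < 4) dv; case: #[y] dv ny4 => [|[|[|[|[|]]]]].
Qed.

(** Take U between V and T with |U| = 8. If x normalises U, then |U : C_U(x)| = 4, so C_U(x) is
    nontrivial and [odd_action_sl23] applies. Otherwise U, U^x and U^(x^2) meet pairwise in V, each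
    has at least two cyclic subgroups outside V, and 4 + 2 + 2 + 2 + 4 = 14. *)
Lemma klein_four_Sylow (T : {group gT}) : 2.-Sylow(G) T -> V \proper T -> sl23_struct G.
Proof.
move=> sylT prV; have [sTG pT _] := and3P sylT.
have prN := nilpotent_proper_norm (pgroup_nil pT) prV.
have ntN : 'N_T(V) / V != 1.
  by rewrite -subG1 quotient_sub1 ?subsetIr // proper_subn.
have pN : 2.-group ('N_T(V) / V) := quotient_pgroup _ (pgroupS (subsetIl _ _) pT).
have [_ dvN _] := pgroup_pdiv pN ntN; have [c Nc oc] := Cauchy (isT : prime 2) dvN.
pose U := (coset V @*^-1 <[c]>)%G.
have oU : #|U| = 8 by rewrite card_cosetpre oV -orderE oc.
have sVU : V \subset U := sub_cosetpre _.
have sUT : U \subset T.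
  have sUN : U \subset 'N_T(V).
    rewrite -(quotientSGK (subsetIl _ _)); last by rewrite subsetI proper_sub // normG.
    by rewrite /= cosetpreK cycle_subG.
  exact: subset_trans sUN (subsetIl _ _).
have sUG := subset_trans sUT sTG; have pU := pgroupS sUT pT.
have ncU : ~~ cyclic U by apply: contra ncV; apply: cyclicS.
have [nUx | nUx] := boolP (x \in 'N(U)).
  have actU : noncentral_action G 3 2 x U.
    split=> //; rewrite nUx; apply: contra ncx; exact: (subsetP (centS sVU)).
  apply: (odd_action_sl23 c13 _ actU) => //.
  have [_ k4] := odd_action_p3 c13 (isT : odd 3) actU.
  apply: contra_eqN k4 => /eqP C1; rewrite [X in #|_ : X|](congr1 val C1) indexg1.
  by rewrite oU.
have nUx2 : x ^+ 2 \notin 'N(U).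
  apply: contra nUx => nUx2; have -> : x = (x ^+ 2) ^+ (#[x].+1)./2; last exact: groupX.
  have odd_x : odd #[x] by have /p_natP[n ->] := px; rewrite oddX orbT.
  rewrite -expgM mul2n halfK /= odd_x subn0 expgS expg_order mulg1 //.
pose S y := cyc (U :^ y)%G :\: cyc V.
have sVUy y : y \in 'N(V) -> V \subset U :^ y by move=> nVy; rewrite -(normP nVy) conjSg.
have S2 y : y \in 'N(V) -> 2 <= #|S y|.
  move=> nVy; have := sum_totient_cycD (sVUy y nVy); rewrite cardJg oU oV => sum4.
  rewrite -(leq_pmul2r (isT : 0 < 2)) -[(2 * 2)%N]/(8 - 4)%N -sum4 -sum_nat_const.
  apply: leq_sum => L; rewrite in_setD !mem_cyc => /andP[_ /andP[sLU cL]].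
  have dvL : #|L| %| 8 by rewrite -oU -(cardJg U y) cardSg.
  have n8 : #|L| != 8.
    apply: contra ncU => /eqP oL; rewrite -(cyclicJ U y).
    suff <- : L :=: U :^ y by [].
    by apply/eqP; rewrite eqEcard sLU cardJg oU oL.
  by have := dvdn_leq (isT : 0 < 8) dvL; case: #|L| dvL n8 => [|[|[|[|[|[|[|[|[|]]]]]]]]].
have disS y1 y2 : y1 \in 'N(V) -> y2 \in 'N(V) -> U :^ y1 != U :^ y2 -> [disjoint S y1 & S y2].
  move=> nVy1 nVy2 ne; apply/pred0P=> L /=; apply/negP.
  rewrite !in_setD !mem_cyc => /andP[/andP[nLV /andP[sL1 cL]] /andP[_ /andP[sL2 _]]].
  case/negP: nLV; rewrite cL andbT.
  suff <- : (U :^ y1) :&: (U :^ y2) = V by rewrite subsetI sL1.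
  apply/esym/eqP; rewrite eqEcard subsetI !sVUy //= oV.
  have : #|U :^ y1 :&: U :^ y2| %| 8 by rewrite -oU -(cardJg U y1) cardSg ?subsetIl.
  have : #|U :^ y1 :&: U :^ y2| != 8.
    apply: contra ne => /eqP o8; rewrite eqEcard !cardJg leqnn andbT.
    have sI := subsetIl (U :^ y1) (U :^ y2).
    suff <- : U :^ y1 :&: U :^ y2 = U :^ y1 by apply: subsetIr.
    by apply/eqP; rewrite eqEcard sI o8 cardJg oU.
  move=> n8 dv8; have := dvdn_leq (isT : 0 < 8) dv8.
  by case: #|_| dv8 n8 => [|[|[|[|[|[|[|[|[|]]]]]]]]].
have nV1 : 1 \in 'N(V) := group1 _.
have nV2 : x ^+ 2 \in 'N(V) by rewrite groupX.
have ne01 : U :^ 1 != U :^ x by apply: contra nUx; rewrite conjsg1 eq_sym => /eqP/normP.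
have ne02 : U :^ 1 != U :^ (x ^+ 2).
  by apply: contra nUx2; rewrite conjsg1 eq_sym => /eqP/normP.
have ne12 : U :^ x != U :^ (x ^+ 2).
  by apply: contra ne01; rewrite expgS expg1 conjsgM (can_eq (conjsgK x)) conjsg1.
have sS y : y \in G -> S y \subset cyc G.
  move=> Gy; apply: subset_trans (subsetDl _ _) (cycS _).
  by rewrite -(conjGid Gy) conjSg.
have pS y L : L \in S y -> 2.-group L.
  by rewrite in_setD !mem_cyc => /andP[_ /andP[sLU _]]; apply: pgroupS sLU _; rewrite pgroupJ.
have [oO1 _ _ _] := noncentral_action_index act.
have [_ k4] := odd_action_p3 c13 (isT : odd 3) act.
rewrite [#|_ : _|]k4 in oO1.
have sO1 : orbit 'JG V <[x]>%G \subset cyc G by rewrite orbitJG_cyc // cycle_cyc.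
have ntx : #[x] != 1%N by rewrite order_eq1; apply: contraNneq ncx => ->; apply: group1.
have dOS y : [disjoint S y & orbit 'JG V <[x]>%G].
  apply: (disjointP_pred (P := fun L : {group gT} => 2.-group L)) => L; first exact: pS.
  move/orbitJG_card=> oL; apply: contra ntx; rewrite /pgroup oL => /p_natP[[|m] e2].
    by rewrite orderE e2.
  by have /p_natP[n e3] := px; move: (congr1 odd e2); rewrite -orderE e3 !oddX orbT.
have dVS y : [disjoint cyc V & S y].
  by rewrite disjoints_subset; apply/subsetP=> L cL; rewrite inE in_setD cL.
have dVO := disjoint_cyc_orbit (isT : odd 3) act.
have := leq_card_disjoint5 (cycS sVG) (sS 1 (group1 G)) (sS x Gx) (sS (x ^+ 2) (groupX 2 Gx)) sO1
  (dVS 1) (dVS x) (dVS (x ^+ 2)) dVO (disS _ _ nV1 nVx ne01) (disS _ _ nV1 nV2 ne02) (dOS 1)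
  (disS _ _ nVx nV2 ne12) (dOS x) (dOS (x ^+ 2)).
rewrite c13 oO1 (card_cyc_p2Elem (isT : prime 2) E2V).
have := S2 _ nV1; have := S2 _ nVx; have := S2 _ nV2.
by move: #|S 1| #|S x| #|S (x ^+ 2)|; clear; lia.
Qed.

(** The cyclic subgroups fixed by V are the products D M with D in V and M of odd order centralised
    by V, as the Sylow hypothesis puts the 2-part inside V. Their number is a multiple of 4, yet
    congruent to 13 modulo 2. *)
Lemma klein_four_parity : 2.-Sylow(G) V ->
    {in cyc G, forall L : {group gT}, odd #|L| -> V \subset 'N(L) -> L \subset 'C(V)} ->
  False.
Proof.
move=> sylV centL; have [_ abV _] := pnElemP E2V.
have cVV := abelem_abelian abV.
have actV : [acts V, on cyc G | 'JG] by apply: acts_cyc (subset_trans sVG (normG G)).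
pose S := [set L : {group gT} in cyc G | odd #|L| && (L \subset 'C(V))].
have inS (L : {group gT}) : (L \in S) = [&& L \in cyc G, odd #|L| & L \subset 'C(V)].
  exact: in_set.
have oddP (L : {group gT}) : odd #|L| -> 2^'.-group L.
  by move=> oddL; rewrite /pgroup p'natE // dvdn2 oddL.
have fixE : 'Fix_(cyc G | 'JG)(V) = [set (u.1 <*> u.2)%G | u : {group gT} * {group gT} in
    setX (cyc V) S].
  apply/setP=> L; rewrite in_setI; apply/andP/imsetP=> [[cL fixL] | [[D M]]].
    have nLV : V \subset 'N(L).
      apply/subsetP=> v Vv; have /afixP/(_ v Vv)/(congr1 val) /= nLv := fixL.
      by rewrite inE nLv.
    have := cL; rewrite mem_cyc => /andP[sLG cyL].
    exists ('O_2(L)%G, 'O_2^'(L)%G); last by apply: val_inj; rewrite /= pcore_join_cyclic.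
    have sOL pi : 'O_pi(L) \subset G := subset_trans (pcore_sub _ _) sLG.
    have nOV pi : V \subset 'N('O_pi(L)) := char_norm_trans (pcore_char _ _) nLV.
    have cO pi : cyclic 'O_pi(L) := cyclicS (pcore_sub _ _) cyL.
    have oddO : odd #|'O_2^'(L)|.
      by have := pcore_pgroup 2^' L; rewrite /pgroup p'natE // dvdn2 negbK.
    apply/setXP; rewrite inS !mem_cyc !cO sOL oddO andbT /= centL ?mem_cyc ?cO ?sOL ?nOV //.
    split=> //; have pJ : 2.-group (V <*> 'O_2(L)).
      by rewrite norm_joinEl //= pgroupM pV pcore_pgroup.
    have eJ : V <*> 'O_2(L) = V.
      by apply: (sub_pHall sylV pJ); rewrite ?joing_subl // join_subG sVG sOL.
    by apply: subset_trans (joing_subr V _) _; rewrite eJ.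
  case/setXP=> /= cD; rewrite inS => /and3P[cM oddM cVM] ->.
  have := cM; rewrite mem_cyc => /andP[sMG cyM]; split.
    exact: joing_cyc pV (oddP _ oddM) cVM cD cyM sVG sMG.
  apply/afixP=> v Vv; apply: val_inj => /=; apply/normP.
  have := cD; rewrite mem_cyc => /andP[sDV _].
  apply: subsetP v Vv; rewrite normsY //; last by rewrite cents_norm // centsC.
  by rewrite cents_norm // centsC (subset_trans sDV).
have := pgroup_fix_mod pV actV; rewrite fixE c13 (card_cyc_join pV) => [|L]; last first.
  by rewrite inS => /and3P[_ oddL ->]; split=> //; apply: oddP.
by rewrite (card_cyc_p2Elem (isT : prime 2) E2V) !modn2 oddM.
Qed.

End KleinFour.

(** If C_Q(x) = 1 and Q is a Sylow subgroup, the parity argument fails only when some element of Q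
    acts nontrivially on a cyclic subgroup of odd order; the case of an acting 2-element then
    applies. *)
Lemma odd_action_cyc13 (gT : finGroupType) (G : {group gT}) p x (Q : {group gT}) :
    #|cyc G| = 13 -> odd p -> noncentral_action G p 2 x Q ->
  metacyclic13 G \/ sl23_struct G.
Proof.
move=> c13 p_odd act; have [p3 k4] := odd_action_p3 c13 p_odd act.
have [C1 | ntC] := eqVneq 'C_Q[x]%G 1%G; last by right; apply: odd_action_sl23 c13 p_odd act ntC.
have oQ : #|Q| = 4 by rewrite -k4 [X in #|_ : X|](congr1 val C1) indexg1.
rewrite p3 in act; have [_ _ _ [sQG pQ] _] := act.
have [T sylT sQT] := Sylow_superset sQG pQ.
have [eqQT | neQT] := eqVneq Q T; last first.
  right; apply: (klein_four_Sylow c13 act oQ sylT).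
  by rewrite properEneq sQT andbT -val_eqE in neQT *.
rewrite -eqQT in sylT.
have [/forall_inP centL | ] := boolP [forall (L | L \in cyc G),
    (odd #|L|) ==> (Q \subset 'N(L)) ==> (L \subset 'C(Q))].
  case: (klein_four_parity c13 act oQ sylT) => L cL oddL nLQ.
  by have := centL L cL; rewrite oddL nLQ.
rewrite negb_forall_in => /exists_inP[L cL]; rewrite !negb_imply => /and3P[oddL nLQ ncL].
left; have := cL; rewrite mem_cyc => /andP[sLG cyL].
have nilL := abelian_nil (cyclic_abelian cyL).
have [|r pi_r /subsetPn[v Qv ncv]] := @nil_noncent_pcore _ Q L nilL; first by rewrite centsC.
move: pi_r; rewrite mem_primes => /and3P[r_pr _ dv_r].
apply: (@even_action_metacyclic13 _ _ r v 'O_r(L)%G c13); split=> //.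
- by apply: contraTneq dv_r => <-; rewrite dvdn2 oddL.
- by split; [apply: subsetP Qv | apply: mem_p_elt pQ Qv].
- by split; [apply: subset_trans (pcore_sub _ _) sLG | apply: pcore_pgroup].
by rewrite ncv (subsetP (char_norm_trans (pcore_char _ _) nLQ)).
Qed.

(** For p and q odd with q <= 5, the index is 3, 9 or 5, and the odd p would divide 2, 8 or 4. *)
Lemma noncentral_action_cyc13 (gT : finGroupType) (G : {group gT}) p q x (Q : {group gT}) :
  #|cyc G| = 13 -> noncentral_action G p q x Q -> metacyclic13 G \/ sl23_struct G.
Proof.
move=> c13 act; have [[p_pr q_pr] ne_pq [Gx px] [sQG qQ] _] := act.
have [q_gt6 | q_lt7] := ltnP 6 q.
  by left; apply: large_prime_metacyclic13 act q_gt6.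
have [p2 | p_odd] := even_prime p_pr.
  by rewrite p2 in act; left; apply: even_action_metacyclic13 act.
have [q2 | q_odd] := even_prime q_pr.
  by rewrite q2 in act; apply: odd_action_cyc13 act.
have le11 := noncentral_action_index_le c13 act.
have [_ gt1 modp /p_natP[n ek]] := noncentral_action_index act.
have dvk : p %| #|Q : 'C_Q[x]| - 1 by rewrite -eqn_mod_dvd ?(ltnW gt1) //; apply/eqP.
have p_gt2 := odd_prime_gt2 p_odd p_pr; have q_gt2 := odd_prime_gt2 q_odd q_pr.
exfalso; rewrite ek in dvk gt1 le11.
have no2 m : p %| 2 ^ m -> False.
  by rewrite Euclid_dvdX // => /andP[/(dvdn_leq (isT : 0 < 2))]; rewrite leqNgt p_gt2.
have /orP[/eqP q3|/eqP q5] : (q == 3) || (q == 5).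
- by move: q_lt7 q_gt2 q_odd; case: (q) => [|[|[|[|[|[|[|q']]]]]]].
- case: n {ek} gt1 dvk le11 => [|[|[|n]]] //; rewrite q3 => _.
  + by move/(no2 1%N).
  + by move/(no2 3).
  by rewrite !expnS => _; have := expn_gt0 3 n; clear; lia.
case: n {ek} gt1 dvk le11 => [|[|n]] //; rewrite q5 => _.
  by move/(no2 2).
by rewrite !expnS => _; have := expn_gt0 5 n; clear; lia.
Qed.

Lemma nonnilpotent_cyc13 (gT : finGroupType) (G : {group gT}) :
  #|cyc G| = 13 -> ~~ nilpotent G -> metacyclic13 G \/ sl23_struct G.
Proof.
move=> c13 /nonnil_noncentral_action[p [q [x [Q act]]]].
exact: noncentral_action_cyc13 act.
Qed.

Lemma nil_cyc13_pgroup (gT : finGroupType) (G : {group gT}) :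
  #|cyc G| = 13 -> nilpotent G -> exists p : nat, p.-group G.
Proof.
move=> c13 nilG; have [G1 | ntG] := eqVneq #|G| 1%N.
  by exists 2; rewrite /pgroup G1.
exists (pdiv #|G|); set p := pdiv _.
have := card_cyc_dprod (nilpotent_pcoreC p nilG) (pcore_pgroup _ _) (pcore_pgroup _ _).
rewrite c13 => /esym e13; have : #|cyc 'O_p(G)| %| 13 by rewrite -e13 dvdn_mulr.
have c1 (K : {group gT}) : #|cyc K| = 1%N -> K :=: 1.
  by move=> cK; apply: cyc_sub_eq; rewrite ?sub1G // cK; apply/card_gt0P; exists 1%G; apply: cyc1.
have hG := nilpotent_pcoreC p nilG.
rewrite dvdn_divisors // !inE => /orP[/eqP o1 | /eqP o13].
  have p_pr : prime p by rewrite pdiv_prime // ltn_neqAle eq_sym ntG cardG_gt0.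
  have := card_Hall (nilpotent_pcore_Hall p nilG); rewrite (c1 _ o1) cards1 => /esym/eqP.
  rewrite p_part_eq1 mem_primes p_pr cardG_gt0 /= /p pdiv_dvd //.
have o1 : #|cyc 'O_p^'(G)%G| = 1%N by move: e13; rewrite o13; move: #|_|; clear; lia.
by have [_ <- _ _] := dprodP hG; rewrite (c1 _ o1) mulg1 pcore_pgroup.
Qed.

(** * Presentations of the metacyclic groups *)

Lemma homGrp_gtype (gT : finGroupType) (G : {group gT}) q m e a b :
    a ^+ q = 1 -> b ^+ m = 1 -> a ^ b = a ^+ e -> <[a]> <*> <[b]> = G ->
  G \homg Grp (x : y : x ^+ q, y ^+ m, x ^ y = x ^+ e).
Proof.
move=> aq bm ab defG; apply/existsP; exists (a, b).
by rewrite /= !xpair_eqE defG aq bm ab !eqxx.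
Qed.

(** The orders of a and b divide q and m, and their product is at least q m, the order of the
    group. *)
Lemma gtype_gens q m e : 1 < q -> 1 < m -> e ^ m = 1 %[mod q] ->
  exists a, exists b, [/\ #[a] = q, #[b] = m, a ^ b = a ^+ e,
     <[a]> * <[b]> = [set: Extremal.gtype q m e] & <[a]> <| [set: Extremal.gtype q m e]].
Proof.
move=> q_gt1 m_gt1 em; have GrpG := Grp_gtype q_gt1 m_gt1 em.
have /existsP[[a b]] := isoGrp_hom GrpG.
rewrite /= !xpair_eqE => /and4P[/eqP defG /eqP aq /eqP bm /eqP ab].
have nab : <[b]> \subset 'N(<[a]>).
  by rewrite cycle_subG inE -cycleJ cycle_subG ab mem_cycle.
have defG' : <[a]> * <[b]> = [set: Extremal.gtype q m e] by rewrite -norm_joinEr.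
have le_a : #[a] <= q by rewrite dvdn_leq ?order_dvdn ?aq // ltnW.
have le_b : #[b] <= m by rewrite dvdn_leq ?order_dvdn ?bm // ltnW.
have oG : (q * m <= #[a] * #[b])%N.
  have <- : #|[set: Extremal.gtype q m e]| = (q * m)%N by rewrite Extremal.card // mulnC.
  by rewrite -defG' !orderE mul_cardG leq_pmulr // cardG_gt0.
have m_gt0 := ltnW m_gt1; have q_gt0 := ltnW q_gt1.
exists a, b; split=> //.
- apply/eqP; rewrite eqn_leq le_a -(leq_pmul2r m_gt0) (leq_trans oG) //.
  by rewrite leq_pmul2l.
- apply/eqP; rewrite eqn_leq le_b -(leq_pmul2l q_gt0) (leq_trans oG) //.
  by rewrite leq_pmul2r.
by rewrite -defG' /normal mulG_subl mul_subG ?normG.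
Qed.

Lemma card_cyc_gtype p q n e : prime p -> prime q -> p != q -> 0 < n ->
    e ^ p = 1 %[mod q] -> e != 1 %[mod q] ->
  #|cyc [set: Extremal.gtype q (p ^ n) e]%G| = (q + n.*2)%N.
Proof.
move=> p_pr q_pr ne_pq n_gt0 ep ne1; have q_gt1 := prime_gt1 q_pr.
have pn_gt1 : 1 < p ^ n by rewrite -(exp1n n) ltn_exp2r // prime_gt1.
have epn : e ^ (p ^ n) = 1 %[mod q].
  case: n n_gt0 {pn_gt1} => // n _; rewrite expnS expnM -modnXm ep modnXm exp1n //.
have [a [b [oa ob ab defG nAG]]] := gtype_gens q_gt1 pn_gt1 epn.
have ncb : b \notin 'C(<[a]>).
  apply: contra ne1 => /centP/(_ a (cycle_id a)) cba.
  rewrite -oa -eq_expg_mod_order expg1 -ab; apply/eqP/conjg_fixP/commgP.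
  exact: commute_sym.
have abk k : a ^ (b ^+ k) = a ^+ (e ^ k).
  elim: k => [|k IHk]; first by rewrite expg0 conjg1 expn0 expg1.
  by rewrite expgSr conjgM IHk conjXg ab -expgM expnS.
have cbp : b ^+ p \in 'C(<[a]>).
  rewrite -sub_cent1 cycle_subG; apply/cent1P/commgP/conjg_fixP.
  by rewrite abk; apply/eqP; rewrite -{2}[a]expg1 eq_expg_mod_order oa ep.
have Gb : b \in [set: Extremal.gtype q (p ^ n) e] by rewrite inE.
have := @card_cyc_semidirect _ p q [set: Extremal.gtype q (p ^ n) e]%G <[a]>%G b p_pr q_pr
  ne_pq nAG oa Gb ncb n defG ob n_gt0 cbp.
by [].
Qed.

Lemma isog_gtype (gT : finGroupType) (G : {group gT}) q m e a b : 1 < q -> 1 < m ->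
    e ^ m = 1 %[mod q] -> #[a] = q -> #[b] = m -> a ^ b = a ^+ e ->
    <[a]> * <[b]> = G -> coprime q m ->
  G \isog [set: Extremal.gtype q m e].
Proof.
move=> q_gt1 m_gt1 em oa ob ab defG co.
have nab : <[b]> \subset 'N(<[a]>).
  by rewrite cycle_subG inE -cycleJ cycle_subG ab mem_cycle.
apply/(isoGrpP _ (Grp_gtype q_gt1 m_gt1 em)); split.
  rewrite Extremal.card // mulnC -[G : {set gT}]defG TI_cardMg -?orderE ?oa ?ob //.
  by rewrite coprime_TIg // -!orderE oa ob.
apply: (@homGrp_gtype _ G q m e a b) => //; rewrite -?oa -?ob ?expg_order //.
by rewrite norm_joinEr.
Qed.

Lemma conj_inv_eq (gT : finGroupType) (a b : gT) :
  (b * a * b^-1 == a^-1) = (a ^ b == a^-1).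
Proof.
have -> : b * a * b^-1 = a ^ b^-1 by rewrite conjgE invgK mulgA.
rewrite -(inj_eq (conjg_inj b)) conjgKV conjVg -(inj_eq (can_inj (@invgK _))) invgK.
by rewrite eq_sym.
Qed.

(** [q.-1] stands for -1 modulo q, and m even makes its m-th power 1. For inversion, conjugating by
    b or by its inverse is the same. *)
Lemma Grp_gtype_inv q m : 1 < q -> 1 < m -> ~~ odd m ->
  [set: Extremal.gtype q m q.-1] \isog
    Grp (a : b : a ^+ q, b ^+ m, b * a * b^-1 = a^-1).
Proof.
move=> q_gt1 m_gt1 even_m rT H.
have em : q.-1 ^ m = 1 %[mod q].
  rewrite -[m]odd_double_half (negPf even_m) add0n -muln2 mulnC expnM -modnXm.
  have -> : q.-1 ^ 2 = 1 %[mod q].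
    case: q q_gt1 => [|[|q]] // _; rewrite /= expnS expn1 mulSn.
    by rewrite -[X in X %% _](_ : q * q.+2 + 1 = _)%N ?modnMDl //; lia.
  by rewrite modnXm exp1n.
rewrite (Grp_gtype q_gt1 m_gt1 em); apply: eq_existsb => -[a b] /=.
rewrite !xpair_eqE conj_inv_eq; congr (_ && _); case: eqP => //= aq.
congr (_ && _); suff -> : a ^+ q.-1 = a^-1 by [].
by apply: (mulgI a); rewrite -expgS (prednK (ltnW q_gt1)) aq mulgV.
Qed.

(** b a b^-1 is the conjugate of a by b^-1, so its exponent f is the inverse of e modulo q. *)
Lemma Grp_gtype_conjV q m e f : 1 < q -> 1 < m -> e ^ m = 1 %[mod q] ->
    e * f = 1 %[mod q] ->
  [set: Extremal.gtype q m e] \isog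
    Grp (a : b : a ^+ q, b ^+ m, b * a * b^-1 = a ^+ f).
Proof.
move=> q_gt1 m_gt1 em ef rT H.
rewrite (Grp_gtype q_gt1 m_gt1 em); apply: eq_existsb => -[a b] /=.
rewrite !xpair_eqE; congr (_ && _); case: eqP => //= aq; congr (_ && _).
have aef : a ^+ (e * f) = a.
  by apply/eqP; rewrite -{2}[a]expg1 -(expg_mod _ aq) ef expg_mod.
have -> : b * a * b^-1 = a ^ b^-1 by rewrite conjgE invgK mulgA.
rewrite -[a ^ b^-1 == _](inj_eq (conjg_inj b)) conjgKV conjXg.
apply/eqP/eqP=> [-> | eqa]; first by rewrite -expgM.
rewrite -conjXg in eqa; rewrite [in RHS]eqa conjXg -expgM mulnC.
by rewrite -conjXg aef.
Qed.

(** x may act by another exponent i than e; replacing x by x^j with j prime to p, which generates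
    the same subgroup, turns i into e. *)
Lemma metacyclic_isog_gtype (gT : finGroupType) (G : {group gT}) p q n e :
    prime p -> prime q -> p != q -> 0 < n ->
    (forall i, i < q -> i ^ p = 1 %[mod q] -> i != 1%N ->
       exists2 j, coprime p j & i ^ j = e %[mod q]) ->
  metacyclic_struct G p q n -> G \isog [set: Extremal.gtype q (p ^ n) e].
Proof.
move=> p_pr q_pr ne_pq n_gt0 e_gen [A [x [nAG oA [Gx ncx] ox [defG cxp]]]].
have q_gt1 := prime_gt1 q_pr.
have pn_gt1 : 1 < p ^ n by rewrite -(exp1n n) ltn_exp2r // prime_gt1.
have /cyclicP[a defA] : cyclic A by rewrite prime_cyclic ?oA.
have oa : #[a] = q by rewrite orderE -defA.
have Aa : a \in A by rewrite defA cycle_id.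
have nAx : x \in 'N(A) by apply: (subsetP (normal_norm nAG)).
have : a ^ x \in A by rewrite memJ_norm.
rewrite defA => /cyclePmin[i]; rewrite oa => lt_i ax.
have axk k : a ^ (x ^+ k) = a ^+ (i ^ k).
  elim: k => [|k IHk]; first by rewrite expg0 conjg1 expn0 expg1.
  by rewrite expgSr conjgM IHk conjXg ax -expgM expnS.
have ip : i ^ p = 1 %[mod q].
  apply/eqP; rewrite -oa -eq_expg_mod_order expg1 -axk; apply/eqP/conjg_fixP/commgP.
  by apply: commute_sym; apply: (centP cxp).
have i1 : i != 1%N.
  apply: contra ncx => /eqP i1; rewrite defA cent_cycle; apply/cent1P/commute_sym/commgP/conjg_fixP.
  by rewrite ax i1 expg1.
have [j co_j ije] := e_gen i lt_i ip i1.
have epn : e ^ (p ^ n) = 1 %[mod q].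
  rewrite -modnXm -ije modnXm -expnM mulnC expnM -modnXm.
  suff -> : i ^ (p ^ n) = 1 %[mod q] by rewrite modnXm exp1n.
  by case: (n) n_gt0 => // m _; rewrite expnS expnM -modnXm ip modnXm exp1n.
have co_xj : coprime #[x] j by rewrite ox coprimeXl.
have defx : <[x]> = <[x ^+ j]> by apply/eqP; rewrite [_ == _]generator_coprime.
apply: (@isog_gtype _ G q (p ^ n) e a (x ^+ j)) => //.
- by rewrite orderE -defx -orderE.
- by rewrite axk; apply/eqP; rewrite eq_expg_mod_order oa ije.
- by rewrite -defx -defA.
by rewrite coprime_sym coprimeXl // prime_coprime // dvdn_prime2.
Qed.

Lemma exp_gen_check p q e :
    all (fun i => [&& i ^ p %% q == 1 %% q & i != 1]%N ==>
           has (fun j => coprime p j && (i ^ j %% q == e %% q)%N) (iota 0 p)) (iota 0 q) ->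
  forall i, i < q -> i ^ p = 1 %[mod q] -> i != 1%N ->
    exists2 j, coprime p j & i ^ j = e %[mod q].
Proof.
move/allP=> chk i lt_i /eqP ip i1.
have := chk i; rewrite mem_iota add0n lt_i ip i1 /= => /(_ isT)/hasP[j _ /andP[co_j /eqP ij]].
by exists j.
Qed.

(** The triples are (q, p^n, e). The exponent is -1 modulo q when p = 2; 3 has order 5 modulo 11; 4
    is the inverse of 2 modulo 7, as [Grp_gtype_conjV] requires. *)
Definition known_gtype13 q m e := (q, m, e) \in
  [:: (11, 2, 10); (11, 5, 3); (7, 8, 6); (7, 27, 4); (5, 16, 4); (3, 32, 2)].

Lemma metacyclic13_isog (gT : finGroupType) (G : {group gT}) :
  metacyclic13 G -> exists q, exists m, exists2 e,
   known_gtype13 q m e & G \isog [set: Extremal.gtype q m e].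
Proof.
case=> p [q [n [[p_pr q_pr ne_pq dv_p] [n_gt0 qn]] sG]].
have lt_n : n < 6 by have := prime_gt1 q_pr; lia.
have isoG := metacyclic_isog_gtype p_pr q_pr ne_pq n_gt0 _ sG.
have le_p : p <= q.-1 by apply: dvdn_leq => //; have := prime_gt1 q_pr; lia.
have defq : q = (13 - n.*2)%N by rewrite -qn addnK.
case: n n_gt0 lt_n defq {qn} => [|[|[|[|[|[|n]]]]]] // _ _ defq in isoG sG *; subst q => //.
have: p \in primes 10 by rewrite mem_primes p_pr.
rewrite inE => /orP[]; rewrite ?inE => /eqP defp; subst p.
    by exists 11, 2; exists 10; rewrite ?inE //; apply: isoG; apply: exp_gen_check; vm_compute.
  by exists 11, 5; exists 3; rewrite ?inE //; apply: isoG; apply: exp_gen_check; vm_compute.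
have: p \in primes 6 by rewrite mem_primes p_pr.
rewrite inE => /orP[]; rewrite ?inE => /eqP defp; subst p.
    by exists 7, 8; exists 6; rewrite ?inE //; apply: isoG; apply: exp_gen_check; vm_compute.
  by exists 7, 27; exists 4; rewrite ?inE //; apply: isoG; apply: exp_gen_check; vm_compute.
have: p \in primes 4 by rewrite mem_primes p_pr.
  rewrite inE => /eqP defp; subst p.
  by exists 5, 16; exists 4; rewrite ?inE //; apply: isoG; apply: exp_gen_check; vm_compute.
have: p \in primes 2 by rewrite mem_primes p_pr.
rewrite inE => /eqP defp; subst p.
by exists 3, 32; exists 2; rewrite ?inE //; apply: isoG; apply: exp_gen_check; vm_compute.
Qed.

Lemma card_cyc_known_gtype13 q m e :
  known_gtype13 q m e -> #|cyc [set: Extremal.gtype q m e]%G| = 13.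
Proof.
rewrite /known_gtype13 !inE.
case/or4P=> [|||/or3P[]] /eqP[-> -> ->].
- exact: (@card_cyc_gtype 2 11 1).
- exact: (@card_cyc_gtype 5 11 1).
- exact: (@card_cyc_gtype 2 7 3).
- exact: (@card_cyc_gtype 3 7 3).
- exact: (@card_cyc_gtype 2 5 4).
exact: (@card_cyc_gtype 2 3 5).
Qed.

(** * The group SL(2, 3) *)

Lemma order_eq4 (gT : finGroupType) (g : gT) : g ^+ 4 = 1 -> g ^+ 2 != 1 -> #[g] = 4.
Proof.
move=> g4; rewrite -order_dvdn => g2.
have: #[g] %| 2 ^ 2 by rewrite order_dvdn g4.
case/(dvdn_pfactor _ _ (isT : prime 2)) => m le_m og; move: g2.
by rewrite og; case: m le_m {og} => [|[|[]]].
Qed.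

(** SL(2, 3) as the quaternion group <i, j> extended by x, which permutes i, j, ij cyclically. The
    separate condition that i^2 is not 1 prevents collapse. *)
Definition sl23_rel (gT : finGroupType) (i j x : gT) :=
  [/\ i ^+ 2 = j ^+ 2, i ^ j = i^-1, x ^+ 3 = 1, i ^ x = j & j ^ x = i * j].

Section SL23Relations.

Variables (gT : finGroupType) (i j x : gT).
Hypothesis rel_ijx : sl23_rel i j x.

Let i2 : i ^+ 2 = j ^+ 2. Proof. by case: rel_ijx. Qed.
Let ij : i ^ j = i^-1. Proof. by case: rel_ijx. Qed.
Let x3 : x ^+ 3 = 1. Proof. by case: rel_ijx. Qed.
Let ix : i ^ x = j. Proof. by case: rel_ijx. Qed.
Let jx : j ^ x = i * j. Proof. by case: rel_ijx. Qed.

(** i^2 = j^2 commutes with j, while conjugation by j inverts it. *)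
Lemma sl23_rel_i4 : i ^+ 4 = 1.
Proof.
have i2j : (i ^+ 2) ^ j = i ^+ 2 by apply/conjg_fixP/commgP; rewrite i2; apply/commute_sym/commuteX.
rewrite conjXg ij expgVn in i2j.
by rewrite (expgD i 2 2) -{1}i2j mulVg.
Qed.

Let Q := (<[i]> <*> <[j]>)%G.

Let defQ : <[i]> * <[j]> = Q.
Proof. by rewrite -norm_joinEr // cycle_subG inE -cycleJ ij cycleV. Qed.

Lemma sl23_rel_mem u : u \in Q -> exists a, exists b : bool, u = i ^+ a * j ^+ b.
Proof.
rewrite -[gval Q]defQ => /mulsgP[v w /cycleP[a ->] /cycleP[b ->] ->].
exists (a + b./2.*2)%N, (odd b).
rewrite expgD -{1}(odd_double_half b) addnC expgD !(mulgA, expgM) -!muln2.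
by rewrite ![(_ * 2)%N]mulnC !expgM i2.
Qed.

Lemma sl23_rel_card_le8 : #|Q| <= 8.
Proof.
have le_i : #[i] <= 4 by rewrite dvdn_leq // order_dvdn sl23_rel_i4.
apply: (@leq_trans #|<[i]> :|: <[i]> :* j|).
  apply/subset_leq_card/subsetP=> u /sl23_rel_mem[a [[] ->]].
    by rewrite inE mem_rcoset expg1 mulgK mem_cycle orbT.
  by rewrite inE expg0 mulg1 mem_cycle.
by rewrite (leq_trans (leq_card_setU _ _)) // card_rcoset -orderE (leq_add le_i le_i).
Qed.

Lemma sl23_rel_norm : x \in 'N(Q).
Proof.
rewrite inE /= conjYg join_subG -!cycleJ !cycle_subG ix jx.
have Qj : j \in <[i]> <*> <[j]> by rewrite mem_gen // inE cycle_id orbT.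
by rewrite Qj groupM // mem_gen // inE cycle_id.
Qed.

Lemma sl23_rel_gen : Q * <[x]> = <<[set i; j; x]>>.
Proof.
rewrite -norm_joinEr ?cycle_subG ?sl23_rel_norm //.
by rewrite /= /cycle !(joing_idl, joing_idr).
Qed.

Hypothesis i2n1 : i ^+ 2 != 1.

Let z := i ^+ 2.

(** Up to powers of the central z, the elements of Q are 1, i, j and ij, and both alternatives are
    stable under multiplication by z. *)
Lemma sl23_rel_elt u : u \in Q -> u \in [set 1; z] \/ u ^+ 2 = z /\ u ^ x != u.
Proof.
have i4 := sl23_rel_i4; have z2 : z ^+ 2 = 1 by rewrite -expgM.
have zi : commute z i by apply/commute_sym/commuteX.
have zj : commute z j by rewrite /z i2; apply/commute_sym/commuteX.
have zx : z ^ x = z by rewrite /z conjXg ix i2.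
have iz : i^-1 = z * i by rewrite -expgSr; apply: (mulgI i); rewrite mulgV -expgS.
have jij : j * i * j = i.
  have -> : j * i * j = j ^+ 2 * i ^ j by rewrite conjgE expgS expg1 !mulgA mulgK.
  by rewrite ij -i2 expgS expg1 mulgK.
pose good v := v \in [set 1; z] \/ v ^+ 2 = z /\ v ^ x != v.
have goodM v k : commute z v -> good v -> good (v * z ^+ k).
  move=> czv; have czkv : commute v (z ^+ k) by apply/commuteX/commute_sym.
  case=> [|[v2 vx]]; last first.
    right; rewrite expgMn // v2 -expgM mulnC expgM z2 expg1n mulg1; split=> //.
    by rewrite conjMg conjXg zx (inj_eq (mulIg _)).
  move=> v1z; left; rewrite -(odd_double_half k) expgD -mul2n expgM z2 expg1n mulg1.
  move: v1z; rewrite !inE => /orP[]/eqP->; case: odd; rewrite ?expg1 ?mul1g ?mulg1 ?eqxx ?orbT //.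
  by rewrite -[z * z]/(z ^+ 2) z2 eqxx.
have i1 : i != 1 by apply: contra i2n1 => /eqP->; rewrite expg1n.
have j1 : j != 1 by apply: contra i2n1 => /eqP ej; rewrite i2 ej expg1n.
have g1 : good 1 by left; rewrite !inE eqxx.
have gi : good i.
  right; split=> //; rewrite ix; apply: contra i2n1 => /eqP ej; move: ij.
  by rewrite ej conjgE mulKg => ei; rewrite expgS expg1 {2}ei mulgV.
have gj : good j.
  by right; rewrite -i2 jx -{2}[j]mul1g (inj_eq (mulIg _)).
have gij : good (i * j).
  right; split; first by rewrite expgS expg1 -mulgA [j * (i * j)]mulgA jij.
  rewrite conjMg ix jx mulgA jij -{1}[i]mulg1 (inj_eq (mulgI _)) eq_sym //.
case/sl23_rel_mem=> a [b ->]; rewrite -/(good _) -(odd_double_half a).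
rewrite expgD -mul2n expgM -/z -mulgA (commuteX2 _ _ (_ : commute z j)) //.
rewrite mulgA; apply: goodM.
  by apply: commuteM; apply: commuteX.
by case: odd b => [] [] /=; rewrite ?expg1 ?mulg1 ?mul1g.
Qed.

Lemma sl23_rel_order_i : #[i] = 4.
Proof.
exact: order_eq4 sl23_rel_i4 i2n1.
Qed.

Lemma sl23_rel_cardQ : #|Q| = 8.
Proof.
have sIQ : <[i]> \subset Q by rewrite joing_subl.
have nQI : ~~ (Q \subset <[i]>).
  rewrite join_subG subxx cycle_subG; apply/negP=> Ij.
  have cij : commute i j by apply: (centsP (cycle_abelian i)) => //; apply: cycle_id.
  have := ij; rewrite conjgE cij mulKg => ei.
  by move: i2n1; rewrite expgS expg1 {2}ei mulgV eqxx.
have : #|<[i]>| %| #|Q| by rewrite cardSg.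
have : #|<[i]>| < #|Q| by rewrite proper_card // properE sIQ.
have := sl23_rel_card_le8; rewrite -/Q -orderE sl23_rel_order_i.
by move: #|Q|; do 9?case=> //.
Qed.

Lemma sl23_rel_order_x : #[x] = 3.
Proof.
apply: nt_prime_order => //; apply: contra i2n1 => /eqP x1; move: ix.
rewrite x1 conjg1 => ej; have := ij; rewrite -ej conjgE mulKg => ei.
by rewrite expgS expg1 {2}ei mulgV.
Qed.

Lemma sl23_rel_card : #|<<[set i; j; x]>>| = 24.
Proof.
rewrite -sl23_rel_gen TI_cardMg; last first.
  by rewrite coprime_TIg // -orderE sl23_rel_order_x sl23_rel_cardQ.
by rewrite -orderE sl23_rel_order_x sl23_rel_cardQ.
Qed.

Lemma sl23_rel_normal : Q <| <<[set i; j; x]>>.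
Proof.
by rewrite -sl23_rel_gen /normal mulG_subl mul_subG ?normG // cycle_subG sl23_rel_norm.
Qed.

Lemma sl23_rel_involution t : t \in <<[set i; j; x]>> -> t ^+ 2 = 1 -> t \in [set 1; z].
Proof.
move=> Gt t2; have Qt : t \in Q.
  have hallQ : 2.-Hall(<<[set i; j; x]>>) Q.
    rewrite /pHall normal_sub ?sl23_rel_normal //= /pgroup sl23_rel_cardQ /=.
    by rewrite -divgS ?normal_sub ?sl23_rel_normal // sl23_rel_card sl23_rel_cardQ.
  rewrite (mem_normal_Hall hallQ sl23_rel_normal) //.
  by rewrite /p_elt; apply: (@pnat_dvd _ 2) => //; rewrite order_dvdn t2.
case: (sl23_rel_elt Qt) => // -[]; rewrite t2 => z1.
by move: i2n1; rewrite -/z -z1 eqxx.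
Qed.

(* Every element other than the identity and the central involution has order
   3, 4 or 6. *)
Lemma sl23_rel_totient g :
  g \in <<[set i; j; x]>>%G -> g \notin [set 1; z] -> totient #[g] = 2.
Proof.
set G := <<_>>%G; move=> Gg ntg; have nQG : Q <| G by apply: sl23_rel_normal.
have z2 : z ^+ 2 = 1 by rewrite -expgM sl23_rel_i4.
have ox := sl23_rel_order_x.
have o4 h : h \in Q -> h \notin [set 1; z] -> #[h] = 4.
  move=> Qh nth; case: (sl23_rel_elt Qh) => [hz|[h2 _]]; first by rewrite hz in nth.
  by apply: order_eq4; rewrite ?(expgM _ 2 2) h2 ?z2.
have [Qg|nQg] := boolP (g \in Q); first by rewrite o4.
have Qg3 : g ^+ 3 \in Q.
  have nQg' : g \in 'N(Q) by apply: (subsetP (normal_norm nQG)).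
  rewrite coset_idr ?groupX // morphX //=; apply/eqP; rewrite -order_dvdn.
  have -> : 3 = #|G / Q|.
    by rewrite card_quotient ?normal_norm // -divgS ?normal_sub // sl23_rel_card sl23_rel_cardQ.
  by apply: order_dvdG; apply: mem_quotient.
have g3z : g ^+ 3 \in [set 1; z].
  (* If g^3 had order 4, g^4 would have order 3, and <g^4> would be conjugate to <x> by Sylow. Then
     x would centralise a conjugate of g^3, an element of order 4 in Q, against [sl23_rel_elt]. *)
  apply: contraT => ntg3; have og3 := o4 _ Qg3 ntg3.
  have g12 : g ^+ 12 = 1 by rewrite (expgM g 3 4) -og3 expg_order.
  have og4 : #[g ^+ 4] = 3.
    apply: nt_prime_order => //; first by rewrite -expgM.
    apply: contra nQg => /eqP g41.
    by rewrite -[g]mulg1 -(mulgV (g ^+ 3)) mulgA -expgS g41 mul1g groupV.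
  have syl y : y \in G -> #[y] = 3 -> 3.-Sylow(G) <[y]>.
    move=> Gy oy; rewrite pHallE cycle_subG Gy /= -orderE oy.
    by rewrite sl23_rel_card p_part.
  have Gx : x \in G by rewrite mem_gen // !inE eqxx orbT.
  have [u Gu xu] := Sylow_trans (syl _ Gx ox) (syl _ (groupX 4 Gg) og4).
  have Qhu : (g ^+ 3) ^ u^-1 \in Q.
    by rewrite memJ_norm // groupV (subsetP (normal_norm nQG)).
  have cxh : ((g ^+ 3) ^ u^-1) ^ x = (g ^+ 3) ^ u^-1.
    rewrite -conjgM conjgCV conjgM invgK; congr (_ ^ _); apply/conjg_fixP/commgP.
    have: x ^ u \in <[g ^+ 4]> by rewrite xu memJ_conjg cycle_id.
    by case/cycleP=> k ->; rewrite -expgM; apply: commuteX2.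
  have := sl23_rel_elt Qhu; case=> [|[_]]; last by rewrite cxh eqxx.
  move=> hz; have: #[g ^+ 3 ^ u^-1] %| 2.
    by rewrite order_dvdn; move: hz; rewrite !inE => /orP[]/eqP->; rewrite ?expg1n ?z2.
  by rewrite orderJ og3.
have g6 : #[g] %| 6.
  rewrite order_dvdn (expgM g 3 2).
  by move: g3z; rewrite !inE => /orP[]/eqP->; rewrite ?expg1n ?z2.
have: ~~ (#[g] %| 2).
  rewrite order_dvdn; apply: contra ntg => /eqP g2.
  exact: sl23_rel_involution.
have: #[g] \in divisors 6 by rewrite -dvdn_divisors.
by rewrite !inE => /or4P[] /eqP->.
Qed.

(** 1 and <z> have one generator each, every other cyclic subgroup two: 24 = 2 + 2 (c - 2). *)
Lemma sl23_rel_card_cyc : #|cyc <<[set i; j; x]>>%G| = 13.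
Proof.
set G := <<_>>%G.
have oz : #[z] = 2 by apply: nt_prime_order; rewrite // -expgM sl23_rel_i4.
have Gz : z \in G by rewrite groupX // mem_gen // !inE eqxx.
pose T := [set 1%G; <[z]>%G].
have sTG : T \subset cyc G by rewrite subUset !sub1set cyc1 cycle_cyc.
have ne_z : 1%G != <[z]>%G.
  by apply/eqP=> /(congr1 (fun L : {group gT} => #|L|)) /=; rewrite cards1 -orderE oz.
have := sum_totient_cyc_group G; rewrite sl23_rel_card (big_setID T) /= (setIidPr sTG).
rewrite big_setU1 ?inE //= big_set1 cards1 -orderE oz /=.
rewrite (eq_bigr (fun=> 2)) => [|L]; last first.
  rewrite in_setD mem_cyc => /and3P[nTL sLG /cyclicP[g defL]].
  rewrite defL -orderE sl23_rel_totient //; first by rewrite -cycle_subG -defL.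
  apply: contra nTL; rewrite !inE -!val_eqE /= defL => /orP[]/eqP->.
    by rewrite cycle1 eqxx.
  by rewrite eqxx orbT.
rewrite sum_nat_const cardsD (setIidPr sTG) cards2 ne_z => c2.
have := subset_leq_card sTG; rewrite cards2 ne_z.
move: c2; move: #|cyc G| => c; rewrite (totient_prime (isT : prime 2)) (_ : totient 1 = 1%N) //=; clear; lia.
Qed.

End SL23Relations.

Lemma sl23_rel_pair (gT rT : finGroupType) (i j x : gT) (i' j' x' : rT) :
  sl23_rel i j x -> sl23_rel i' j' x' -> sl23_rel (i, i') (j, j') (x, x').
Proof.
have e (a b : gT) (c d : rT) : a = b -> c = d -> (a, c) = (b, d) by move=> -> ->.
by move=> [a b c d f] [a' b' c' d' f']; split; apply: e; rewrite // /conjg /= in b b' d d' f f' *.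
Qed.

(* Goursat: the pairs of corresponding generators span a subgroup of the direct
   product which also satisfies the relations, hence has order 24 and projects
   isomorphically onto both factors. *)
Lemma sl23_rel_isog (gT rT : finGroupType) (i j x : gT) (i' j' x' : rT) :
    sl23_rel i j x -> i ^+ 2 != 1 -> sl23_rel i' j' x' -> i' ^+ 2 != 1 ->
  <<[set i; j; x]>> \isog <<[set i'; j'; x']>>.
Proof.
move=> r nt r' nt'; have rr := sl23_rel_pair r r'.
have ntt : (i, i') ^+ 2 != 1.
  by apply: contra nt => /eqP[/= ei _]; rewrite expgS expg1 -ei.
set K := <<[set (i, i'); (j, j'); (x, x')]>>%G.
have isoK : K \isog <<[set i; j; x]>>.
  rewrite isog_sym isogEcard (sl23_rel_card rr ntt) (sl23_rel_card r nt) andbT /=.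
  have <- : fst @* K = <<[set i; j; x]>>
    by rewrite morphim_gen ?subsetT // morphimEsub ?subsetT // !(imsetU, imset_set1).
  exact: morphim_homg.
have isoK' : K \isog <<[set i'; j'; x']>>.
  rewrite isog_sym isogEcard (sl23_rel_card rr ntt) (sl23_rel_card r' nt') andbT /=.
  have <- : snd @* K = <<[set i'; j'; x']>>
    by rewrite morphim_gen ?subsetT // morphimEsub ?subsetT // !(imsetU, imset_set1).
  exact: morphim_homg.
by rewrite isog_sym in isoK; apply: isog_trans isoK isoK'.
Qed.

(** * Recovering the relations of SL(2, 3) from numerical data *)

Section SL23Struct.

Variables (gT : finGroupType) (G Q : {group gT}) (x : gT).
Hypotheses (oG : #|G| = 24) (sQG : Q \subset G) (Gx : x \in G) (oQ : #|Q| = 8).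
Hypotheses (ox : #[x] = 3) (cQ : #|cyc Q| = 5) (nQx : x \in 'N(Q)) (oC : #|'C_Q[x]| = 2).

Let ncyclicQ : ~~ cyclic Q.
Proof.
apply/negP=> cyQ; have := card_cyc_cyclic_pgroup (isT : prime 2) cyQ (oQ : #|Q| = (2 ^ 3)%N).
by rewrite cQ.
Qed.

Lemma sl23_order_dvd4 u : u \in Q -> #[u] %| 4.
Proof.
move=> Qu; have: #[u] %| 2 ^ 3 by rewrite -[(2 ^ 3)%N]oQ order_dvdG.
case/(dvdn_pfactor _ _ (isT : prime 2)) => m le_m ou.
rewrite ou; case: m le_m ou => [|[|[|[|]]]] // _ ou.
case/negP: ncyclicQ; apply/cyclicP; exists u; apply/eqP.
by rewrite eq_sym eqEcard cycle_subG Qu -orderE ou oQ.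
Qed.

(** Cyclic subgroups of Q have order 1, 2 or 4; if t of the five have order at most 2, then t + 2 (5
    - t) = 8. *)
Lemma sl23_small_cyc : #|[set L in cyc Q | #|L| <= 2]| = 2.
Proof.
set T := [set L in cyc Q | _].
have sT : T \subset cyc Q by apply/subsetP=> L; rewrite in_set => /andP[].
have ordL L : L \in cyc Q -> #|L| %| 4.
  by rewrite mem_cyc => /andP[sLQ /cyclicP[u dL]]; rewrite dL -orderE sl23_order_dvd4 // -cycle_subG -dL.
have := sum_totient_cyc_group Q; rewrite oQ (big_setID T) /= (setIidPr sT).
rewrite (eq_bigr (fun=> 1%N)) => [|L]; last first.
  rewrite in_set => /andP[_]; have := cardG_gt0 L.
  by case: #|L| => [|[|[|]]] //; rewrite totient_prime.
rewrite [X in _ + X](eq_bigr (fun=> 2)) => [|L]; last first.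
  rewrite in_setD in_set negb_and => /andP[] + cL; rewrite cL /= -ltnNge => lt2.
  suff -> : #|L| = 4 by [].
  have: #|L| %| 2 ^ 2 by apply: ordL.
  case/(dvdn_pfactor _ _ (isT : prime 2)) => m le_m oL.
  by move: lt2; rewrite oL; case: m le_m {oL} => [|[|[|]]].
rewrite !sum_nat_const cardsD (setIidPr sT) cQ.
have := subset_leq_card sT; rewrite cQ.
by move: #|T| => t; clear; lia.
Qed.

Lemma sl23_involution u v : u \in Q -> v \in Q -> #[u] = 2 -> #[v] = 2 -> u = v.
Proof.
move=> Qu Qv ou ov; apply/eqP; apply: contraT => ne_uv.
pose T := [set 1%G; <[u]>%G; <[v]>%G].
have sT : T \subset [set L in cyc Q | #|L| <= 2].
  apply/subsetP=> L; rewrite in_set !inE -mem_cyc => /orP[/orP[]|] /eqP ->.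
  - by rewrite cyc1 cards1.
  - by rewrite cycle_cyc Qu -orderE ou.
  by rewrite cycle_cyc Qv -orderE ov.
have := subset_leq_card sT; rewrite sl23_small_cyc.
have ne1 (w : gT) : #[w] = 2 -> 1%G != <[w]>%G.
  by move=> ow; apply/eqP=> /(congr1 (fun L : {group gT} => #|L|)) /=; rewrite cards1 -orderE ow.
have nuv : <[u]>%G != <[v]>%G.
  apply: contra ne_uv => /eqP/(congr1 (fun L : {group gT} => u \in L)) /=.
  rewrite cycle_id => /esym; rewrite cycle2g // !inE => /orP[/eqP u1|] //.
  by rewrite u1 order1 in ou.
by rewrite /T -setUA cardsU1 cards2 nuv !inE negb_or !ne1.
Qed.

(** Let x move i in Q, and put j = i^x, k = j^x. All three square to the unique involution z, and k
    lies in the coset <i> j but not in <j>: either k = i j, or k = i^-1 j and the relations hold for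
    the inverses of i and j. *)
Lemma sl23_quaternion : exists i, exists j,
  [/\ sl23_rel i j x, i ^+ 2 != 1 & <<[set i; j; x]>> = G].
Proof.
have x3 : x ^+ 3 = 1 by rewrite -ox expg_order.
have [i0 Qi0 nci0] : exists2 u, u \in Q & u \notin 'C[x].
  apply/subsetPn; apply/negP=> sQC; have /setIidPl defQ := sQC.
  by move: oC; rewrite defQ oQ.
have [z Cz oz] : exists2 z, z \in 'C_Q[x] & #[z] = 2.
  by have [||z Cz oz] := @Cauchy _ 2 'C_Q[x]%G; rewrite ?oC //; exists z.
have Qz : z \in Q by case/setIP: Cz.
have defC : 'C_Q[x] = [set 1; z].
  by apply/eqP; rewrite -cycle2g // eq_sym eqEcard cycle_subG Cz oC -orderE oz.
have sq u : u \in Q -> u \notin 'C[x] -> u ^+ 2 = z.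
  move=> Qu ncu; apply: sl23_involution => //; first by rewrite groupX.
  apply: nt_prime_order => //; first by rewrite -expgM; apply/eqP; rewrite -order_dvdn sl23_order_dvd4.
  apply: contra ncu => /eqP u2; have [->|nt_u] := eqVneq u 1; first exact: group1.
  have uz : u = z by apply: sl23_involution => //; apply: nt_prime_order.
  by rewrite uz; case/setIP: Cz.
have z2 : z ^+ 2 = 1 by rewrite -oz expg_order.
have nt_z : z != 1 by rewrite -order_gt1 oz.
have o4 u : u \in Q -> u \notin 'C[x] -> #[u] = 4.
  by move=> Qu ncu; have u2 := sq u Qu ncu; apply: order_eq4; rewrite ?(expgM u 2 2) u2.
have cxE u : (u \in 'C[x]) = (u ^ x == u).
  apply/cent1P/eqP=> [c | /conjg_fixP/commgP c]; last exact: commute_sym.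
  by apply/conjg_fixP/commgP/commute_sym.
have zx : z ^ x = z by apply/eqP; rewrite -cxE; case/setIP: Cz.
(* A cyclic group of order 4 has only the identity and inversion as automorphisms; inversion is
   excluded because its cube would be induced by x^3 = 1. *)
have nNx u : u \in Q -> u \notin 'C[x] -> x \notin 'N(<[u]>).
  move=> Qu ncu; apply/negP => nux; have ntu := ncu; rewrite cxE in ntu.
  have : u ^ x \in <[u]> by rewrite memJ_norm // cycle_id.
  case/cyclePmin=> k; rewrite o4 // => lt_k uxk.
  have u4 : u ^+ 4 = 1 by rewrite -(o4 u) // expg_order.
  case: k lt_k uxk => [|[|[|[|]]]] // _ uxk.
  - by move: ncu; rewrite -(conjgK x u) uxk expg0 conj1g group1.
  - by rewrite uxk expg1 eqxx in ntu.
  - have uz : u = z by apply: (conjg_inj x); rewrite zx uxk sq.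
    by move: ncu; rewrite uz; case/setIP: Cz => _ ->.
  have uV : u ^ x = u^-1 by rewrite uxk; apply: (mulgI u); rewrite mulgV -expgS.
  have : u ^ (x ^+ 3) = u^-1.
    by rewrite (expgS x 2) (expgS x 1) expg1 !conjgM uV conjVg uV invgK uV.
  rewrite x3 conjg1 => uu; have := sq u Qu ncu; rewrite expgS expg1 {2}uu mulgV.
  by move/esym/eqP; rewrite (negPf nt_z).
pose i := i0; have [Qi nci] : i \in Q /\ i \notin 'C[x] by [].
have QJ u : u \in Q -> u ^ x \in Q by move=> Qu; rewrite memJ_norm.
have cJ u : u \notin 'C[x] -> u ^ x \notin 'C[x].
  by rewrite !cxE (inj_eq (conjg_inj x)).
pose j := i ^ x; have [Qj ncj] : j \in Q /\ j \notin 'C[x] by rewrite QJ ?cJ.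
pose k := j ^ x; have [Qk nck] : k \in Q /\ k \notin 'C[x] by rewrite QJ ?cJ.
have nIj : j \notin <[i]>.
  by apply: contra (nNx i Qi nci) => Ij; rewrite inE -cycleJ cycle_subG.
have nJk : k \notin <[j]>.
  by apply: contra (nNx j Qj ncj) => Jk; rewrite inE -cycleJ cycle_subG.
have nIk : k \notin <[i]>.
  apply: contra (nNx i Qi nci) => Ik.
  have nx2 : x ^+ 2 \in 'N(<[i]>) by rewrite inE -cycleJ cycle_subG expgS expg1 conjgM.
  have -> : x = x ^+ 2 ^+ 2 by rewrite -expgM (expgD x 3 1) x3 mul1g.
  exact: groupX.
have oi : #[i] = 4 by apply: o4.
have defQ : <[i]> :|: <[i]> :* j = Q.
  apply/eqP; rewrite eqEcard subUset cycle_subG Qi mul_subG ?cycle_subG ?sub1set //=.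
  rewrite cardsU disjoint_setI0 ?cards0 ?card_rcoset -?orderE ?oi ?oQ //.
  apply/pred0P=> u /=; rewrite mem_rcoset; apply/andP=> [[Iu Iuj]].
  by move: nIj; rewrite -groupV -(groupMl _ Iu) Iuj.
have ij : i ^ j = i^-1.
  have Qij : i * j \in Q by rewrite groupM.
  have ncij : i * j \notin 'C[x].
    apply: contra nIj => cij; have : i * j \in 'C_Q[x] by rewrite inE Qij.
    rewrite defC -(sq i) // !inE => /orP[]/eqP ijE.
      by rewrite -(mulKg i j) ijE mulg1 groupV cycle_id.
    by rewrite -(mulKg i j) ijE groupM ?groupV ?groupX ?cycle_id.
  have := sq _ Qij ncij; rewrite -(sq i) // (expgS (i * j) 1) (expgS i 1) !expg1 -mulgA => /mulgI jij.
  have jj : j * j = i * i.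
    by have := sq j Qj ncj; rewrite -(sq i) // (expgS j 1) (expgS i 1) !expg1.
  apply: (mulgI (j * j)); rewrite {2}jj conjgE mulgK -mulgA (mulgA j j^-1) mulgV mul1g.
  exact: jij.
have i2j : i ^+ 2 = j ^+ 2 by rewrite !sq.
have gen (a b : gT) : sl23_rel a b x -> a \in Q -> b \in Q -> a ^+ 2 = z ->
    <<[set a; b; x]>> = G.
  move=> r Qa Qb a2; apply/eqP; rewrite eqEcard oG (sl23_rel_card r) ?a2 // andbT.
  rewrite gen_subG !subUset !sub1set Gx andbT.
  by rewrite (subsetP sQG _ Qa) (subsetP sQG _ Qb).
have: k \in <[i]> :|: <[i]> :* j by rewrite defQ.
rewrite inE (negPf nIk) /= => /rcosetP[v /cyclePmin[a]]; rewrite oi => lt_a -> kE.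
case: a lt_a kE => [|[|[|[|]]]] // _ kE.
- by rewrite kE expg0 mul1g cycle_id in nJk.
- have r : sl23_rel i j x by split=> //; rewrite -/k kE expg1.
  by exists i, j; split; rewrite ?sq //; apply: gen => //; apply: sq.
- by move: nJk; rewrite kE i2j -expgSr mem_cycle.
have i3 : i ^+ 3 = i^-1.
  by apply: (mulgI i); rewrite mulgV -expgS -oi expg_order.
have r : sl23_rel i^-1 j^-1 x.
  split=> //; rewrite ?expgVn ?i2j //.
  - by apply: (conjg_inj j); rewrite conjgKV invgK ij.
  - by rewrite conjVg.
  rewrite conjVg -/k kE i3 invMg invgK.
  rewrite -[in RHS]ij conjgE. by rewrite mulgA -[RHS]mulgA mulgV mulg1.
have i2 : i^-1 ^+ 2 = z.
  by rewrite expgVn sq //; apply: (mulgI z); rewrite mulgV; apply: esym z2.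
by exists i^-1, j^-1; split; rewrite ?i2 //; apply: gen; rewrite ?groupV.
Qed.

End SL23Struct.

(** * SL(2, 3) as a matrix group *)

Section Matrix22.

Import GRing.Theory.
Local Open Scope ring_scope.

Variable R : comUnitRingType.
Implicit Types a b c d : R.

Definition mx22 a b c d : 'M[R]_2 :=
  \matrix_(r, s) if r == 0 then if s == 0 then a else b else if s == 0 then c else d.

Lemma det_mx22 a b c d : \det (mx22 a b c d) = a * d - b * c.
Proof.
rewrite (expand_det_row _ ord0) !big_ord_recl big_ord0 /cofactor !det_mx11 !mxE /=.
by rewrite expr0 expr1 mul1r mulN1r addr0 mulrN.
Qed.

Lemma mul_mx22 a b c d a' b' c' d' : mx22 a b c d * mx22 a' b' c' d' =
  mx22 (a * a' + b * c') (a * b' + b * d') (c * a' + d * c') (c * b' + d * d').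
Proof.
apply/matrixP=> r s; rewrite !mxE !big_ord_recl big_ord0 !mxE /= addr0.
by case: (r == 0); case: (s == 0).
Qed.

End Matrix22.

(** Enough to fix the order: [SL23_rel] exhibits a subgroup of order 24, and 24 is the only multiple
    of 24 properly dividing 48. *)
Lemma SL23_card_dvd : #|SLgroup 2 'F_3| %| 48 /\ #|SLgroup 2 'F_3| < 48.
Proof.
have oGL : #|'GL_2['F_3]| = 48 by rewrite card_GL_2 card_Fp.
rewrite -oGL; split; first by rewrite cardSg ?subsetT.
rewrite proper_card // properE subsetT; apply/subsetPn.
have Ud : mx22 (-1 : 'F_3) 0 0 1 \is a GRing.unit by rewrite unitmxE det_mx22.
exists (FinRing.unit _ Ud); first by rewrite inE.
by rewrite inE det_mx22.
Qed.

Lemma SL23_rel : exists i, exists j, exists x,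
  [/\ sl23_rel i j x, i ^+ 2 != 1 & <<[set i; j; x]>> = SLgroup 2 'F_3].
Proof.
(* i squares to -1, x is a transvection, and j is x^-1 i x. *)
have Ui : (mx22 0 1 (-1) 0 : 'M['F_3]_2)%R \is a GRing.unit by rewrite unitmxE det_mx22.
have Uj : (mx22 1 (-1) (-1) (-1) : 'M['F_3]_2)%R \is a GRing.unit by rewrite unitmxE det_mx22.
have Ux : (mx22 1 1 0 1 : 'M['F_3]_2)%R \is a GRing.unit by rewrite unitmxE det_mx22.
pose i : {'GL_2['F_3]} := FinRing.unit _ Ui.
pose j : {'GL_2['F_3]} := FinRing.unit _ Uj.
pose x : {'GL_2['F_3]} := FinRing.unit _ Ux.
have r : sl23_rel i j x.
  split.
  - apply: val_inj; rewrite !FinRing.val_unitX /= !GRing.expr2 !mul_mx22.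
    by congr mx22; apply: val_inj.
  - have e : i * j * i = j.
      by apply: val_inj; rewrite !FinRing.val_unitM /= !mul_mx22; congr mx22; apply: val_inj.
    by apply: (mulgI j); rewrite conjgE mulKVg -[in RHS]e mulgK.
  - apply: val_inj; rewrite FinRing.val_unitX /= (GRing.exprS _ 2) GRing.expr2 !mul_mx22.
    by apply/matrixP=> a b; rewrite !mxE; apply: val_inj; case: a b => [[|[|]]] // ? [[|[|]]].
  - have e : i * x = x * j.
      by apply: val_inj; rewrite !FinRing.val_unitM /= !mul_mx22; congr mx22; apply: val_inj.
    by rewrite conjgE e mulKg.
  have e : j * x = x * (i * j).
    by apply: val_inj; rewrite !FinRing.val_unitM /= !mul_mx22; congr mx22; apply: val_inj.
  by rewrite conjgE e mulKg.
have nt : i ^+ 2 != 1.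
  apply/eqP=> /(congr1 val); rewrite FinRing.val_unitX /= GRing.expr2 mul_mx22.
  by move/matrixP/(_ 0%R 0%R); rewrite !mxE.
exists i, j, x; split=> //; apply/eqP.
have [dv lt] := SL23_card_dvd.
have sKS : <<[set i; j; x]>> \subset SLgroup 2 'F_3.
  by rewrite gen_subG !subUset !sub1set !inE !det_mx22.
rewrite eqEcard sKS (sl23_rel_card r nt) /=.
have := cardSg sKS; rewrite (sl23_rel_card r nt); case/dvdnP=> k oS.
move: dv lt; rewrite oS; case: k {oS} => [|[|k]] //.
Qed.

Lemma sl23_struct_isog (gT : finGroupType) (G : {group gT}) :
  sl23_struct G -> G \isog SLgroup 2 'F_3.
Proof.
case=> x [Q [oG [sQG Gx] [oQ ox] cQ [nQx oC]]].
have [i [j [r nt <-]]] := sl23_quaternion oG sQG Gx oQ ox cQ nQx oC.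
have [i' [j' [x' [r' nt' <-]]]] := SL23_rel.
exact: sl23_rel_isog.
Qed.

Lemma card_cyc_SL23 : #|cyc [group of SLgroup 2 'F_3]| = 13.
Proof.
have [i [j [x [r nt defS]]]] := SL23_rel.
by rewrite -(sl23_rel_card_cyc r nt); congr #|pred_of_set (cyc _)|; apply: val_inj.
Qed.

(** * The classification *)

Lemma isoGrp_isog (gT rT : finGroupType) (G : {group gT}) (H : {group rT}) p :
  G \isog Grp p -> H \isog Grp p -> G \isog H.
Proof.
move=> GrpG GrpH; apply/(isoGrpP _ GrpH); split; last exact: isoGrp_hom.
apply/eqP; rewrite eqn_leq !leq_homg //.
  by rewrite GrpG isoGrp_hom.
by rewrite GrpH isoGrp_hom.
Qed.

Lemma abelem_Z11_Z11 : 11.-abelem [set: 'Z_11 * 'Z_11] /\ #|[set: 'Z_11 * 'Z_11]| = 121.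
Proof.
split; last by rewrite cardsT card_prod card_ord.
apply/abelemP=> //; split; first by apply/centsP=> a _ b _; apply: GRing.addrC.
have X11 (c : 'Z_11) : c ^+ 11 = 1 by have := expg_cardG (in_setT c); rewrite cardsT card_ord.
case=> a b _; have -> n : (a, b) ^+ n = (a ^+ n, b ^+ n).
  by elim: n => // n IHn; rewrite !expgS IHn.
by rewrite !X11.
Qed.

Lemma cyclic_Zn n : cyclic [set: 'Z_n].
Proof. by apply/cyclicP; exists Zp1; apply: Zp_cycle. Qed.

Lemma card_Zn n : 1 < n -> #|[set: 'Z_n]| = n.
Proof. by move=> n_gt1; rewrite cardsT card_ord Zp_cast. Qed.

Lemma Grp_gtype_7_27 : [set: Extremal.gtype 7 27 4] \isog
  Grp (a : b : a ^+ 7, b ^+ 27, b * a * b^-1 = a ^+ 2).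
Proof.
have em : 4 ^ 27 = 1 %[mod 7] by rewrite (expnM 4 3 9) -modnXm exp1n.
exact: (@Grp_gtype_conjV 7 27 4 2 isT isT em erefl).
Qed.

Theorem theorem3p8 (gT : finGroupType) (G : {group gT}) :
  #|cyclic_subgroups G| = 13 <->
  (G \isog [set: 'Z_11 * 'Z_11]
   \/ (exists p : nat, prime p /\ G \isog [set: 'Z_(p ^ 12)])
   \/ G \isog 'D_22
   \/ G \isog SLgroup 2 'F_3
   \/ G \isog 'Q_32
   \/ G \isog Z11_Z5
   \/ G \isog Grp (a : b : a ^+ 7, b ^+ 8, b * a * b^-1 = a^-1)
   \/ G \isog Grp (a : b : a ^+ 5, b ^+ 16, b * a * b^-1 = a^-1)
   \/ G \isog Grp (a : b : a ^+ 3, b ^+ 32, b * a * b^-1 = a^-1)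
   \/ G \isog Grp (a : b : a ^+ 7, b ^+ 27, b * a * b^-1 = a ^+ 2)).
Proof.
(* ['Z_n] has n elements only for n > 1. *)
have exp_gt1 p : prime p -> 1 < p ^ 12.
  by move=> p_pr; apply: leq_trans (ltn_expl 12 (prime_gt1 p_pr)).
split=> [c13 |].
  have [nilG | nnilG] := boolP (nilpotent G); last first.
    case: (nonnilpotent_cyc13 c13 nnilG) => [/metacyclic13_isog | /sl23_struct_isog isoG]; last tauto.
    case=> q [m [e known isoG]]; move: known isoG; rewrite /known_gtype13 !inE.
    case/or4P=> [|||/or3P[]] /eqP[-> -> ->] isoG.
    (* ['D_22] and [Z11_Z5] are these group types by definition; the other four cases are stated by
       presentations. *)
    - by do 2!right; left.
    - by do 5!right; left.
    - by do 6!right; left; apply: isoGrp_trans isoG (@Grp_gtype_inv 7 8 isT isT isT).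
    - by do 9!right; apply: isoGrp_trans isoG Grp_gtype_7_27.
    - by do 7!right; left; apply: isoGrp_trans isoG (@Grp_gtype_inv 5 16 isT isT isT).
    by do 8!right; left; apply: isoGrp_trans isoG (@Grp_gtype_inv 3 32 isT isT isT).
  have [p pG] := nil_cyc13_pgroup c13 nilG.
  case: (pgroup_cyc13 pG c13) => [[abG oG] | [cG [q q_pr oG]] | isoG].
  - left; rewrite (isog_abelem_card _ abG) oG.
    by have [-> ->] := abelem_Z11_Z11.
  - right; left; exists q; split=> //; have gt1 := exp_gt1 q q_pr.
    by rewrite isog_cyclic_card // cyclic_Zn card_Zn ?oG //=.
  by do 4!right; left.
case=> [isoG|]; first rewrite (isog_cyc isoG).
  have [abZ oZ] := abelem_Z11_Z11.
  by apply: (@card_cyc_p2Elem _ setT _ 11) => //; apply/pnElemP; rewrite subsetT oZ; split.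
case=> [[p [p_pr isoG]]|].
  rewrite (isog_cyc isoG); apply: (card_cyc_cyclic_pgroup p_pr (cyclic_Zn _)).
  by apply: card_Zn; apply: exp_gt1.
have inv_gtype q m e p : known_gtype13 q m e -> [set: Extremal.gtype q m e] \isog Grp p ->
    G \isog Grp p -> #|cyc G| = 13.
  move=> known GrpT GrpG; rewrite (isog_cyc (isoGrp_isog GrpG GrpT)).
  exact: card_cyc_known_gtype13.
case=> [isoG|]; first by rewrite (isog_cyc isoG); apply: (@card_cyc_known_gtype13 11 2 10).
case=> [isoG|]; first by rewrite (isog_cyc isoG) card_cyc_SL23.
case=> [isoG|]; first by rewrite (isog_cyc isoG) card_cyc_Q32.
case=> [isoG|]; first by rewrite (isog_cyc isoG); apply: (@card_cyc_known_gtype13 11 5 3).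
case; first exact: (inv_gtype 7 8 6 _ _ (@Grp_gtype_inv 7 8 isT isT isT)).
case; first exact: (inv_gtype 5 16 4 _ _ (@Grp_gtype_inv 5 16 isT isT isT)).
case; first exact: (inv_gtype 3 32 2 _ _ (@Grp_gtype_inv 3 32 isT isT isT)).
exact: (inv_gtype 7 27 4 _ _ Grp_gtype_7_27).
Qed.
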